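(* Let $\Bbbk$ be a field with $\mathrm{char}\,\Bbbk\ne2$. (1) Every pair of skew-symmetric bilinear forms over $\Bbbk$ is weakly congruent to $\tilde{\mathfrak A}^\rho$ for some $\rho\in\tilde{\mathfrak F}(\Bbbk)$. (2) For $\rho,\rho'\in\tilde{\mathfrak F}(\Bbbk)$, the pairs $\tilde{\mathfrak A}^\rho$ and $\tilde{\mathfrak A}^{\rho'}$ are weakly congruent if and only if $\rho$ and $\rho'$ belong to the same orbit of $\mathfrak g=\mathrm{GL}(2,\Bbbk)$.
   Context: For pairs $\mathbf A=(A_1,A_2)$ of square matrices: $\mathbf A\circ Q=(q_{11}A_1+q_{21}A_2,\,q_{12}A_1+q_{22}A_2)$ for $Q=(q_{ij})\in\mathrm{GL}(2,\Bbbk)$, and $P\circ\mathbf A=(PA_1P^\top,PA_2P^\top)$; $\mathbf A,\mathbf A'$ are weakly congruent if $\mathbf A'=P\circ\mathbf A\circ Q$ for invertible $P,Q$. Direct sums are blockwise. For a pair $R=(R_1,R_2)$ of $r\times s$ matrices, $R^+=\left(\begin{pmatrix}0&R_i\\-R_i^\top&0\end{pmatrix}\right)_{i=1,2}$. Pairs: $R_f=(I_d,F(f))$ for $f\in\Bbbk[x]$ monic of degree $d$, $F(f)$ its companion matrix; $R_{\infty,d}=(F(x^d),I_d)$; $R_{-,d}=((I_{d-1}\mid0),(0\mid I_{d-1}))$ ($(d-1)\times d$ matrices). An irreducible homogeneous polynomial $g\in\Bbbk[x_1,x_2]$ is unital if $g=x_2$ or its leading coefficient with respect to $x_1$ is $1$.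 $\mathcal P=\mathcal P(\Bbbk)$ is the set of unital irreducible homogeneous polynomials in $\Bbbk[x_1,x_2]$, and $\tilde{\mathcal P}=\mathcal P\cup\{\varepsilon\}$ with a formal symbol $\varepsilon$. $\mathfrak g$ acts on $\Bbbk[x_1,x_2]$ by $Q\circ h=h(q_{11}x_1+q_{12}x_2,\,q_{21}x_1+q_{22}x_2)$; for $g\in\mathcal P$, $Q*g$ is the unique $g'\in\mathcal P$ with $Q\circ g=\lambda g'$ for some nonzero $\lambda\in\Bbbk$, and $Q*\varepsilon=\varepsilon$. $\tilde{\mathfrak F}(\Bbbk)$ is the set of functions $\rho:\tilde{\mathcal P}\times\mathbb N\to\mathbb Z_{\ge0}$ with $\rho(g,d)=0$ for almost all $(g,d)$; $\mathfrak g$ acts by $(\rho*Q)(g,d)=\rho(Q*g,d)$. For $(g,d)\in\tilde{\mathcal P}\times\mathbb N$ set $R(g,d)=R_{-,d}^+$ if $g=\varepsilon$, $R(g,d)=R_{\infty,d}^+$ if $g=x_2$, and $R(g,d)=R^+_{g(x,1)^d}$ otherwise. Finally $\tilde{\mathfrak A}^\rho=\bigoplus_{(g,d)}R(g,d)^{\rho(g,d)}$. *)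

(* Defs.v *)
From HB Require Import structures.
From mathcomp Require Import all_boot all_order all_algebra.
From Stdlib Require Import ClassicalEpsilon.
Set Implicit Arguments. Unset Strict Implicit. Unset Printing Implicit Defensive.
Import Order.TTheory GRing.Theory Num.Theory.
Local Open Scope ring_scope.

Section Defs.
Variable K : fieldType.

Record mpair := MPair { msz : nat; mp1 : 'M[K]_msz; mp2 : 'M[K]_msz }.

Definition skew_pair (A : mpair) : Prop :=
  (mp1 A)^T = - mp1 A /\ (mp2 A)^T = - mp2 A.

Definition act_right (A : mpair) (Q : 'M[K]_2) : mpair :=
  @MPair (msz A) (Q 0 0 *: mp1 A + Q 1 0 *: mp2 A)
                 (Q 0 1 *: mp1 A + Q 1 1 *: mp2 A).

(* weak congruence: B = P o A o Q, P invertible (written as a possibly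
   rectangular matrix with a two-sided inverse, which forces equal sizes),
   Q in GL(2,k). *)
Definition wcong (A B : mpair) : Prop :=
  exists (P : 'M[K]_(msz B, msz A)) (P' : 'M[K]_(msz A, msz B)),
    P *m P' = 1%:M /\ P' *m P = 1%:M /\
    exists Q : 'M[K]_2, Q \in unitmx /\
      let AQ := act_right A Q in
      mp1 B = P *m mp1 AQ *m P^T /\ mp2 B = P *m mp2 AQ *m P^T.

Definition dsum (A B : mpair) : mpair :=
  @MPair (msz A + msz B) (block_mx (mp1 A) 0 0 (mp1 B))
                         (block_mx (mp2 A) 0 0 (mp2 B)).

Definition mpair0 : mpair := @MPair 0 0 0.

Definition plus_pair r s (R1 R2 : 'M[K]_(r, s)) : mpair :=
  @MPair (r + s) (block_mx 0 R1 (- R1^T) 0) (block_mx 0 R2 (- R2^T) 0).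

Definition R_fin (f : {poly K}) : mpair :=
  plus_pair 1%:M (companionmx f).
Definition R_inf (d : nat) : mpair :=
  plus_pair (companionmx ('X^d : {poly K})) 1%:M.
Definition R_minus (d : nat) : mpair :=
  @plus_pair d.-1 d (\matrix_(i < d.-1, j < d) ((i == j :> nat)%:R))
                    (\matrix_(i < d.-1, j < d) ((i.+1 == j :> nat)%:R)).

(* ---------- polynomials in k[x1,x2] ----------
   k[x1,x2] is represented as {poly {poly K}}: the outer variable is x1,
   the coefficients are polynomials in x2.  *)
Definition bpoly := {poly {poly K}}.
Definition X1 : bpoly := 'X.
Definition X2 : bpoly := ('X)%:P.
Definition coef2 (h : bpoly) (i j : nat) : K := (h`_i)`_j.

Definition homogeneous (h : bpoly) : Prop :=
  exists n, forall i j, coef2 h i j != 0 -> (i + j)%N = n.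

Definition irreducible_elt (R : idomainType) (x : R) : Prop :=
  x != 0 /\ x \isn't a GRing.unit /\
  forall a b : R, x = a * b -> a \is a GRing.unit \/ b \is a GRing.unit.

Definition unital (g : bpoly) : Prop := g = X2 \/ lead_coef g = 1.

Definition inP (g : bpoly) : Prop :=
  homogeneous g /\ irreducible_elt g /\ unital g.

Definition eval2 (h a b : bpoly) : bpoly :=
  \sum_(i < size h) \sum_(j < size h`_i) (coef2 h i j)%:P%:P * (a ^+ i * b ^+ j).

Definition act_poly (Q : 'M[K]_2) (h : bpoly) : bpoly :=
  eval2 h ((Q 0 0)%:P%:P * X1 + (Q 0 1)%:P%:P * X2)
          ((Q 1 0)%:P%:P * X1 + (Q 1 1)%:P%:P * X2).

(* Q * g : the (unique) g' in P with Q o g = lambda g', lambda <> 0 *)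
Definition act_P (Q : 'M[K]_2) (g : bpoly) : bpoly :=
  epsilon (inhabits g)
    (fun g' => inP g' /\ exists lam : K, lam != 0 /\ act_poly Q g = lam%:P%:P * g').

(* ---------- the index set  P~ x N  and functions rho ----------
   P~ = P u {eps} is represented inside  option bpoly  (None = eps,
   Some g = g, with g required to lie in P); N = positive naturals, inside nat. *)
Definition ptilde := option bpoly.

(* rho in F~(k): a function P~ x N -> Z_{>=0}, almost everywhere zero;
   represented as a function on (option bpoly) x nat vanishing outside P~ x N *)
Definition Ftilde (rho : ptilde -> nat -> nat) : Prop :=
  (forall x, rho x 0%N = 0%N) /\
  (forall g d, rho (Some g) d <> 0%N -> inP g) /\
  exists s : seq (ptilde * nat), forall x d, rho x d <> 0%N -> (x, d) \in s.

Definition same_orbit (rho rho' : ptilde -> nat -> nat) : Prop :=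
  exists Q : 'M[K]_2, Q \in unitmx /\
    (forall d, rho' None d = rho None d) /\
    (forall g, inP g -> forall d, rho' (Some g) d = rho (Some (act_P Q g)) d).

Definition Rblock (x : ptilde) (d : nat) : mpair :=
  match x with
  | None => R_minus d
  | Some g => if g == X2 then R_inf d
              else R_fin ((map_poly (fun c : {poly K} => c.[1]) g) ^+ d)
  end.

Definition Atilde_seq (s : seq (ptilde * nat)) : mpair :=
  foldr (fun xd acc => dsum (Rblock xd.1 xd.2) acc) mpair0 s.

(* s lists every (g,d) exactly rho(g,d) times, so that Atilde_seq s is
   A~^rho = (+)_{(g,d)} R(g,d)^{rho(g,d)} (with the summands in some order) *)
Definition realizes (s : seq (ptilde * nat)) (rho : ptilde -> nat -> nat) : Prop :=
  forall x d, count_mem (x, d) s = rho x d.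

End Defs.

(* Main.v *)
(* A pair of skew-symmetric matrices is a pencil. Existence: if the pencil has a polynomial
   kernel vector of minimal degree e, its coefficients span an isotropic space U, and a dual
   isotropic space W on which the pencil restricts to the block R_-; the linear system
   defining W is solvable because of the minimality of e. If there is no such vector and A1
   is singular, a longest Jordan chain at infinity has a dual chain. If A1 is invertible,
   A2 A1^-1 is self-adjoint for the alternating form A1, so its cyclic submodules are
   isotropic and one of maximal primary order pairs perfectly with another one. In each case
   U + W is a direct summand with an orthogonal complement, and one inducts.

   Equivalence: R(g,d) is the double of the pencil of multiplications by x2 and x1 from the
   forms of degree n-1 to the forms of degree n modulo g^d, so a linear substitution of the
   variables carries R(g,d) to R(Q*g,d). Uniqueness under strict congruence follows from the
   dimensions of the spaces of morphisms from fixed test pencils, whose second differences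
   are the multiplicities. *)
Require Import Defs.
From HB Require Import structures.
From mathcomp Require Import all_boot all_order all_algebra.
From mathcomp Require Import zify ring.
From Stdlib Require Import ClassicalEpsilon Classical.
Set Implicit Arguments. Unset Strict Implicit. Unset Printing Implicit Defensive.
Import Order.TTheory GRing.Theory Num.Theory.
Local Open Scope ring_scope.

(** * Congruence of pairs *)

Section Congruence.
Variable K : fieldType.
Implicit Types A B C : mpair K.

(** Existence is proved for strict congruence. All isotropy there rests on one remark: if an index
    can be shifted from one side of a form to the other, the Gram matrix is Hankel, hence symmetric,
    and being skew it vanishes in characteristic other than 2. Chain equations and self-adjointness
    both provide such shifts. The dual spaces of the singular and infinite cases come from the
    Fredholm alternative for the trace pairing: an obstruction to solving the linear system would
    contradict the extremal choice of the chain. The order of the cases is forced, since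
    independence of a chain at infinity uses the absence of kernel vectors. In the uniqueness count,
    doubling makes both a pencil and its transpose visible: a regular block counts twice, while an
    epsilon block answers a regular test pencil through one half only, by an amount linear in the
    exponent that the second difference removes. Finally, [hat] is the transpose conjugated by the
    swap: [Q] combines the matrices of a pair by columns but the variables by rows, and the first
    matrix of a block stands for multiplication by x2. *)

Definition cong A B : Prop :=
  exists (P : 'M[K]_(msz B, msz A)) (P' : 'M[K]_(msz A, msz B)),
    [/\ P *m P' = 1%:M, P' *m P = 1%:M,
        mp1 B = P *m mp1 A *m P^T & mp2 B = P *m mp2 A *m P^T].

Lemma wcongE A B :
  wcong A B <-> exists2 Q : 'M[K]_2, Q \in unitmx & cong (act_right A Q) B.
Proof.
split=> [[P [P' [H1 [H2 [Q [uQ [e1 e2]]]]]]] | [Q uQ [P [P' [H1 H2 e1 e2]]]]].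
  by exists Q => //; exists P, P'; split.
by exists P, P'; split => //; split => //; exists Q.
Qed.

Lemma cong_refl A : cong A A.
Proof. by exists 1%:M, 1%:M; rewrite !mul1mx trmx1 !mulmx1. Qed.

Lemma cong_sym A B : cong A B -> cong B A.
Proof.
case=> P [P' [H1 H2 e1 e2]]; exists P', P; split=> //.
  by rewrite e1 !mulmxA H2 mul1mx -mulmxA -trmx_mul H2 trmx1 mulmx1.
by rewrite e2 !mulmxA H2 mul1mx -mulmxA -trmx_mul H2 trmx1 mulmx1.
Qed.

Lemma cong_trans B A C : cong A B -> cong B C -> cong A C.
Proof.
case=> P [P' [H1 H2 e1 e2]] [R [R' [G1 G2 f1 f2]]].
exists (R *m P), (P' *m R'); split.
- by rewrite mulmxA -(mulmxA R) H1 mulmx1.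
- by rewrite mulmxA -(mulmxA P') G2 mulmx1.
- by rewrite f1 e1 trmx_mul !mulmxA.
by rewrite f2 e2 trmx_mul !mulmxA.
Qed.

Lemma cong_dsum A A' B B' : cong A A' -> cong B B' -> cong (dsum A B) (dsum A' B').
Proof.
case=> P [P' [H1 H2 e1 e2]] [R [R' [G1 G2 f1 f2]]].
exists (block_mx P 0 0 R), (block_mx P' 0 0 R'); split.
- by rewrite /= mulmx_block !mulmx0 !mul0mx !addr0 !add0r H1 G1 -scalar_mx_block.
- by rewrite /= mulmx_block !mulmx0 !mul0mx !addr0 !add0r H2 G2 -scalar_mx_block.
- rewrite /= tr_block_mx !mulmx_block !trmx0.
  by rewrite !(mulmx0, mul0mx, addr0, add0r) e1 f1.
rewrite /= tr_block_mx !mulmx_block !trmx0.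
by rewrite !(mulmx0, mul0mx, addr0, add0r) e2 f2.
Qed.

Lemma cong_dsumCA A B C : cong (dsum A (dsum B C)) (dsum B (dsum A C)).
Proof.
have H0 := (mulmx0, mul0mx, mulmx1, mul1mx, addr0, add0r, row_mx0, col_mx0).
have H1 := (tr_block_mx, tr_row_mx, tr_col_mx, trmx0, trmx1).
have H2 := (mul_row_block, mul_block_col, mul_row_col, mul_mx_row, mul_col_mx).
pose P m n p : 'M[K]_(n + (m + p), m + (n + p)) :=
  block_mx 0 (row_mx 1%:M 0) (col_mx 1%:M 0) (block_mx 0 0 0 1%:M).
have D m1 m2 n1 n2 (x : 'M[K]_(m1, n1)) (y : 'M[K]_(m2, n2)) :
    row_mx (col_mx x 0) 0 + col_mx 0 (row_mx 0 y) = block_mx x 0 0 y.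
  rewrite -[X in row_mx _ X]col_mx0 -block_mxEh -[X in col_mx X _]row_mx0.
  by rewrite -block_mxEv add_block_mx !H0.
have E m n p (a : 'M[K]_m) (b : 'M[K]_n) (c : 'M[K]_p) :
   block_mx b 0 0 (block_mx a 0 0 c) =
   P m n p *m block_mx a 0 0 (block_mx b 0 0 c) *m (P m n p)^T.
  rewrite /P !H1 !mulmx_block !H0 !H2 !H0.
  by rewrite D.
have U m n p : P m n p *m (P m n p)^T = 1%:M.
  rewrite /P !H1 !mulmx_block !H0 !H2 !H0.
  rewrite -[X in row_mx _ X]col_mx0 -block_mxEh add_block_mx !H0.
  by rewrite -!scalar_mx_block.
exists (P (msz A) (msz B) (msz C)), (P (msz A) (msz B) (msz C))^T.
split; [exact: U | | exact: (E _ _ _ (mp1 A)) | exact: (E _ _ _ (mp2 A))].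
have -> : P (msz A) (msz B) (msz C) = (P (msz B) (msz A) (msz C))^T by rewrite /P !H1.
by rewrite trmxK U.
Qed.

Lemma dsum_act A B Q : act_right (dsum A B) Q = dsum (act_right A Q) (act_right B Q).
Proof.
rewrite /act_right /dsum /=; congr MPair;
  by rewrite !scale_block_mx add_block_mx !scaler0 !addr0.
Qed.

Lemma mulmx2E (Q Q' : 'M[K]_2) i j : (Q *m Q') i j = Q i 0 * Q' 0 j + Q i 1 * Q' 1 j.
Proof.
rewrite !mxE !big_ord_recl !big_ord0 !addr0.
by have -> : lift ord0 ord0 = 1 :> 'I_2 by apply: val_inj.
Qed.

Lemma act_rightM A (Q Q' : 'M[K]_2) : act_right (act_right A Q) Q' = act_right A (Q *m Q').
Proof.
rewrite /act_right /=; congr MPair; rewrite !mulmx2E;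
  by rewrite !scalerDr !scalerDl !scalerA addrACA -!(mulrC (Q' _ _)).
Qed.

Lemma act_right1 A : act_right A 1%:M = A.
Proof.
case: A => n A1 A2; rewrite /act_right /=; congr MPair;
  by rewrite !mxE /= !scale0r !scale1r ?addr0 ?add0r.
Qed.

Lemma cong_act A B Q : cong A B -> cong (act_right A Q) (act_right B Q).
Proof.
case=> P [P' [H1 H2 e1 e2]]; exists P, P'; split=> //=;
  by rewrite e1 e2 mulmxDr mulmxDl -!scalemxAr -!scalemxAl.
Qed.

Lemma plus_pair_act r s (R1 R2 : 'M[K]_(r, s)) Q :
  act_right (plus_pair R1 R2) Q =
  plus_pair (Q 0 0 *: R1 + Q 1 0 *: R2) (Q 0 1 *: R1 + Q 1 1 *: R2).
Proof.
rewrite /act_right /plus_pair /=; congr MPair;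
  rewrite !scale_block_mx add_block_mx !scaler0 !addr0; congr block_mx;
  by rewrite [in RHS]linearD !linearZ /= !scalerN -opprD.
Qed.

(** Equivalence of pencils lifts to congruence of their doubles: the second half is transformed by
    the contragredient of [S], which treats [R] and [- R^T] consistently. *)
Lemma cong_plus r s (R1 R2 R1' R2' : 'M[K]_(r, s)) (P : 'M_r) (S : 'M_s) :
  P \in unitmx -> S \in unitmx ->
  P *m R1 = R1' *m S -> P *m R2 = R2' *m S ->
  cong (plus_pair R1 R2) (plus_pair R1' R2').
Proof.
move=> uP uS e1 e2; pose T := (invmx S)^T.
have F (X X' : 'M[K]_(r, s)) : P *m X = X' *m S ->
    block_mx 0 X' (- X'^T) 0 =
    block_mx P 0 0 T *m block_mx 0 X (- X^T) 0 *m (block_mx P 0 0 T)^T.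
  move=> e; rewrite tr_block_mx !mulmx_block !trmx0.
  rewrite !(mulmx0, mul0mx, addr0, add0r) /T trmxK e mulmxK //.
  congr block_mx; rewrite mulmxN mulNmx -mulmxA -trmx_mul e.
  by rewrite trmx_mul mulmxA -trmx_mul mulmxV // trmx1 mul1mx.
exists (block_mx P 0 0 T), (block_mx (invmx P) 0 0 S^T); split; [| |exact: F..].
  rewrite mulmx_block !(mulmx0, mul0mx, addr0, add0r) mulmxV // -trmx_mul mulmxV //.
  by rewrite trmx1 -scalar_mx_block.
rewrite mulmx_block !(mulmx0, mul0mx, addr0, add0r) mulVmx // -trmx_mul mulVmx //.
by rewrite trmx1 -scalar_mx_block.
Qed.

Definition valid_block (xd : ptilde K * nat) : Prop :=
  (0 < xd.2)%N /\ forall g, xd.1 = Some g -> inP g.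

Lemma Atilde_mid s1 x s2 : cong (Atilde_seq (s1 ++ x :: s2)) (Atilde_seq (x :: s1 ++ s2)).
Proof.
elim: s1 => [|y s1 IH]; first exact: cong_refl.
apply: cong_trans (cong_dsumCA (Rblock y.1 y.2) (Rblock x.1 x.2) _).
exact: cong_dsum (cong_refl _) IH.
Qed.

Lemma Atilde_perm s s' : perm_eq s s' -> cong (Atilde_seq s) (Atilde_seq s').
Proof.
elim: s s' => [|x s IH] s' e; first by move: e; rewrite perm_sym => /perm_nilP ->; apply: cong_refl.
have xs' : x \in s' by rewrite -(perm_mem e) mem_head.
case/splitPr: xs' e => p1 p2.
rewrite perm_sym -[x :: p2]cat1s perm_catCA perm_cons perm_sym => e.
apply: cong_trans (cong_sym (Atilde_mid _ _ _)).
exact: cong_dsum (cong_refl _) (IH _ e).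
Qed.
End Congruence.

(** * Homogeneous polynomials in two variables *)

Section Homogeneous.
Variable K : fieldType.
Implicit Types (g h : bpoly K) (p q f : {poly K}) (Q : 'M[K]_2).

Definition scal (c : K) : bpoly K := c%:P%:P.
(* [hom N p] is homogeneous of degree [N] with coefficient [p`_i] at [x1^i x2^(N-i)];
   the coefficients of [p] above degree [N] are dropped. *)
Definition hom N p : bpoly K := \poly_(i < N.+1) (p`_i *: 'X^(N - i)).
Definition dehom g : {poly K} := map_poly (fun c : {poly K} => c.[1]) g.

Lemma coef_hom N p i : (hom N p)`_i = if (i <= N)%N then p`_i *: 'X^(N - i) else 0.
Proof. by rewrite coef_poly ltnS. Qed.

Lemma dehomE g : dehom g = map_poly (horner_eval (1 : K)) g.
Proof. by []. Qed.

Lemma coef_dehom g i : (dehom g)`_i = (g`_i).[1].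
Proof. by rewrite dehomE coef_map. Qed.

Lemma dehomM g h : dehom (g * h) = dehom g * dehom h.
Proof. by rewrite !dehomE rmorphM. Qed.

Lemma homK N p : (size p <= N.+1)%N -> dehom (hom N p) = p.
Proof.
move=> sp; apply/polyP=> i; rewrite coef_dehom coef_hom.
case: leqP => h; first by rewrite hornerZ hornerXn expr1n mulr1.
by rewrite horner0 nth_default // (leq_trans sp).
Qed.

Lemma hom0 N : hom N 0 = 0.
Proof. by apply/polyP=> i; rewrite coef_hom coef0 scale0r coef0 if_same. Qed.

Lemma homD N p q : hom N (p + q) = hom N p + hom N q.
Proof.
apply/polyP=> i; rewrite coefD !coef_hom coefD.
by case: leqP; rewrite ?addr0 // scalerDl.
Qed.

Lemma homZ N c p : hom N (c *: p) = scal c * hom N p.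
Proof.
apply/polyP=> i; rewrite coefCM !coef_hom coefZ.
by case: leqP; rewrite ?mulr0 // mul_polyC scalerA.
Qed.

Lemma hom_sum N (I : Type) (r : seq I) P (F : I -> {poly K}) :
  hom N (\sum_(i <- r | P i) F i) = \sum_(i <- r | P i) hom N (F i).
Proof. by elim/big_rec2: _ => [|i x y _ <-]; rewrite ?hom0 ?homD. Qed.

Lemma homM N M p q : (size p <= N.+1)%N -> (size q <= M.+1)%N ->
  hom (N + M) (p * q) = hom N p * hom M q.
Proof.
move=> sp sq; apply/polyP=> k; rewrite coefM coef_hom coefM.
under [RHS]eq_bigr => i _.
  rewrite (_ : _ * _ = (p`_i * q`_(k - i)) *: 'X^(N + M - k)); last first.
    rewrite !coef_hom; case: leqP => hi; last first.
      by rewrite (nth_default _ (leq_trans sp hi)) !(mul0r, scale0r).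
    case: leqP => hj; last first.
      by rewrite (nth_default _ (leq_trans sq hj)) !(mulr0, scale0r).
    rewrite -scalerAl -scalerAr scalerA -exprD; congr (_ *: 'X^_).
    by have := ltn_ord i; lia.
  over.
rewrite -scaler_suml; case: leqP => // hk.
rewrite big1 ?scale0r // => i _.
case: (leqP i N) => hi; last by rewrite (nth_default _ (leq_trans sp hi)) mul0r.
by rewrite (nth_default _ (leq_trans sq _)) ?mulr0 //; have := ltn_ord i; lia.
Qed.

Lemma hom_exp N p d : (size p <= N.+1)%N -> hom (N * d) (p ^+ d) = hom N p ^+ d.
Proof.
move=> sp; have sx k : (size (p ^+ k) <= (N * k).+1)%N.
  elim: k => [|k IH]; first by rewrite expr0 size_poly1.
  rewrite exprS (leq_trans (size_polyMleq _ _)) // mulnS.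
  by move: sp IH; move: (size p) (size _) => a b; lia.
elim: d => [|d IH].
  rewrite muln0 !expr0; apply/polyP=> i; rewrite coef_hom leqn0 !coef1.
  by case: eqP => // ->; rewrite subn0 expr0 scale1r.
by rewrite mulnS !exprS homM // IH.
Qed.

Lemma homX1 N p : hom N.+1 ('X * p) = X1 K * hom N p.
Proof.
apply/polyP=> i; rewrite /X1 !(mulrC 'X) coefMX !coef_hom coefMX.
by case: i => [|i] /=; rewrite ?scale0r // subSS ltnS.
Qed.

Lemma homX2 N p : (size p <= N.+1)%N -> hom N.+1 p = X2 K * hom N p.
Proof.
move=> sp; apply/polyP=> i; rewrite coefCM !coef_hom.
case: (leqP i N) => hi; first by rewrite leqW // -scalerAr -exprS subSn.
by rewrite mulr0 (nth_default _ (leq_trans sp hi)) scale0r if_same.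
Qed.

Lemma hom_inj N p q : (size p <= N.+1)%N -> (size q <= N.+1)%N ->
  hom N p = hom N q -> p = q.
Proof. by move=> sp sq e; rewrite -(homK sp) e homK. Qed.

Lemma hom_homogeneous N p : homogeneous (hom N p).
Proof.
exists N => i j; rewrite /coef2 coef_hom; case: leqP => hi; last by rewrite coef0 eqxx.
rewrite coefZ coefXn; case: (j =P _) => [->|]; rewrite ?mulr0 ?eqxx // => _.
by rewrite subnKC.
Qed.

Lemma homogeneous_hom h : homogeneous h ->
  exists2 N, (size (dehom h) <= N.+1)%N & h = hom N (dehom h).
Proof.
case=> N hN; have e i : h`_i = if (i <= N)%N then (dehom h)`_i *: 'X^(N - i) else 0.
  rewrite coef_dehom; have z j : (i + j)%N <> N -> (h`_i)`_j = 0.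
    by move=> ne; apply/eqP/negP=> /negP /hN.
  case: leqP => hi; last by apply/polyP=> j; rewrite coef0 z //; lia.
  have -> : h`_i = (h`_i)`_(N - i) *: 'X^(N - i).
    apply/polyP=> j; rewrite coefZ coefXn; case: (j =P (N - i)%N) => [->|ne].
      by rewrite mulr1.
    by rewrite mulr0 z //; lia.
  by rewrite hornerZ hornerXn expr1n mulr1.
exists N; last by apply/polyP=> i; rewrite coef_hom e.
by apply/leq_sizeP=> j hj; rewrite coef_dehom e leqNgt hj horner0.
Qed.

Definition ev2 (a b : bpoly K) : {poly K} -> bpoly K :=
  horner_eval b \o map_poly (@polyC {poly K} \o @polyC K).

(** Two nested Horner evaluations replace the double sum; each is a ring morphism, and this is how
    the action on polynomials is seen to be multiplicative. *)
Lemma eval2E h a b : eval2 h a b = (map_poly (ev2 a b) h).[a].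
Proof.
rewrite horner_poly; apply: eq_bigr => i _.
rewrite /ev2 /= /horner_eval horner_poly mulr_suml; apply: eq_bigr => j _.
by rewrite /coef2 /=; ring.
Qed.

Definition sbX1 Q : bpoly K := scal (Q 0 0) * X1 K + scal (Q 0 1) * X2 K.
Definition sbX2 Q : bpoly K := scal (Q 1 0) * X1 K + scal (Q 1 1) * X2 K.
Definition act_rm Q : {rmorphism bpoly K -> bpoly K} :=
  (horner_eval (sbX1 Q) \o map_poly (ev2 (sbX1 Q) (sbX2 Q)) : bpoly K -> bpoly K).

Lemma act_rmE Q h : act_poly Q h = act_rm Q h.
Proof. by rewrite /act_poly eval2E. Qed.

Lemma eval2_scal a b c : eval2 (scal c) a b = scal c.
Proof. by rewrite eval2E map_polyC hornerC /ev2 /= map_polyC /horner_eval hornerC. Qed.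

Lemma eval2_X1 a b : eval2 (X1 K) a b = a.
Proof. by rewrite eval2E map_polyX hornerX. Qed.

Lemma eval2_X2 a b : eval2 (X2 K) a b = b.
Proof. by rewrite eval2E map_polyC hornerC /ev2 /= map_polyX /horner_eval hornerX. Qed.

Lemma eval2_id h : eval2 h (X1 K) (X2 K) = h.
Proof.
rewrite -[RHS]coefK poly_def; apply: eq_bigr => i _.
rewrite -[X in X *: _]coefK poly_def -mul_polyC rmorph_sum /= mulr_suml.
apply: eq_bigr => j _; rewrite -mul_polyC !rmorphM /= rmorphXn /coef2 /X1 /X2; ring.
Qed.

Lemma act_rm_eval2 Q h a b : act_rm Q (eval2 h a b) = eval2 h (act_rm Q a) (act_rm Q b).
Proof.
rewrite /eval2 rmorph_sum; apply: eq_bigr => i _; rewrite rmorph_sum.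
apply: eq_bigr => j _; rewrite !rmorphM !rmorphXn; congr (_ * _).
by rewrite -act_rmE [act_poly _ _]eval2_scal.
Qed.

Lemma act_rm_scal Q c : act_rm Q (scal c) = scal c.
Proof. by rewrite -act_rmE [act_poly _ _]eval2_scal. Qed.

Lemma act_rm_X1 Q : act_rm Q (X1 K) = sbX1 Q.
Proof. by rewrite -act_rmE [act_poly _ _]eval2_X1. Qed.

Lemma act_rm_X2 Q : act_rm Q (X2 K) = sbX2 Q.
Proof. by rewrite -act_rmE [act_poly _ _]eval2_X2. Qed.

Lemma scalD a b : scal (a + b) = scal a + scal b.
Proof. by rewrite /scal !rmorphD. Qed.
Lemma scalM a b : scal (a * b) = scal a * scal b.
Proof. by rewrite /scal !rmorphM. Qed.

(** The rows of [Q'] are the linear forms put in place of the variables; substituting the rows of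
    [Q] into them multiplies [Q'] on the right, whence the reversed order. *)
Lemma act_rmM Q Q' h : act_rm Q (act_rm Q' h) = act_rm (Q' *m Q) h.
Proof.
rewrite -[act_rm Q' h]act_rmE -[RHS]act_rmE /act_poly act_rm_eval2.
congr (eval2 h _ _); rewrite rmorphD !rmorphM !act_rm_scal act_rm_X1 act_rm_X2;
  by rewrite /sbX1 /sbX2 !mulmx2E -/(scal _) -/(scal _) !scalD !scalM; ring.
Qed.

Lemma act_rm1 h : act_rm 1%:M h = h.
Proof.
rewrite -act_rmE -[RHS]eval2_id /act_poly; congr (eval2 h _ _);
  by rewrite !mxE /= ?mul0r ?mul1r ?addr0 ?add0r.
Qed.

Lemma act_rmK Q : Q \in unitmx -> cancel (act_rm Q) (act_rm (invmx Q)).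
Proof. by move=> uQ h; rewrite act_rmM mulmxV // act_rm1. Qed.

Lemma act_rmVK Q : Q \in unitmx -> cancel (act_rm (invmx Q)) (act_rm Q).
Proof. by move=> uQ h; rewrite act_rmM mulVmx // act_rm1. Qed.

Lemma homE N p : hom N p = \sum_(i < N.+1) scal p`_i * (X1 K ^+ i * X2 K ^+ (N - i)).
Proof.
rewrite /hom poly_def; apply: eq_bigr => i _.
by rewrite -!mul_polyC !rmorphM /= /X1 /X2 rmorphXn /scal /=; ring.
Qed.

Lemma hom1 a b : hom 1 (a *: 'X + b%:P) = scal a * X1 K + scal b * X2 K.
Proof.
rewrite homE !big_ord_recl big_ord0 /= !coefD !coefZ !coefX !coefC /=.
by rewrite mulr0 mulr1 add0r !addr0 expr0 expr1 mul1r mulr1 addrC.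
Qed.

(** The degree is explicit and zero is allowed in every degree, so that sums and products can be
    tracked; [homogeneous] hides the degree. *)
Definition ishom N h := exists2 p : {poly K}, (size p <= N.+1)%N & h = hom N p.

Lemma ishomM N M g h : ishom N g -> ishom M h -> ishom (N + M) (g * h).
Proof.
case=> p sp -> [q sq ->]; exists (p * q); last by rewrite homM.
by rewrite (leq_trans (size_polyMleq _ _)) //; move: sp sq; lia.
Qed.

Lemma ishomX N h d : ishom N h -> ishom (N * d) (h ^+ d).
Proof.
move=> H; elim: d => [|d IH]; last by rewrite mulnS exprS; apply: ishomM.
rewrite muln0 expr0; exists 1; first by rewrite size_poly1.
apply/polyP=> i; rewrite coef_hom leqn0 !coef1.
by case: eqP => // ->; rewrite subn0 expr0 scale1r.
Qed.

Lemma ishomE N h : ishom N h -> h = hom N (dehom h).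
Proof. by case=> p sp ->; rewrite homK. Qed.

Lemma ishom_size N h : ishom N h -> (size (dehom h) <= N.+1)%N.
Proof. by case=> p sp ->; rewrite homK. Qed.

Lemma ishom_act N h Q : ishom N h -> ishom N (act_rm Q h).
Proof.
case=> p sp ->; rewrite homE rmorph_sum.
have sD a b : ishom N a -> ishom N b -> ishom N (a + b).
  case=> x sx -> [y sy ->]; exists (x + y); last by rewrite homD.
  by rewrite (leq_trans (size_polyD _ _)) // geq_max sx.
elim/big_ind: _ => // [|i _]; first by exists 0; rewrite ?size_poly0 ?hom0.
rewrite !rmorphM !rmorphXn act_rm_scal act_rm_X1 act_rm_X2.
have s1 a b : ishom 1 (scal a * X1 K + scal b * X2 K).
  exists (a *: 'X + b%:P); last by rewrite hom1.
  rewrite (leq_trans (size_polyD _ _)) // geq_max size_polyC.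
  by rewrite (leq_trans (size_scale_leq _ _)) ?size_polyX ?(leq_trans (leq_b1 _)).
have [q sq ->] : ishom N (sbX1 Q ^+ i * sbX2 Q ^+ (N - i)).
  have := ishomM (ishomX i (s1 (Q 0 0) (Q 0 1))) (ishomX (N - i) (s1 (Q 1 0) (Q 1 1))).
  by rewrite !mul1n subnKC // -ltnS.
exists (p`_i *: q); last by rewrite homZ.
exact: leq_trans (size_scale_leq _ _) sq.
Qed.
End Homogeneous.

(** * Unital irreducible polynomials *)

Section UnitalIrreducible.
Variable K : fieldType.
Implicit Types (g h : bpoly K) (p q f : {poly K}) (Q : 'M[K]_2).

Lemma unit_bpolyP h : reflect (exists2 c : K, c != 0 & h = scal c) (h \is a GRing.unit).
Proof.
rewrite poly_unitE; apply: (iffP andP) => [[/size_poly1P [p p0 ->]]|[c c0 ->]].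
  rewrite coefC eqxx poly_unitE => /andP[/size_poly1P [c c0 ->] _].
  by exists c.
rewrite /scal size_polyC polyC_eq0 c0 coefC eqxx poly_unitE size_polyC c0 coefC eqxx.
by rewrite unitfE.
Qed.

Lemma size_hom p : p != 0 -> size (hom (size p).-1 p) = size p.
Proof.
move=> p0; rewrite /hom size_poly_eq ?prednK ?lt0n ?size_poly_eq0 //.
by rewrite subnn expr0 scaler_eq0 lead_coef_eq0 (negPf p0) oner_eq0.
Qed.

Lemma hom_sizeM p q : p != 0 -> q != 0 ->
  hom (size (p * q)).-1 (p * q) = hom (size p).-1 p * hom (size q).-1 q.
Proof.
move=> p0 q0; rewrite -homM ?prednK ?lt0n ?size_poly_eq0 //.
congr hom; rewrite size_mul //; move: p0 q0; rewrite -!size_poly_gt0.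
by case: (size p) => [//|a]; case: (size q) => [//|b] _ _; rewrite addnS addSn.
Qed.

Lemma lead_coef_hom f : f \is monic -> lead_coef (hom (size f).-1 f) = 1.
Proof.
move=> mf; rewrite lead_coefE size_hom ?monic_neq0 // coef_hom leqnn subnn.
by rewrite -lead_coefE (monicP mf) expr0 scale1r.
Qed.

Lemma irreducible_X2 : irreducible_elt (X2 K).
Proof.
split; first by rewrite polyC_eq0 polyX_eq0.
split.
  apply/negP=> /unit_bpolyP [c _ /polyC_inj e].
  by have := size_polyX K; rewrite e size_polyC; case: (c != 0).
move=> a b e.
have ab0 : a * b != 0 by rewrite -e polyC_eq0 polyX_eq0.
have [a0 b0] : a != 0 /\ b != 0 by apply/andP; rewrite -negb_or -mulf_eq0.
have /eqP : size (a * b) = 1%N by rewrite -e size_polyC polyX_eq0.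
rewrite size_mul // -subn1.
have := size_poly_gt0 a; have := size_poly_gt0 b; rewrite a0 b0 => sb sa sab.
have /size_poly1P [p p0 ep] : size a == 1%N by lia.
have /size_poly1P [q q0 eq] : size b == 1%N by lia.
have epq : 'X = p * q by apply: (@polyC_inj {poly K}); rewrite polyCM -ep -eq.
have /eqP : size (p * q) = 2%N by rewrite -epq size_polyX.
rewrite size_mul // -subn1.
have := size_poly_gt0 p; have := size_poly_gt0 q; rewrite p0 q0 => sq sp spq.
have [h|h] : size p == 1%N \/ size q == 1%N by lia.
  case/size_poly1P: h => c c0 ec; left; apply/unit_bpolyP.
  by exists c; rewrite // ep ec.
case/size_poly1P: h => c c0 ec; right; apply/unit_bpolyP.
by exists c; rewrite // eq ec.
Qed.

(** The factors need not be homogeneous, but their leading coefficients in x1 multiply to 1 and are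
    therefore constants. Setting x2 = 1 then preserves degrees in x1, so a factor that becomes
    constant was already a constant. *)
Lemma irreducible_hom f : f \is monic -> irreducible_poly f ->
  irreducible_elt (hom (size f).-1 f).
Proof.
move=> mf [sf irf]; have f0 := monic_neq0 mf.
split; first by rewrite -size_poly_eq0 size_hom // size_poly_eq0.
split; first by rewrite poly_unitE size_hom // (gtn_eqF sf).
move=> a b e.
have : lead_coef a * lead_coef b = 1 by rewrite -lead_coefM -e lead_coef_hom.
have ef : f = dehom a * dehom b by rewrite -dehomM -e homK // leqSpred.
have key (x y : bpoly K) : lead_coef x * lead_coef y = 1 -> f = dehom x * dehom y ->
    size (dehom x) = 1%N -> x \is a GRing.unit.
  move=> lxy _ sx.
  have ux : lead_coef x \is a GRing.unit.
    by apply/unitrP; exists (lead_coef y); rewrite mulrC lxy.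
  move: ux; rewrite poly_unitE => /andP[/size_poly1P [c c0 ec] _].
  have s1 : (size x).-1 = 0%N.
    apply/eqP; rewrite -leqn0 -ltnS -sx ltnNge; apply/negP=> h.
    have : (dehom x)`_(size x).-1 = 0 by rewrite nth_default.
    by rewrite coef_dehom -lead_coefE ec hornerC => /eqP; rewrite (negPf c0).
  apply/unit_bpolyP; exists c => //.
  have x0 : x != 0 by apply: contra_eq_neq ec => ->; rewrite lead_coef0 eq_sym polyC_eq0.
  rewrite [x]size1_polyC; last by move: s1; lia.
  by move: ec; rewrite lead_coefE s1 => ->.
move=> lab; case: (eqVneq (size (dehom a)) 1%N) => sa; first by left; apply: (key a b).
right; apply: (key b a); rewrite 1?mulrC //.
have := irf _ sa; rewrite {1}ef dvdp_mulr // => /(_ isT) /eqp_size.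
have [a0 b0] : dehom a != 0 /\ dehom b != 0 by apply/andP; rewrite -negb_or -mulf_eq0 -ef.
rewrite ef size_mul //; have := size_poly_gt0 (dehom a); have := size_poly_gt0 (dehom b).
rewrite a0 b0; clear; move: (size _) (size _) => m n. lia.
Qed.

Lemma inP_X2 : inP (X2 K).
Proof.
split; last by split; [exact: irreducible_X2 | left].
exists 1%N => i j; rewrite /coef2 /X2 coefC; case: i => [|i] /=; last by rewrite coef0 eqxx.
by rewrite coefX; case: (j =P 1%N) => [->|]; rewrite ?eqxx.
Qed.

Lemma inP_hom f : f \is monic -> irreducible_poly f -> inP (hom (size f).-1 f).
Proof.
move=> mf irf; split; first exact: hom_homogeneous.
by split; [exact: irreducible_hom | right; apply: lead_coef_hom].
Qed.

Lemma X2_neq_hom f : f \is monic -> hom (size f).-1 f != X2 K.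
Proof.
move=> mf; apply/eqP=> /(congr1 lead_coef); rewrite lead_coef_hom // lead_coefC.
by move/(congr1 (fun p => size p)); rewrite size_poly1 size_polyX.
Qed.

(** By homogeneity the leading coefficient in x1 is a scalar times a power of x2; as it equals 1,
    that power is trivial and dehomogenizing loses no degree. *)
Lemma inP_monic g : inP g -> g != X2 K ->
  exists f, [/\ f \is monic, irreducible_poly f & g = hom (size f).-1 f].
Proof.
case=> /homogeneous_hom [N]; set f := dehom g => sf eg [[g0 [ug ig]] un] gX2.
have {un} lg : lead_coef g = 1 by case: un => [e|//]; rewrite e eqxx in gX2.
have sg : (size g <= N.+1)%N by rewrite eg size_poly.
have sg0 : (0 < size g)%N by rewrite size_poly_gt0.
have eN : (size g).-1 = N.
  move: lg; rewrite lead_coefE {1}eg coef_hom; case: leqP => [h|]; last by lia.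
  move/(congr1 (fun p => size p)); rewrite size_poly1.
  case: (eqVneq f`_(size g).-1 0) => [->|nz]; first by rewrite scale0r size_poly0.
  by rewrite size_scale // size_polyXn; lia.
have fN : f`_N = 1 by rewrite coef_dehom -eN -lead_coefE lg hornerC.
have sfN : size f = N.+1.
  apply/eqP; rewrite eqn_leq sf /= ltnNge; apply/negP=> h.
  by move/eqP: fN; rewrite nth_default // eq_sym oner_eq0.
have mf : f \is monic by rewrite monicE lead_coefE sfN fN.
have f0 := monic_neq0 mf.
have ef : g = hom (size f).-1 f by rewrite sfN.
exists f; split=> //; split.
  rewrite ltnNge sfN; apply/negP=> h; move/negP: ug; apply; rewrite poly_unitE.
  have N0 : N = 0%N by clear -h; lia.
  rewrite {1}ef size_hom // sfN N0 eqxx /=.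
  by move: lg; rewrite lead_coefE eN N0 => ->; rewrite unitr1.
move=> q sq /dvdpP [r er].
have [r0 q0] : r != 0 /\ q != 0 by apply/andP; rewrite -negb_or -mulf_eq0 -er.
have := ig (hom (size r).-1 r) (hom (size q).-1 q).
rewrite -hom_sizeM // -er => /(_ ef) [].
  rewrite poly_unitE size_hom // => /andP[/size_poly1P [c c0 ec] _].
  by rewrite er ec mul_polyC eqp_sym eqp_scale.
by rewrite poly_unitE size_hom // (negPf sq).
Qed.

Lemma scal_eq0 (c : K) : (scal c == 0) = (c == 0).
Proof. by rewrite !polyC_eq0. Qed.

Lemma irreducible_scal (c : K) h : c != 0 -> irreducible_elt h -> irreducible_elt (scal c * h).
Proof.
move=> c0 [h0 [uh ih]]; have uc : scal c \is a GRing.unit by apply/unit_bpolyP; exists c.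
split; first by rewrite mulf_eq0 scal_eq0 negb_or c0.
split; first by rewrite unitrM negb_and uh orbT.
move=> a b e; have eh : h = (scal c)^-1 * a * b by rewrite -mulrA -e mulKr.
by case: (ih _ _ eh) => H; [left | right]; rewrite // unitrM unitrV uc in H.
Qed.

Lemma irreducible_act Q h : Q \in unitmx -> irreducible_elt h -> irreducible_elt (act_rm Q h).
Proof.
move=> uQ [h0 [uh ih]]; split.
  by apply: contra_neq h0 => e; rewrite -(act_rmK uQ h) e rmorph0.
split; first by apply: contra uh => /(rmorph_unit (act_rm (invmx Q))); rewrite act_rmK.
move=> a b /(congr1 (act_rm (invmx Q))); rewrite act_rmK // rmorphM => /ih [].
  by move/(rmorph_unit (act_rm Q)); rewrite act_rmVK; [left|].
by move/(rmorph_unit (act_rm Q)); rewrite act_rmVK; [right|].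
Qed.

Lemma irreducible_normalize h : homogeneous h -> irreducible_elt h ->
  exists (c : K) g, [/\ c != 0, inP g & h = scal c * g].
Proof.
case/homogeneous_hom=> N; set p := dehom h => sp eh ih.
have [h0 [uh _]] := ih.
have p0 : p != 0 by apply: contra_neq h0 => e; rewrite eh e hom0.
case: (eqVneq p`_N 0) => pN; last first.
  have sN : size p = N.+1.
    apply/eqP; rewrite eqn_leq sp /= ltnNge; apply/negP=> s.
    by rewrite nth_default ?eqxx in pN.
  have pl : p`_N = lead_coef p by rewrite lead_coefE sN.
  exists p`_N, (hom N ((p`_N)^-1 *: p)); split=> //; last first.
    by rewrite -homZ scalerA divff // scale1r.
  have e : hom N ((p`_N)^-1 *: p) = scal (p`_N)^-1 * h by rewrite homZ -eh.
  split; first exact: hom_homogeneous.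
  split; first by rewrite e; apply: irreducible_scal; rewrite ?invr_eq0.
  right; have m : (p`_N)^-1 *: p \is monic by rewrite monicE lead_coefZ -pl mulVf.
  by have := lead_coef_hom m; rewrite size_scale ?invr_eq0 // sN.
(* Without an x1^N term x2 divides [h], and irreducibility leaves only a scalar multiple of x2. *)
case: N => [|N] in sp eh pN *.
  by case/eqP: p0; rewrite (size1_polyC sp) pN.
have sp' : (size p <= N.+1)%N.
  apply/leq_sizeP=> j; rewrite leq_eqVlt => /predU1P [<- //|hj].
  by rewrite nth_default // (leq_trans sp).
rewrite homX2 // in eh.
have [_ [_ /(_ _ _ eh) []]] := ih.
  by have [_ [/negP]] := irreducible_X2.
case/unit_bpolyP=> c c0 ec; exists c, (X2 K); split=> //; first exact: inP_X2.
by rewrite eh ec mulrC.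
Qed.

Lemma inP_scal_inj (a b : K) g h : inP g -> inP h -> a != 0 -> b != 0 ->
  scal a * g = scal b * h -> g = h.
Proof.
move=> Pg Ph a0 b0 e.
have sXC (c d : K) f : f \is monic -> d != 0 -> scal c * X2 K <> scal d * hom (size f).-1 f.
  move=> mf d0 /(congr1 lead_coef); rewrite !lead_coefM lead_coef_hom // !lead_coefC mulr1.
  move/(congr1 (fun p => size p)); rewrite size_polyC d0 mul_polyC.
  case: (eqVneq c 0) => [->|c0]; first by rewrite scale0r size_poly0.
  by rewrite size_scale // size_polyX.
case: (eqVneq g (X2 K)) => [eg|ng]; case: (eqVneq h (X2 K)) => [eh|nh].
- by rewrite eg eh.
- have [f [mf _ ef]] := inP_monic Ph nh.
  by rewrite eg ef in e; case: (sXC _ _ _ mf b0 e).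
- have [f [mf _ ef]] := inP_monic Pg ng.
  by rewrite eh ef in e; case: (sXC _ _ _ mf a0 (esym e)).
have [f [mf _ ef]] := inP_monic Pg ng; have [f' [mf' _ ef']] := inP_monic Ph nh.
have ab : a = b.
  move: e => /(congr1 lead_coef); rewrite ef ef' !lead_coefM !lead_coef_hom // !lead_coefC !mulr1.
  exact: polyC_inj.
have a0' : scal a != 0 by rewrite scal_eq0.
by apply: (mulfI a0'); rewrite e ab.
Qed.

(** This makes the [epsilon] in [act_P] usable: an invertible substitution preserves homogeneity and
    irreducibility, so a unital multiple exists. *)
Lemma act_P_spec Q g : Q \in unitmx -> inP g ->
  inP (act_P Q g) /\ exists2 c : K, c != 0 & act_rm Q g = scal c * act_P Q g.
Proof.
move=> uQ [Hg [ig _]].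
have : exists g', inP g' /\ exists lam : K, lam != 0 /\ act_poly Q g = lam%:P%:P * g'.
  have [N s e] := homogeneous_hom Hg.
  have [|c [g' [c0 Pg' eg']]] := irreducible_normalize _ (irreducible_act uQ ig).
    have : ishom N g by exists (dehom g).
    by case/(ishom_act Q) => p _ ->; apply: hom_homogeneous.
  by exists g'; split=> //; exists c; rewrite act_rmE.
case/(epsilon_spec (inhabits g))=> Pg' [c [c0 e]]; split=> //.
by exists c => //; rewrite -act_rmE e.
Qed.

Lemma act_P_eq Q g h (c : K) : Q \in unitmx -> inP g -> inP h -> c != 0 ->
  act_rm Q g = scal c * h -> act_P Q g = h.
Proof.
move=> uQ Pg Ph c0 e; have [P1 [d d0 e1]] := act_P_spec uQ Pg.
by apply: (inP_scal_inj P1 Ph d0 c0); rewrite -e1.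
Qed.

Lemma act_P_inj Q g h : Q \in unitmx -> inP g -> inP h -> act_P Q g = act_P Q h -> g = h.
Proof.
move=> uQ Pg Ph e.
have [_ [a a0 ea]] := act_P_spec uQ Pg; have [_ [b b0 eb]] := act_P_spec uQ Ph.
apply: (inP_scal_inj Pg Ph b0 a0); apply: (can_inj (act_rmK uQ)).
by rewrite !rmorphM !act_rm_scal ea eb e mulrCA.
Qed.

Lemma act_P_surj Q h : Q \in unitmx -> inP h -> exists2 g, inP g & act_P Q g = h.
Proof.
move=> uQ Ph; have uV : invmx Q \in unitmx by rewrite unitmx_inv.
have [Pg [c c0 e]] := act_P_spec uV Ph; exists (act_P (invmx Q) h) => //.
have c0' : c^-1 != 0 by rewrite invr_eq0.
apply: (act_P_eq uQ Pg Ph c0'); apply: (can_inj (act_rmVK uQ)).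
rewrite (act_rmK uQ) rmorphM act_rm_scal e.
by rewrite mulrA -scalM mulVf // mul1r.
Qed.
End UnitalIrreducible.

(** * Linear substitutions acting on the blocks *)

Section BlockAction.
Variable K : fieldType.
Implicit Types (g h : bpoly K) (p q f : {poly K}) (Q T : 'M[K]_2).

(* Reading row vectors of length [e] as forms of degree [e - 1], right multiplication by
   [Lm e] is multiplication by [x2] and by [Lm' e] multiplication by [x1]. *)
Definition Lm e : 'M[K]_(e, e.+1) := \matrix_(i < e, j < e.+1) (i == j :> nat)%:R.
Definition Lm' e : 'M[K]_(e, e.+1) := \matrix_(i < e, j < e.+1) (i.+1 == j :> nat)%:R.

Lemma R_minusE e : R_minus K e.+1 = plus_pair (Lm e) (Lm' e).
Proof. by []. Qed.

Lemma mul_Lm e n (A : 'M[K]_(e.+1, n)) i j : (Lm e *m A) i j = A (widen_ord (leqnSn e) i) j.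
Proof.
rewrite mxE (bigD1 (widen_ord (leqnSn e) i)) //= mxE eqxx mul1r big1 ?addr0 //.
by move=> k; rewrite -val_eqE /= mxE eq_sym => /negPf ->; rewrite mul0r.
Qed.

Lemma mul_Lm' e n (A : 'M[K]_(e.+1, n)) i j : (Lm' e *m A) i j = A (lift ord0 i) j.
Proof.
rewrite mxE (bigD1 (lift ord0 i)) //= mxE eqxx mul1r big1 ?addr0 //.
by move=> k; rewrite -val_eqE /= mxE eq_sym => /negPf ->; rewrite mul0r.
Qed.

Lemma rVpoly_sum n (v : 'rV[K]_n) : rVpoly v = \sum_i v 0 i *: 'X^i.
Proof.
rewrite {1}[v]row_sum_delta linear_sum; apply: eq_bigr => i _.
by rewrite linearZ /= rVpoly_delta.
Qed.

Lemma rVpoly_mulmx m n (v : 'rV[K]_m) (A : 'M[K]_(m, n)) :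
  rVpoly (v *m A) = \sum_i v 0 i *: rVpoly (row i A).
Proof. by rewrite mulmx_sum_row linear_sum; apply: eq_bigr => i _; rewrite linearZ. Qed.

Lemma rVpoly_Lm e (v : 'rV[K]_e) : rVpoly (v *m Lm e) = rVpoly v.
Proof.
rewrite rVpoly_mulmx rVpoly_sum; apply: eq_bigr => i _; congr (_ *: _).
rewrite -[RHS](rVpoly_delta K (widen_ord (leqnSn e) i)); congr rVpoly.
by apply/rowP=> j; rewrite !mxE eqxx -val_eqE /= eq_sym.
Qed.

Lemma rVpoly_Lm' e (v : 'rV[K]_e) : rVpoly (v *m Lm' e) = 'X * rVpoly v.
Proof.
rewrite rVpoly_mulmx rVpoly_sum mulr_sumr; apply: eq_bigr => i _.
rewrite -scalerAr -exprS; congr (_ *: _).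
rewrite -[RHS](rVpoly_delta K (lift ord0 i)); congr rVpoly.
by apply/rowP=> j; rewrite !mxE eqxx -val_eqE /= eq_sym.
Qed.

Lemma size_rVpoly n (v : 'rV[K]_n) : (size (rVpoly v) <= n)%N.
Proof. exact: size_poly. Qed.

(** The N-th symmetric power of the substitution [Q], on row vectors of coefficients in the basis
    x1^i x2^(N-i). *)
Definition Sym N Q : 'M[K]_N.+1 :=
  \matrix_i poly_rV (dehom (act_rm Q (hom N 'X^i))).

Lemma Sym_act N Q (v : 'rV[K]_N.+1) :
  hom N (rVpoly (v *m Sym N Q)) = act_rm Q (hom N (rVpoly v)).
Proof.
rewrite rVpoly_mulmx rVpoly_sum !hom_sum rmorph_sum; apply: eq_bigr => i _.
rewrite !homZ rmorphM act_rm_scal; congr (_ * _); rewrite rowK.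
have H : ishom N (act_rm Q (hom N 'X^i)).
  by apply: ishom_act; exists 'X^i; rewrite // size_polyXn.
by rewrite poly_rV_K ?ishom_size // -ishomE.
Qed.

Lemma Sym_unit N Q : Q \in unitmx -> Sym N Q \in unitmx.
Proof.
move=> uQ; rewrite -row_free_unit; apply: inj_row_free => v e.
have := Sym_act Q v; rewrite e linear0 hom0 => /(congr1 (act_rm (invmx Q))).
rewrite (act_rmK uQ) rmorph0 => /esym e'; apply: (can_inj rVpolyK).
by rewrite linear0; apply: (@hom_inj _ N); rewrite ?size_rVpoly ?size_poly0 // hom0.
Qed.

Lemma rV_hom_eq N m (A B : 'M[K]_(m, N.+1)) :
  (forall v : 'rV_m, hom N (rVpoly (v *m A)) = hom N (rVpoly (v *m B))) -> A = B.
Proof.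
move=> H; apply/row_matrixP=> i; rewrite !rowE; apply: (can_inj rVpolyK).
by apply: (@hom_inj _ N); rewrite ?size_rVpoly.
Qed.

(** Substitution is multiplicative: applied to x2 h it gives the second row of [Q], read as a linear
    form, times the substituted h. *)
Lemma Lm_Sym N Q : Lm N.+1 *m Sym N.+1 Q =
  Sym N Q *m (Q 1 1 *: Lm N.+1 + Q 1 0 *: Lm' N.+1).
Proof.
apply: rV_hom_eq => v; rewrite !mulmxA Sym_act rVpoly_Lm homX2 ?size_rVpoly //.
rewrite rmorphM -Sym_act act_rm_X2 mulmxDr -!scalemxAr linearD !linearZ /=.
rewrite rVpoly_Lm rVpoly_Lm' homD !homZ homX1 homX2 ?size_rVpoly //.
by rewrite /sbX2 mulrDl !mulrA addrC.
Qed.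

Lemma Lm'_Sym N Q : Lm' N.+1 *m Sym N.+1 Q =
  Sym N Q *m (Q 0 1 *: Lm N.+1 + Q 0 0 *: Lm' N.+1).
Proof.
apply: rV_hom_eq => v; rewrite !mulmxA Sym_act rVpoly_Lm' homX1.
rewrite rmorphM -Sym_act act_rm_X1 mulmxDr -!scalemxAr linearD !linearZ /=.
rewrite rVpoly_Lm rVpoly_Lm' homD !homZ homX1 homX2 ?size_rVpoly //.
by rewrite /sbX1 mulrDl !mulrA addrC.
Qed.

(* If [T] recombines the two matrices of a pencil, [hat T] is the substitution of the
   variables under which multiplication by [(x2, x1)] is recombined in the same way. *)
Definition hat T : 'M[K]_2 :=
  \matrix_(i, j) (if i == 0 then if j == 0 then T 1 1 else T 0 1
                  else if j == 0 then T 1 0 else T 0 0).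

Lemma hatE T : (hat T 0 0 = T 1 1) * (hat T 0 1 = T 0 1) *
               (hat T 1 0 = T 1 0) * (hat T 1 1 = T 0 0).
Proof. by rewrite !mxE. Qed.

Lemma hatK : involutive hat.
Proof.
move=> T; apply/matrixP=> i j; rewrite mxE !hatE.
by case: i => [[|[|//]] hi]; case: j => [[|[|//]] hj] /=; congr (T _ _); apply: val_inj.
Qed.

Lemma det2 T : \det T = T 0 0 * T 1 1 - T 0 1 * T 1 0.
Proof.
rewrite (expand_det_row _ 0) !big_ord_recl big_ord0 addr0 /cofactor !det_mx11 !mxE /=.
have -> : lift 0 0 = 1 :> 'I_2 by apply: val_inj.
have -> : lift 1 0 = 0 :> 'I_2 by apply: val_inj.
by rewrite expr0 expr1 mul1r mulN1r mulrN.
Qed.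

Lemma hat_unit T : (hat T \in unitmx) = (T \in unitmx).
Proof. by rewrite !unitmxE !det2 !hatE (mulrC (T 1 1)). Qed.

(* With [h] the form spanning the left kernel of [G], this is the pencil of
   multiplications by [x2] and [x1] from the forms of degree [N] to the forms of degree
   [N.+1] modulo [h]; it depends on [h] only (pencil_ker) and so transforms like [h]. *)
Definition pencil N (G : 'M[K]_(N.+2, N.+1)) := plus_pair (Lm N.+1 *m G) (Lm' N.+1 *m G).

Lemma pencil_act N G T : T \in unitmx ->
  cong (act_right (@pencil N G) T) (pencil (Sym N.+1 (hat T) *m G)).
Proof.
move=> uT; rewrite plus_pair_act; apply: (@cong_plus _ _ _ _ _ _ _ (Sym N (hat T)) 1%:M).
- by rewrite Sym_unit ?hat_unit.
- exact: unitmx1.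
- by rewrite mulmx1 mulmxA Lm_Sym -mulmxA mulmxDl !hatE -!scalemxAl.
by rewrite mulmx1 mulmxA Lm'_Sym -mulmxA mulmxDl !hatE -!scalemxAl.
Qed.

(** Full rank makes the left kernel the line spanned by [p]. Two such matrices with the same left
    kernel differ by an invertible right factor, which [cong_plus] absorbs. *)
Lemma pencil_ker N (G G' : 'M[K]_(N.+2, N.+1)) (p : 'rV[K]_N.+2) :
  p != 0 -> row_full G -> row_full G' -> p *m G = 0 -> p *m G' = 0 ->
  cong (pencil G) (pencil G').
Proof.
move=> p0.
have key (H H' : 'M[K]_(N.+2, N.+1)) : row_full H -> p *m H = 0 -> p *m H' = 0 ->
    H' = H *m (pinvmx H *m H').
  move=> fH pH pH'; have kp : (kermx H <= p)%MS.
    have pk : (p <= kermx H)%MS by apply/sub_kermxP.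
    rewrite -(geq_leqif (mxrank_leqif_sup pk)) mxrank_ker (eqP fH) subSnn.
    by rewrite lt0n mxrank_eq0.
  have : ((1%:M - H *m pinvmx H : 'M_N.+2) <= p)%MS.
    apply: submx_trans kp; apply/sub_kermxP.
    by rewrite mulmxBl mul1mx -mulmxA mulVpmx // mulmx1 subrr.
  case/submxP=> D /(congr1 (fun X => X *m H')).
  rewrite -mulmxA pH' mulmx0 mulmxBl mul1mx -mulmxA => /eqP.
  by rewrite subr_eq0 => /eqP.
move=> fG fG' pG pG'; set S := pinvmx G *m G'.
have e : G' = G *m S by apply: key.
have e' : G = G' *m (pinvmx G' *m G) by apply: key.
have uS : S \in unitmx.
  have : S *m (pinvmx G' *m G) = 1%:M.
    by rewrite /S -mulmxA -e' mulVpmx.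
  by case/mulmx1_unit.
have uV : invmx S \in unitmx by rewrite unitmx_inv.
apply: (@cong_plus _ _ _ _ _ _ _ 1%:M (invmx S)); rewrite ?unitmx1 // mul1mx e.
  by rewrite mulmxA mulmxK.
by rewrite mulmxA mulmxK.
Qed.

(** [companionmx] with the size as an independent parameter, so that sizes can be rewritten
    freely. *)
Definition comp_mx n p : 'M[K]_n :=
  \matrix_(i, j) if (i == n.-1 :> nat) then - p`_j else (i.+1 == j :> nat)%:R.

Lemma R_finE n p : (size p).-1 = n -> R_fin p = plus_pair 1%:M (comp_mx n p).
Proof. by move=> <-. Qed.

Lemma R_infE d : R_inf K d = plus_pair (comp_mx d 'X^d) 1%:M.
Proof.
have H n : (size ('X^d : {poly K})).-1 = n ->
    R_inf K d = plus_pair (comp_mx n 'X^d) 1%:M by move=> <-.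
by apply: H; rewrite size_polyXn.
Qed.

(** Reduction modulo a monic [p] of degree [N.+1], on coefficient vectors of degree at most [N.+1]:
    only the top monomial changes. *)
Definition modG N p : 'M[K]_(N.+2, N.+1) :=
  \matrix_(i, j) if (i == N.+1 :> nat) then - p`_j else (i == j :> nat)%:R.

Lemma Lm_modG N p : Lm N.+1 *m modG N p = 1%:M.
Proof. by apply/matrixP=> i j; rewrite mul_Lm !mxE /= (ltn_eqF (ltn_ord i)). Qed.

Lemma Lm'_modG N p : Lm' N.+1 *m modG N p = comp_mx N.+1 p.
Proof. by apply/matrixP=> i j; rewrite mul_Lm' !mxE. Qed.

Lemma modG_full N p : row_full (modG N p).
Proof. by apply/row_fullP; exists (Lm N.+1); apply: Lm_modG. Qed.

Lemma modG_ker N p : p \is monic -> size p = N.+2 -> poly_rV p *m modG N p = 0.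
Proof.
move=> mp sp; apply/rowP=> j; rewrite !mxE big_ord_recr /= !mxE eqxx.
have -> : p`_N.+1 = 1 by move/monicP: mp; rewrite lead_coefE sp.
rewrite mul1r (bigD1 j) //= !mxE /= eqxx (ltn_eqF (ltn_ord j)) mulr1 big1 ?addr0 ?subrr //.
move=> i ij; rewrite !mxE /= (ltn_eqF (ltn_ord i)).
by rewrite -val_eqE in ij; rewrite (negPf ij) mulr0.
Qed.

Lemma R_fin_pencil N p : size p = N.+2 -> R_fin p = pencil (modG N p).
Proof. by move=> sp; rewrite (@R_finE N.+1) ?sp // /pencil Lm_modG Lm'_modG. Qed.

(** Up to congruence, [A] is the pencil of multiplications modulo [h]. In this form a change of
    variables in [A] is a change of variables in [h]. *)
Definition presents N (G : 'M[K]_(N.+2, N.+1)) h A :=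
  [/\ ishom N.+1 h, row_full G, poly_rV (dehom h) *m G = 0 & cong (pencil G) A].

Lemma presents_fin f d : (0 < d)%N -> f \is monic -> irreducible_poly f ->
  exists N (G : 'M[K]_(N.+2, N.+1)), presents G (hom (size f).-1 f ^+ d) (R_fin (f ^+ d)).
Proof.
move=> d0 mf [sf _]; have md := monic_exp d mf.
have eN : (((size f).-1 * d).-1.+1 = (size f).-1 * d)%N.
  by rewrite prednK // muln_gt0 d0 andbT -subn1 subn_gt0.
have sd : size (f ^+ d) = ((size f).-1 * d).-1.+2.
  by rewrite eN -size_exp prednK // size_poly_gt0 monic_neq0.
exists ((size f).-1 * d).-1, (modG ((size f).-1 * d).-1 (f ^+ d)).
have eh : hom (size f).-1 f ^+ d = hom ((size f).-1 * d).-1.+1 (f ^+ d).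
  by rewrite eN hom_exp // leqSpred.
rewrite eh; split; [by exists (f ^+ d); rewrite ?sd | exact: modG_full | |].
  by rewrite homK ?sd // modG_ker.
by rewrite (R_fin_pencil sd); apply: cong_refl.
Qed.

(** The left kernel of [Sym N.+1 (hat T) *m G] consists of the forms that the substitution sends
    into the line of [h], and [g] is one of them. *)
Lemma presents_act N (G : 'M[K]_(N.+2, N.+1)) h (c : K) g A T : T \in unitmx ->
  presents G h A -> c != 0 -> act_rm (hat T) g = scal c * h ->
  ishom N.+1 g -> presents (Sym N.+1 (hat T) *m G) g (act_right A T).
Proof.
move=> uT [hh fG pG cA] c0 e hg.
have uS : Sym N.+1 (hat T) \in unitmx by rewrite Sym_unit ?hat_unit.
split=> //.
- by rewrite /row_full (eqmxMfull G) ?row_full_unit.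
- rewrite mulmxA.
  have -> : poly_rV (dehom g) *m Sym N.+1 (hat T) = c *: poly_rV (dehom h) :> 'rV[K]_N.+2.
    apply: (can_inj rVpolyK); apply: (@hom_inj _ N.+1); rewrite ?size_rVpoly //.
    rewrite Sym_act linearZ /= homZ !poly_rV_K ?ishom_size // -!ishomE //.
  by rewrite -scalemxAl pG scaler0.
apply: cong_trans (cong_act T cA); apply: cong_sym; exact: pencil_act.
Qed.

Definition swap2 : 'M[K]_2 := \matrix_(i, j) (i != j)%:R.

Lemma swap2_unit : swap2 \in unitmx.
Proof.
by rewrite unitmxE det2 !mxE /= mulr0 mulr1 sub0r unitrN unitr1.
Qed.

Lemma R_inf_swap d : R_inf K d = act_right (R_fin ('X^d)) swap2.
Proof.
rewrite R_infE (@R_finE d) ?size_polyXn // plus_pair_act.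
by rewrite !mxE /= !scale0r !scale1r add0r addr0.
Qed.

(** Exchanging the variables turns the presentation of the block of ['X^d] by x1^d into one of the
    infinite block by x2^d. *)
Lemma presents_inf d : (0 < d)%N ->
  exists N (G : 'M[K]_(N.+2, N.+1)), presents G (X2 K ^+ d) (R_inf K d).
Proof.
case: d => // d _; rewrite R_inf_swap.
have X1h : X1 K ^+ d.+1 = hom d.+1 'X^(d.+1).
  elim: d => [|d IH]; last by rewrite exprS IH [in RHS]exprS homX1.
  have := @hom1 K 1 0; rewrite scale1r addr0 => ->.
  by rewrite /scal mul1r polyC0 mul0r addr0.
have P1 : presents (modG d 'X^(d.+1)) (X1 K ^+ d.+1) (R_fin ('X^(d.+1))).
  have s : size ('X^(d.+1) : {poly K}) = d.+2 by rewrite size_polyXn.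
  rewrite X1h; split; [by exists 'X^(d.+1); rewrite ?s | exact: modG_full | |].
    by rewrite homK ?s // modG_ker // monicXn.
  by rewrite (R_fin_pencil s); apply: cong_refl.
exists d, (Sym d.+1 (hat swap2) *m modG d 'X^(d.+1)).
apply: (presents_act swap2_unit P1 (oner_neq0 K)).
  rewrite rmorphXn act_rm_X2 /sbX2 !hatE !mxE /= /scal !polyC0 !polyC1.
  by rewrite mul0r addr0 !mul1r.
have X2h : ishom 1 (X2 K).
  exists 1; first by rewrite size_poly1.
  have := @homX2 K 0 1; rewrite size_poly1 => -> //.
  rewrite homE big_ord_recl big_ord0 coefC /= /scal !polyC1.
  by rewrite !expr0 !mulr1 addr0 mulr1.
by have := ishomX d.+1 X2h; rewrite mul1n.
Qed.

Lemma presents_inP g d : (0 < d)%N -> inP g ->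
  exists N (G : 'M[K]_(N.+2, N.+1)), presents G (g ^+ d) (Rblock (Some g) d).
Proof.
move=> d0 Pg; rewrite /Rblock; case: eqP => [->|/eqP nX]; first exact: presents_inf.
have [f [mf irf eg]] := inP_monic Pg nX; have := presents_fin d0 mf irf.
by rewrite -eg -/(dehom g) {3}eg homK // leqSpred.
Qed.
End BlockAction.

(** * Linear substitutions acting on direct sums and on multiplicities *)

Section DirectSumAction.
Variable K : fieldType.
Implicit Types (g h : bpoly K) (Q T : 'M[K]_2).

(** A nonzero coefficient in x1 is a scalar times a power of x2, whose exponent reveals the degree.
    It serves to identify the sizes of two presentations. *)
Lemma ishom_uniq N M h : h != 0 -> ishom N h -> ishom M h -> N = M.
Proof.
move=> h0 HN HM; have d0 : dehom h != 0.
  by apply: contra_neq h0 => e; rewrite (ishomE HN) e hom0.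
have := congr1 (fun x : bpoly K => x`_(size (dehom h)).-1) (etrans (esym (ishomE HN)) (ishomE HM)).
have := ishom_size HN; have := ishom_size HM; have := size_poly_gt0 (dehom h); rewrite d0.
rewrite !coef_hom -[_`_ _]/(lead_coef (dehom h)); move: (size (dehom h)) => s s0 sM sN.
have -> : (s.-1 <= N)%N by clear -sN s0; lia.
have -> : (s.-1 <= M)%N by clear -sM s0; lia.
move/(congr1 (fun p : {poly K} => size p)); rewrite !size_scale ?lead_coef_eq0 // !size_polyXn.
by clear -s0 sM sN; lia.
Qed.

Lemma Rblock_act g h d T : (0 < d)%N -> inP g -> inP h -> T \in unitmx ->
  act_P (hat T) h = g ->
  cong (act_right (Rblock (Some g) d) T) (Rblock (Some h) d).
Proof.
move=> d0 Pg Ph uT e; have uQ : hat T \in unitmx by rewrite hat_unit.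
have [_ [c c0]] := act_P_spec uQ Ph; rewrite e => ec.
have ecd : act_rm (hat T) (h ^+ d) = scal (c ^+ d) * g ^+ d.
  by rewrite rmorphXn ec exprMn /scal !rmorphXn.
have h0 : h != 0 by case: Ph => _ [[]].
have g0 : g != 0 by case: Pg => _ [[]].
have cd0 : c ^+ d != 0 by rewrite expf_neq0.
have [N [G PG]] := presents_inP d0 Pg.
have [N' [G' PG']] := presents_inP d0 Ph.
(* Substitution preserves the degree, so [g ^+ d] and [h ^+ d] have equal degrees and both
   presentations live in the same size. *)
have eN : N = N'.
  apply: succn_inj; apply: (@ishom_uniq _ _ (act_rm (hat T) (h ^+ d))).
  - by rewrite ecd mulf_neq0 ?scal_eq0 // expf_neq0.
  - case: PG => -[p sp eg] _ _ _; rewrite ecd eg -homZ; exists ((c ^+ d) *: p) => //.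
    by rewrite size_scale.
  by apply: ishom_act; case: PG'.
move: G' PG'; rewrite -eN => G' [hh fG' pG' cG'].
have [_ fG pG cG] := presents_act uT PG cd0 ecd hh.
apply: cong_trans (cong_sym cG) _; apply: cong_trans cG'; apply: pencil_ker fG fG' pG pG'.
apply/eqP=> /(congr1 rVpoly); rewrite linear0 poly_rV_K ?ishom_size // => e0.
by have := expf_neq0 d h0; rewrite (ishomE hh) e0 hom0 eqxx.
Qed.

(** For d at least 2 the block is multiplication from all forms of degree d - 2 to all forms of
    degree d - 1, with no quotient taken, so the symmetric powers themselves intertwine. For d = 1
    the matrices have no rows. *)
Lemma R_minus_act d T : (0 < d)%N -> T \in unitmx ->
  cong (act_right (R_minus K d) T) (R_minus K d).
Proof.
case: d => // -[|e] _ uT; rewrite R_minusE plus_pair_act.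
  by rewrite ![_ + _]flatmx0 [Lm K 0]flatmx0 [Lm' K 0]flatmx0; apply: cong_refl.
apply: (@cong_plus _ _ _ _ _ _ _ (Sym e (hat T)) (Sym e.+1 (hat T))); rewrite ?Sym_unit ?hat_unit //.
  by rewrite Lm_Sym !hatE.
by rewrite Lm'_Sym !hatE.
Qed.

Definition act_idx Q (xd : ptilde K * nat) := (omap (act_P Q) xd.1, xd.2).

Lemma Atilde_act T s : T \in unitmx -> (forall xd, xd \in s -> valid_block xd) ->
  cong (act_right (Atilde_seq (map (act_idx (hat T)) s)) T) (Atilde_seq s).
Proof.
move=> uT; elim: s => [|[x d] s IH] vs.
  by rewrite /act_right /= !scaler0 !addr0; apply: cong_refl.
have [d0 vx] := vs _ (mem_head _ _); have uQ : hat T \in unitmx by rewrite hat_unit.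
rewrite /= dsum_act; apply: cong_dsum; last first.
  by apply: IH => xd xds; apply: vs; rewrite inE xds orbT.
move: vs => _.
case: x d0 vx => [g|] /= d0 vx; last exact: R_minus_act.
have Pg := vx _ erefl.
by apply: (@Rblock_act (act_P (hat T) g) g) => //; case: (act_P_spec uQ Pg).
Qed.

(** Translates the orbit relation into lists. Injectivity of the action on P lets counts be compared
    along [act_P]; surjectivity ensures that every index in P is reached. *)
Lemma act_idx_count Q rho rho' s s' : Q \in unitmx -> Ftilde rho -> Ftilde rho' ->
  realizes s rho -> realizes s' rho' ->
  perm_eq s (map (act_idx Q) s') <->
  (forall d, rho' None d = rho None d) /\
  (forall g, inP g -> forall d, rho' (Some g) d = rho (Some (act_P Q g)) d).
Proof.
move=> uQ [_ [Prho _]] [_ [Prho' _]] rs rs'.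
have mem' g d : (Some g, d) \in s' -> inP g.
  by rewrite -has_pred1 has_count rs' lt0n => /eqP /Prho'.
have cS g d : inP g -> count_mem (Some (act_P Q g), d) (map (act_idx Q) s') = rho' (Some g) d.
  move=> Pg; rewrite -rs' count_map; apply: eq_in_count => -[[h|] k] hs //=.
  rewrite /act_idx /= !xpair_eqE; congr andb; apply/eqP/eqP => [[e]|[->] //].
  by congr Some; apply: act_P_inj e => //; apply: mem' hs.
have cN d : count_mem (None, d) (map (act_idx Q) s') = rho' None d.
  by rewrite -rs' count_map; apply: eq_in_count => -[[h|] k].
split=> [/permP e|[eN eS]].
  split=> [d|g Pg d]; first by rewrite -cN -rs -e.
  by rewrite -cS // -rs -e.
apply/allP=> -[x d] _ /=; apply/eqP; rewrite rs.
case: x => [h|]; last by rewrite cN eN.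
(* At an index outside P both counts vanish. *)
have [Ph|nPh] := classic (inP h).
  by have [g Pg <-] := act_P_surj uQ Ph; rewrite cS // eS.
have -> : rho (Some h) d = 0%N by apply/eqP/negP=> /negP /eqP /Prho.
apply/esym/count_memPn/negP=> /mapP [[[g|] k] gs] // [eh _].
by apply: nPh; rewrite eh; have [] := act_P_spec uQ (mem' _ _ gs).
Qed.
End DirectSumAction.

(** * Dimensions of spaces of pencil morphisms *)

Section SolutionSpaces.
Variable K : fieldType.

Lemma dim_inj (aT rT : vectType K) (f : {linear aT -> rT}) (U : {vspace aT}) (V : {vspace rT}) :
  (forall u, u \in U -> f u \in V) -> (forall u, u \in U -> f u = 0 -> u = 0) ->
  (\dim U <= \dim V)%N.
Proof.
move=> fV f0; rewrite -(@limg_dim_eq _ _ _ (linfun f) U).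
  by apply/dimvS/subvP=> _ /memv_imgP [u uU ->]; rewrite lfunE; apply: fV.
apply/eqP; rewrite -subv0; apply/subvP=> u; rewrite memv_cap memv_ker lfunE /=.
by case/andP=> uU /eqP e; rewrite (f0 u uU e) mem0v.
Qed.

Lemma dim_bij (aT rT : vectType K) (f : {linear aT -> rT}) (U : {vspace aT}) (V : {vspace rT}) :
  (forall u, u \in U -> f u \in V) -> (forall u, u \in U -> f u = 0 -> u = 0) ->
  (forall v, v \in V -> exists2 u, u \in U & f u = v) -> \dim U = \dim V.
Proof.
move=> fV f0 fs; apply/eqP; rewrite eqn_leq (dim_inj fV f0) /=.
have -> : V = (linfun f @: U)%VS.
  apply/vspaceP=> v; apply/idP/memv_imgP => [/fs [u uU <-]|[u uU ->]].
    by exists u; rewrite ?lfunE.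
  by rewrite lfunE; apply: fV.
by rewrite -(limg_ker_dim (linfun f) U) leq_addl.
Qed.

Lemma dim_split m r s (U : {vspace 'M[K]_(m, r + s)}) (V1 : {vspace 'M[K]_(m, r)})
    (V2 : {vspace 'M[K]_(m, s)}) :
  (forall Y, (Y \in U) = (lsubmx Y \in V1) && (rsubmx Y \in V2)) ->
  \dim U = (\dim V1 + \dim V2)%N.
Proof.
move=> H; rewrite -(limg_ker_dim (linfun lsubmx) U) addnC; congr addn.
  congr (\dim _); apply/vspaceP=> v; apply/memv_imgP/idP => [[Y YU ->]|vV].
    by rewrite lfunE /=; move: YU; rewrite H => /andP[].
  exists (row_mx v 0); first by rewrite H row_mxKl row_mxKr vV mem0v.
  by rewrite lfunE /= row_mxKl.
apply: (@dim_bij _ _ (@rsubmx K m r s)).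
- by move=> Y; rewrite memv_cap H => /andP[/andP[]].
- move=> Y; rewrite memv_cap memv_ker lfunE /= => /andP[_ /eqP e1] e2.
  by rewrite -[Y]hsubmxK e1 e2 row_mx0.
move=> v vV; exists (row_mx 0 v); last by rewrite /= row_mxKr.
by rewrite memv_cap H row_mxKl row_mxKr mem0v vV memv_ker lfunE /= row_mxKl eqxx.
Qed.

(* Morphisms of pencils from [(L', L)] to [(A1, A2)]: their dimension [nul] is additive and
   invariant under congruence. *)
Definition sol l m n n' (L L' : 'M[K]_(l, m)) (A1 A2 : 'M[K]_(n, n')) : {vspace 'M[K]_(m, n)} :=
  lker (linfun ((mulmxr A1 \o mulmx L) \- (mulmxr A2 \o mulmx L'))).

Lemma mem_sol l m n n' (L L' : 'M[K]_(l, m)) (A1 A2 : 'M[K]_(n, n')) Y :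
  (Y \in sol L L' A1 A2) = (L *m Y *m A1 == L' *m Y *m A2).
Proof. by rewrite memv_ker lfunE /= subr_eq0. Qed.

Definition nul l m (L L' : 'M[K]_(l, m)) (A : mpair K) := \dim (sol L L' (mp1 A) (mp2 A)).

Lemma nul_cong_leq l m (L L' : 'M[K]_(l, m)) A B : cong A B -> (nul L L' B <= nul L L' A)%N.
Proof.
case=> P [P' [H1 H2 e1 e2]]; apply: (@dim_inj _ _ (mulmxr P)) => Y /=.
  rewrite !mem_sol e1 e2 !mulmxA => /eqP e; apply/eqP.
  have /(congr1 (fun X => X *m P'^T)) := e.
  by rewrite -!mulmxA -trmx_mul H2 trmx1 !mulmx1.
by move=> _ /(congr1 (mulmxr P')) /=; rewrite -mulmxA H1 mulmx1 mul0mx.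
Qed.

Lemma nul_cong l m (L L' : 'M[K]_(l, m)) A B : cong A B -> nul L L' A = nul L L' B.
Proof.
by move=> H; apply/eqP; rewrite eqn_leq !nul_cong_leq //; apply: cong_sym.
Qed.

Lemma nul_dsum l m (L L' : 'M[K]_(l, m)) A B :
  nul L L' (dsum A B) = (nul L L' A + nul L L' B)%N.
Proof.
apply: dim_split => Y; rewrite !mem_sol /= -{1 2}[Y]hsubmxK !mul_mx_row !mul_row_block.
rewrite !mulmx0 !addr0 !add0r; apply/eqP/andP => [/eq_row_mx [-> ->] //|[/eqP -> /eqP ->] //].
Qed.

(** The left half of a solution only meets [R] and the right half only [- R^T], where the sign drops
    out of a homogeneous equation. *)
Lemma nul_plus l m (L L' : 'M[K]_(l, m)) r s (R1 R2 : 'M[K]_(r, s)) :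
  nul L L' (plus_pair R1 R2) = (\dim (sol L L' R1 R2) + \dim (sol L L' R1^T R2^T))%N.
Proof.
apply: dim_split => Y; rewrite !mem_sol /= -{1 2}[Y]hsubmxK !mul_mx_row !mul_row_block.
rewrite !mulmx0 !addr0 !add0r !mulmxN.
apply/eqP/andP => [/eq_row_mx [/oppr_inj -> ->] //|[/eqP -> /eqP ->] //].
Qed.

Lemma nul_Atilde l m (L L' : 'M[K]_(l, m)) s :
  nul L L' (Atilde_seq s) = (\sum_(x <- s) nul L L' (Rblock x.1 x.2))%N.
Proof.
elim: s => [|x s IH]; last by rewrite big_cons -IH nul_dsum.
rewrite big_nil; apply/eqP; rewrite -leqn0 (leq_trans (dimvS (subvf _))) // dimvf dim_matrix.
by rewrite -[leqLHS]/(m * 0)%N muln0.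
Qed.

Definition mpow n (A : 'M[K]_n) k := iter k (mulmx A) 1%:M.

Lemma mpowSr n (A : 'M[K]_n) k : mpow A k.+1 = mpow A k *m A.
Proof.
elim: k => [|k IH]; first by rewrite /mpow /= mulmx1 mul1mx.
by transitivity (A *m (mpow A k *m A)); [rewrite -IH | rewrite mulmxA].
Qed.

Lemma mpow_tr n (A : 'M[K]_n) k : mpow A^T k = (mpow A k)^T.
Proof. by elim: k => [|k IH]; rewrite /mpow /= ?trmx1 // -/(mpow _ k) IH -trmx_mul -mpowSr. Qed.

(** The equation is substituted into itself; as soon as one of the two powers vanishes, so does [Y].
    The vanishing statements about [sol] below are reduced to this. *)
Lemma mpow_fix m n (C : 'M[K]_m) (N : 'M[K]_n) Y k :
  C *m Y *m N = Y -> Y = mpow C k *m Y *m mpow N k.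
Proof.
move=> e; elim: k => [|k IH]; first by rewrite /mpow /= mul1mx mulmx1.
rewrite mpowSr [mpow N _]/(N *m mpow N k).
by transitivity (mpow C k *m (C *m Y *m N) *m mpow N k); [rewrite e | rewrite !mulmxA].
Qed.

Definition nilp n (A : 'M[K]_n) := exists k, mpow A k = 0.

Lemma nilp_fix_l m n (C : 'M[K]_m) (N : 'M[K]_n) Y : nilp C -> C *m Y *m N = Y -> Y = 0.
Proof. by case=> k Ck /(mpow_fix k); rewrite Ck !mul0mx. Qed.

Lemma nilp_fix_r m n (C : 'M[K]_m) (N : 'M[K]_n) Y : nilp N -> C *m Y *m N = Y -> Y = 0.
Proof. by case=> k Ck /(mpow_fix k); rewrite Ck !mulmx0. Qed.

Definition Ush n : 'M[K]_n := \matrix_(i, j) (i.+1 == j :> nat)%:R.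

Lemma mpow_Ush n k i j : mpow (Ush n) k i j = (i + k == j)%N%:R.
Proof.
elim: k i j => [|k IH] i j; first by rewrite /mpow /= mxE addn0.
rewrite {1}/mpow iterS -/(mpow _ k) mxE.
have [hi|hi] := boolP (i.+1 < n)%N.
  rewrite (bigD1 (Ordinal hi)) //= mxE eqxx mul1r IH addSnnS big1 ?addr0 //.
  move=> l; rewrite -val_eqE /= mxE eq_sym => /negPf ->; by rewrite mul0r.
rewrite big1 => [|l _]; last first.
  by rewrite mxE; case: eqP => [e|_]; [rewrite e ltn_ord in hi | rewrite mul0r].
by case: eqP => // e; have := ltn_ord j; rewrite -e; move: hi; clear; lia.
Qed.

Lemma nilp_Ush n : nilp (Ush n).
Proof.
exists n; apply/matrixP=> i j; rewrite mpow_Ush mxE.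
by case: eqP => // e; have := ltn_ord j; rewrite -e ltnNge leq_addl.
Qed.

Lemma nilp_UshT n : nilp (Ush n)^T.
Proof. by have [k e] := nilp_Ush n; exists k; rewrite mpow_tr e trmx0. Qed.

Lemma comp_Ush n : comp_mx n ('X^n : {poly K}) = Ush n.
Proof.
apply/matrixP=> i j; rewrite !mxE coefXn (ltn_eqF (ltn_ord j)) oppr0.
by case: eqP => // ei; rewrite ei prednK ?(gtn_eqF (ltn_ord j)) //; case: n i j {ei} => // -[].
Qed.

Lemma Lm_Lm'T e : Lm K e *m (Lm' K e)^T = (Ush e)^T.
Proof.
apply/matrixP=> i j; rewrite mul_Lm !mxE /=; by [].
Qed.

Lemma Lm'_LmT e : Lm' K e *m (Lm K e)^T = Ush e.
Proof. by apply/matrixP=> i j; rewrite mul_Lm' !mxE /= eq_sym. Qed.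

Lemma Lm_LmT e : Lm K e *m (Lm K e)^T = 1%:M.
Proof. by apply/matrixP=> i j; rewrite mul_Lm !mxE /= eq_sym. Qed.

Lemma Lm'_Lm'T e : Lm' K e *m (Lm' K e)^T = 1%:M.
Proof. by apply/matrixP=> i j; rewrite mul_Lm' !mxE /= eqSS eq_sym. Qed.

Lemma dim_sol0 l m n n' (L L' : 'M[K]_(l, m)) (A1 A2 : 'M[K]_(n, n')) :
  (forall Y, L *m Y *m A1 = L' *m Y *m A2 -> Y = 0) -> \dim (sol L L' A1 A2) = 0%N.
Proof.
move=> H; apply/eqP; rewrite dimv_eq0 -subv0; apply/subvP=> Y.
by rewrite mem_sol => /eqP /H ->; rewrite mem0v.
Qed.

(** Multiplying by a one-sided inverse leaves C Y N = Y with N a nilpotent shift. In these names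
    [C1] and [1C] stand for a regular test pencil and [E] for the transposed epsilon one; the last
    part is the half of the block tested. *)
Lemma sol_C1_Lm m e (C : 'M[K]_m) : \dim (sol C 1%:M (Lm K e) (Lm' K e)) = 0%N.
Proof.
apply: dim_sol0 => Y /(congr1 (mulmxr (Lm' K e)^T)) /=.
by rewrite mul1mx -!mulmxA Lm_Lm'T Lm'_Lm'T mulmx1 mulmxA; apply/nilp_fix_r/nilp_UshT.
Qed.

Lemma sol_1C_Lm m e (C : 'M[K]_m) : \dim (sol 1%:M C (Lm K e) (Lm' K e)) = 0%N.
Proof.
apply: dim_sol0 => Y /(congr1 (mulmxr (Lm K e)^T)) /= /esym.
by rewrite mul1mx -!mulmxA Lm'_LmT Lm_LmT mulmx1 mulmxA; apply/nilp_fix_r/nilp_Ush.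
Qed.

Lemma sol_E_Lm k e : \dim (sol (Lm K k)^T (Lm' K k)^T (Lm K e) (Lm' K e)) = 0%N.
Proof.
apply: dim_sol0 => Y /(congr1 (fun X => Lm K k *m X *m (Lm K e)^T)) /= /esym.
rewrite -!mulmxA Lm'_LmT Lm_LmT mulmx1 !mulmxA Lm_LmT Lm_Lm'T mul1mx.
by apply/nilp_fix_r/nilp_Ush.
Qed.

Lemma sol_E_1 k n (T : 'M[K]_n) : \dim (sol (Lm K k)^T (Lm' K k)^T 1%:M T) = 0%N.
Proof.
apply: dim_sol0 => Y /(congr1 (fun X => Lm K k *m X)) /= /esym.
rewrite mulmx1 !mulmxA Lm_LmT Lm_Lm'T mul1mx.
by apply/nilp_fix_l/nilp_UshT.
Qed.

Lemma sol_E_T1 k n (T : 'M[K]_n) : \dim (sol (Lm K k)^T (Lm' K k)^T T 1%:M) = 0%N.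
Proof.
apply: dim_sol0 => Y /(congr1 (fun X => Lm' K k *m X)) /=.
rewrite mulmx1 !mulmxA Lm'_LmT Lm'_Lm'T mul1mx.
by apply/nilp_fix_l/nilp_Ush.
Qed.

Lemma sol_C1_U m n (C : 'M[K]_m) (N : 'M[K]_n) : nilp N \/ nilp C -> \dim (sol C 1%:M N 1%:M) = 0%N.
Proof.
move=> H; apply: dim_sol0 => Y; rewrite mul1mx mulmx1.
by case: H; [apply: nilp_fix_r | apply: nilp_fix_l].
Qed.

Lemma sol_1C_U m n (C : 'M[K]_m) (N : 'M[K]_n) : nilp N \/ nilp C -> \dim (sol 1%:M C 1%:M N) = 0%N.
Proof.
move=> H; apply: dim_sol0 => Y; rewrite mul1mx mulmx1 => /esym.
by case: H; [apply: nilp_fix_r | apply: nilp_fix_l].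
Qed.

(** Each column of a solution is [C] times the preceding one, so the first column is arbitrary and
    determines the rest. *)
Lemma sol_C1_LmT m e (C : 'M[K]_m) : \dim (sol C 1%:M (Lm K e)^T (Lm' K e)^T) = m.
Proof.
rewrite (@dim_bij _ _ (@col K m e.+1 ord0) _ fullv) ?dimvf ?dim_matrix ?mulr1 //.
- by move=> *; apply: memvf.
- move=> Y; rewrite mem_sol mul1mx => /eqP e0 c0; apply/matrixP=> i [j hj]; rewrite mxE.
  elim: j i hj => [|j IH] i hj.
    by move/matrixP: c0 => /(_ i 0); rewrite !mxE => <-; congr (Y _ _); apply: val_inj.
  have hj' : (j < e)%N by [].
  move/(congr1 trmx): e0; rewrite !trmx_mul !trmxK => /matrixP /(_ (Ordinal hj') i).
  rewrite mul_Lm mul_Lm' !mxE /= => e1.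
  transitivity (Y i (lift ord0 (Ordinal hj'))); first by congr (Y _ _); apply: val_inj.
  rewrite -e1 big1 // => k _; rewrite mxE.
  by rewrite (_ : widen_ord _ _ = Ordinal (ltnW hj)) ?IH ?mul0r ?mulr0 //; apply: val_inj.
move=> v _; pose F i j := (mpow C j *m v) i 0.
have FS i j : F i j.+1 = \sum_k C i k * F k j.
  by rewrite /F [mpow C _]/(C *m mpow C j) -mulmxA mxE.
exists (\matrix_(i, j) F i j); last first.
  by apply/matrixP=> i j; rewrite !mxE /F /mpow /= mul1mx (ord1 j).
rewrite mem_sol mul1mx; apply/eqP/trmx_inj; rewrite !trmx_mul !trmxK; apply/matrixP=> j i.
by rewrite mul_Lm mul_Lm' !mxE /= FS; apply: eq_bigr => k _; rewrite !mxE mulrC.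
Qed.

(** Here each column is [C] times the following one, so the last column is the free parameter. *)
Lemma sol_1C_LmT m e (C : 'M[K]_m) : \dim (sol 1%:M C (Lm K e)^T (Lm' K e)^T) = m.
Proof.
rewrite (@dim_bij _ _ (@col K m e.+1 ord_max) _ fullv) ?dimvf ?dim_matrix ?mulr1 //.
- by move=> *; apply: memvf.
- move=> Y; rewrite mem_sol mul1mx => /eqP e0 c0.
  have H k (j : 'I_e.+1) i : (e - j)%N = k -> Y i j = 0.
    elim: k j i => [|k IH] j i ej.
      move/matrixP: c0 => /(_ i 0); rewrite !mxE => <-; congr (Y _ _); apply: val_inj => /=.
      by have := ltn_ord j; move: ej; clear; lia.
    have hj : (j < e)%N by move: ej; clear; lia.
    move/(congr1 trmx): e0; rewrite !trmx_mul !trmxK => /matrixP /(_ (Ordinal hj) i).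
    rewrite mul_Lm mul_Lm' !mxE /= => e1.
    transitivity (Y i (widen_ord (leqnSn e) (Ordinal hj))); first by congr (Y _ _); apply: val_inj.
    rewrite e1 big1 // => l _; rewrite mxE IH ?mul0r ?mulr0 //=.
    by rewrite /bump /=; clear -ej hj; lia.
  by apply/matrixP=> i j; rewrite mxE; apply: H erefl.
move=> v _; pose F i j := (mpow C j *m v) i 0.
have FS i j : F i j.+1 = \sum_k C i k * F k j.
  by rewrite /F [mpow C _]/(C *m mpow C j) -mulmxA mxE.
exists (\matrix_(i, j) F i (e - j)%N); last first.
  by apply/matrixP=> i j; rewrite !mxE /= subnn /F /mpow /= mul1mx (ord1 j).
rewrite mem_sol mul1mx; apply/eqP/trmx_inj; rewrite !trmx_mul !trmxK; apply/matrixP=> j i.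
rewrite mul_Lm mul_Lm' !mxE /=.
have -> : (e - j = (e - bump 0 j).+1)%N by rewrite /bump /=; have := ltn_ord j; clear; lia.
by rewrite FS; apply: eq_bigr => k _; rewrite !mxE mulrC.
Qed.
End SolutionSpaces.

(** * Kernels of polynomials in companion matrices, and the remaining test dimensions *)

Section CompanionKernels.
Variable K : fieldType.
Implicit Types p q h : {poly K}.

Lemma rVpoly_modG n p (w : 'rV[K]_n.+2) : p \is monic -> size p = n.+2 ->
  rVpoly (w *m modG n p) = rVpoly w %% p.
Proof.
(* The dividend has degree at most that of [p], so the quotient is its top coefficient. *)
move=> mp sp; apply: (@modpP _ _ (w 0 ord_max)%:P); last by rewrite sp ltnS size_rVpoly.
have pn : p`_n.+1 = 1 by move/monicP: mp; rewrite lead_coefE sp.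
apply/polyP=> i; rewrite coefD coefCM.
have [hi|hi] := ltnP i n.+2; last first.
  by rewrite !nth_default ?mulr0 ?addr0 ?sp // ?(leq_trans (size_rVpoly _)) // ltnW.
have [hi'|hi'] := ltnP i n.+1; last first.
  have ei : i = n.+1 by apply/eqP; rewrite eqn_leq -ltnS hi.
  rewrite ei pn mulr1 [X in _ + X]nth_default ?size_rVpoly // addr0.
  by rewrite -[n.+1]/(nat_of_ord (ord_max : 'I_n.+2)) coef_rVpoly_ord.
rewrite -[i]/(nat_of_ord (Ordinal hi)) coef_rVpoly_ord.
rewrite -[X in _ = _ + (rVpoly _)`_X]/(nat_of_ord (Ordinal hi')) coef_rVpoly_ord.
rewrite mxE big_ord_recr /= (bigD1 (Ordinal hi')) //= !mxE /= eqxx (ltn_eqF hi') eqxx mulr1.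
rewrite big1 ?addr0 => [|j]; last first.
  by rewrite -val_eqE !mxE /= (ltn_eqF (ltn_ord j)) => /negPf ->; rewrite mulr0.
rewrite mulrN (_ : widen_ord _ _ = Ordinal hi); last exact: val_inj.
by rewrite [RHS]addrCA subrr addr0.
Qed.

Lemma rVpoly_comp n p (v : 'rV[K]_n.+1) : p \is monic -> size p = n.+2 ->
  rVpoly (v *m comp_mx n.+1 p) = ('X * rVpoly v) %% p.
Proof. by move=> mp sp; rewrite -Lm'_modG mulmxA rVpoly_modG // rVpoly_Lm'. Qed.

Lemma rVpoly_horner n p (v : 'rV[K]_n.+1) h : p \is monic -> size p = n.+2 ->
  rVpoly (v *m horner_mx (comp_mx n.+1 p) h) = (rVpoly v * h) %% p.
Proof.
move=> mp sp; elim/poly_ind: h => [|h c IH].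
  by rewrite rmorph0 mulmx0 linear0 mulr0 mod0p.
rewrite rmorphD rmorphM /= horner_mx_X horner_mx_C mulmxDr mulmxA linearD /=.
rewrite rVpoly_comp // IH modp_mul mul_mx_scalar linearZ /= mulrDr modpD.
congr (_ + _); first by congr (_ %% _); ring.
rewrite mulrC mul_polyC modpZl modp_small // sp ltnS; exact: size_rVpoly.
Qed.

Definition kerv n m (A : 'M[K]_(n, m)) : {vspace 'rV[K]_n} := lker (linfun (mulmxr A)).

Lemma mem_kerv n m (A : 'M[K]_(n, m)) v : (v \in kerv A) = (v *m A == 0).
Proof. by rewrite memv_ker lfunE. Qed.

Lemma dim_kerv n m (A : 'M[K]_(n, m)) : \dim (kerv A) = (n - \rank A)%N.
Proof.
rewrite -mxrank_ker -[RHS]mul1n -[RHS](dim_matrix K 1 (\rank (kermx A))) -dimvf; apply/esym.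
apply: (@dim_bij _ _ _ (mulmxr (row_base (kermx A)))) => [u _|u _ /= e|v].
- rewrite mem_kerv /=; apply/eqP/sub_kermxP.
  by apply: submx_trans (submxMl _ _) _; rewrite eq_row_base.
- by apply: (row_free_inj (row_base_free (kermx A))); rewrite e mul0mx.
rewrite mem_kerv => /eqP/sub_kermxP; rewrite -(eq_row_base (kermx A)) => /submxP [D ->].
by exists D; rewrite ?memvf.
Qed.

Lemma horner_mxE n (T : 'M[K]_n.+1) q : horner_mx T q = \sum_(i < size q) q`_i *: T ^+ i.
Proof.
rewrite -{1}[q]coefK poly_def linear_sum; apply: eq_bigr => i _.
by rewrite linearZ /= rmorphXn /= horner_mx_X.
Qed.

Lemma trmx_exp n (T : 'M[K]_n.+1) k : (T ^+ k)^T = T^T ^+ k.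
Proof. by elim: k => [|k IH]; rewrite ?trmx1 // exprS exprSr trmx_mul IH. Qed.

Lemma horner_mx_tr n (T : 'M[K]_n.+1) q : horner_mx T^T q = (horner_mx T q)^T.
Proof.
rewrite !horner_mxE linear_sum; apply: eq_bigr => i _.
by rewrite linearZ /= trmx_exp.
Qed.

Lemma row_comp_mx m n q (Y : 'M[K]_(m.+1, n)) i (hi : (i.+1 < m.+1)%N) :
  row (Ordinal (ltnW hi)) (comp_mx m.+1 q *m Y) = row (Ordinal hi) Y.
Proof.
apply/rowP=> j; rewrite !mxE (bigD1 (Ordinal hi)) //= !mxE /= (ltn_eqF (_ : i < m)%N) //.
rewrite eqxx mul1r big1 ?addr0 // => k; rewrite -val_eqE /= => ne.
by rewrite !mxE /= (ltn_eqF (_ : i < m)%N) // eq_sym (negPf ne) mul0r.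
Qed.

Lemma row_comp_mx_max m n q (Y : 'M[K]_(m.+1, n)) :
  row ord_max (comp_mx m.+1 q *m Y) = - \sum_(j < m.+1) q`_j *: row j Y.
Proof.
apply/rowP=> j; rewrite !mxE summxE -sumrN; apply: eq_bigr => k _.
by rewrite !mxE eqxx mulNr.
Qed.

Lemma mul_horner_monic m n q (T : 'M[K]_n.+1) (v : 'rV_n.+1) : q \is monic -> size q = m.+2 ->
  v *m horner_mx T q = \sum_(j < m.+1) q`_j *: (v *m T ^+ j) + v *m T ^+ m.+1.
Proof.
move=> /monicP; rewrite lead_coefE => + sq; rewrite horner_mxE sq big_ord_recr /= => ->.
rewrite scale1r mulmxDr mulmx_sumr; congr (_ + _).
by apply: eq_bigr => j _; rewrite -scalemxAr.
Qed.

(** The Krylov matrix of [v]. *)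
Definition orbit_mx m n (T : 'M[K]_n.+1) (v : 'rV_n.+1) : 'M[K]_(m, n.+1) := \matrix_i (v *m T ^+ i).

Lemma comp_orbit m n q (T : 'M[K]_n.+1) (v : 'rV_n.+1) : q \is monic -> size q = m.+2 ->
  v *m horner_mx T q = 0 -> comp_mx m.+1 q *m orbit_mx m.+1 T v = orbit_mx m.+1 T v *m T.
Proof.
move=> mq sq; rewrite (mul_horner_monic _ _ mq sq) => /eqP; rewrite addr_eq0 => /eqP ev.
apply/row_matrixP=> -[i hi]; have := hi; rewrite ltnS leq_eqVlt => /predU1P [ei|hi'].
  have -> : Ordinal hi = ord_max by apply: val_inj.
  rewrite row_comp_mx_max row_mul rowK /= -mulmxA -[T ^+ m *m T]exprSr.
  rewrite (_ : \sum_j _ = - (v *m T ^+ m.+1)) ?opprK // -ev.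
  by apply: eq_bigr => j _; rewrite rowK.
rewrite (bool_irrelevance hi (ltnW (hi' : i.+1 < m.+1)%N)) row_comp_mx row_mul !rowK /=.
by rewrite exprSr mulmxA.
Qed.

(** The equation C Y = Y T makes [Y] the Krylov matrix of its first row, and its last row says that
    q(T) kills that row. *)
Lemma dim_sol_C1 m n q (T : 'M[K]_n.+1) : q \is monic -> size q = m.+2 ->
  \dim (sol (comp_mx m.+1 q) 1%:M 1%:M T) = (n.+1 - \rank (horner_mx T q))%N.
Proof.
move=> mq sq; rewrite -dim_kerv.
apply: (@dim_bij _ _ _ (@row K m.+1 n.+1 ord0)).
- move=> Y; rewrite mem_sol mul1mx mulmx1 mem_kerv => /eqP e.
  have rY i (hi : (i < m.+1)%N) : row (Ordinal hi) Y = row ord0 Y *m T ^+ i.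
    elim: i hi => [|i IH] hi.
      by rewrite expr0 mulmx1; congr (row _ Y); apply: val_inj.
    by rewrite -(row_comp_mx q) e row_mul IH exprSr mulmxA.
  have e2 := row_comp_mx_max q Y; rewrite e row_mul in e2.
  rewrite (mul_horner_monic _ _ mq sq) addr_eq0 exprSr mulmxA -(rY m (ltnSn m)).
  rewrite -[Ordinal _]/ord_max e2 opprK.
  by apply/eqP; apply: eq_bigr => -[j hj] _ /=; rewrite (rY j hj).
- move=> Y; rewrite mem_sol mul1mx mulmx1 => /eqP e r0; apply/row_matrixP=> -[i hi].
  rewrite row0; elim: i hi => [|i IH] hi.
    by rewrite -r0; congr (row _ Y); apply: val_inj.
  by rewrite -(row_comp_mx q) e row_mul IH mul0mx.
move=> v; rewrite mem_kerv => /eqP ev.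
exists (orbit_mx m.+1 T v); last by rewrite /= rowK expr0 mulmx1.
by rewrite mem_sol mul1mx mulmx1 comp_orbit.
Qed.

(** The companion matrix is multiplication by x modulo [p], so the kernel of [q] consists of the
    multiples of [r] modulo [p = g * r], parametrized by polynomials of degree below that of [g]. *)
Lemma rank_horner_comp n p q (g r : {poly K}) : p \is monic -> size p = n.+2 -> p = g * r ->
  (forall v, (p %| v * q) = (r %| v)) ->
  (n.+1 - \rank (horner_mx (comp_mx n.+1 p) q) = (size g).-1)%N.
Proof.
move=> mp sp ep H; rewrite -dim_kerv.
have p0 := monic_neq0 mp.
have [g0 r0] : g != 0 /\ r != 0 by apply/andP; rewrite -negb_or -mulf_eq0 -ep.
have mem v : (v \in kerv (horner_mx (comp_mx n.+1 p) q)) = (r %| rVpoly v).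
  rewrite mem_kerv -H -(inj_eq (can_inj (@rVpolyK K n.+1))) linear0.
  by rewrite rVpoly_horner.
have sg : ((size g).-1 + size r = n.+2)%N.
  rewrite -sp ep size_mul // -!subn1; have := size_poly_gt0 g; rewrite g0.
  by move: (size g) (size r) => a b; clear; lia.
move: ((size g).-1) sg => d sg.
rewrite -[RHS]mul1n -[RHS](dim_matrix K 1 d) -dimvf; apply/esym.
have sz (u : 'rV[K]_d) : (size (r * rVpoly u)%R <= n.+1)%N.
  apply: leq_trans (size_polyMleq _ _) _; rewrite -ltnS -sg -ltnS.
  have := size_rVpoly u; have := size_poly_gt0 r; rewrite r0.
  by move: (size r) (size (rVpoly u)) => a b; clear; lia.
apply: (@dim_bij _ _ _ (poly_rV \o (r \*o rVpoly))) => [u _|u _|v].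
- by rewrite mem /= poly_rV_K ?dvdp_mulr.
- move/(congr1 rVpoly); rewrite /= poly_rV_K // linear0 => /eqP; rewrite mulf_eq0 (negPf r0) /=.
  by move/eqP=> e; apply: (can_inj (@rVpolyK K _)); rewrite e linear0.
rewrite mem => /dvdpP [w ew]; exists (poly_rV w); first exact: memvf.
rewrite /= poly_rV_K; first by rewrite mulrC -ew rVpolyK.
have [->|w0] := eqVneq w 0; first by rewrite size_poly0.
have := size_rVpoly v; rewrite ew size_mul // -ltnS -sg.
have := size_poly_gt0 r; have := size_poly_gt0 w; rewrite r0 w0.
by move: (size r) (size w) => a b; clear; lia.
Qed.

Lemma dim_sol_E_LmT k e :
  \dim (sol (Lm K k)^T (Lm' K k)^T (Lm K e)^T (Lm' K e)^T) = (k - e)%N.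
Proof.
(* The entries of [Y], extended by zero to all natural indices, so that the two shifts need no
   bounds. *)
pose P (Y : 'M[K]_(k, e.+1)) i j := \sum_(a < k) \sum_(b < e.+1) Y a b *+ ((a == i :> nat) && (b == j :> nat)).
have PE Y i j (hi : (i < k)%N) (hj : (j < e.+1)%N) : P Y i j = Y (Ordinal hi) (Ordinal hj).
  rewrite /P (bigD1 (Ordinal hi)) //= (bigD1 (Ordinal hj)) //= !eqxx mulr1n.
  rewrite big1 ?addr0 => [|b]; last by rewrite -val_eqE /= => /negPf ->; rewrite ?andbF mulr0n.
  rewrite big1 ?addr0 // => a; rewrite -val_eqE /= => /negPf ->.
  by rewrite big1 // => b _; rewrite mulr0n.
have P0 Y i j : (k <= i)%N -> P Y i j = 0.
  move=> hi; rewrite /P big1 // => a _; rewrite big1 // => b _.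
  by rewrite (ltn_eqF (leq_trans (ltn_ord a) hi)).
have Y1 (Y : 'M[K]_(k, e.+1)) (i : 'I_k.+1) (j : 'I_e) : ((Lm K k)^T *m Y *m (Lm K e)^T) i j = P Y i j.
  rewrite mxE /P exchange_big; apply: eq_bigr => b _ /=; rewrite !mxE mulr_suml.
  apply: eq_bigr => a _; rewrite !mxE [(b == _ :> nat)]eq_sym.
  by case: eqP => _; case: eqP => _ /=; rewrite ?mul1r ?mul0r ?mulr0 ?mulr1.
have Y2 (Y : 'M[K]_(k, e.+1)) (i : 'I_k.+1) (j : 'I_e) : ((Lm' K k)^T *m Y *m (Lm' K e)^T) i j =
    if (i : nat) is i'.+1 then P Y i' j.+1 else 0.
  rewrite mxE; under eq_bigr => b _ do rewrite !mxE mulr_suml.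
  case: i => [[|i] hi] /=.
    by rewrite big1 // => b _; rewrite big1 // => a _; rewrite !mxE /= mul0r mul0r.
  rewrite /P exchange_big; apply: eq_bigr => b _ /=.
  apply: eq_bigr => a _; rewrite !mxE /= eqSS [X in _ && X]eq_sym.
  by case: eqP => _; case: eqP => _ /=; rewrite ?mul1r ?mul0r ?mulr0 ?mulr1.
have memP Y : reflect (forall i j, (i <= k)%N -> (j < e)%N ->
      P Y i j = if i is i'.+1 then P Y i' j.+1 else 0)
    (Y \in sol (Lm K k)^T (Lm' K k)^T (Lm K e)^T (Lm' K e)^T).
  rewrite mem_sol; apply: (iffP eqP) => [e0 i j hi hj|H].
    by have := congr1 (fun X : 'M_(_, _) => X (Ordinal (hi : i < k.+1)%N) (Ordinal hj)) e0; rewrite Y1 Y2.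
  by apply/matrixP=> i j; rewrite Y1 Y2 H // -ltnS.
(* A solution is constant along antidiagonals, [P Y i j = c (i + j)], with [c] supported
   on the interval from [e] to [k - 1]. *)
have PA Y j i : Y \in sol (Lm K k)^T (Lm' K k)^T (Lm K e)^T (Lm' K e)^T -> (j <= e)%N -> (i + j <= k)%N ->
    P Y i j = P Y (i + j)%N 0%N.
  move/memP=> H; elim: j i => [|j IH] i hj hij; first by rewrite addn0.
  have hi : (i < k)%N by move: hij; clear; lia.
  have /= <- := H i.+1 j hi hj.
  by rewrite addnS -addSn IH // ?(ltnW hj) // addSnnS.
have PB Y i j : Y \in sol (Lm K k)^T (Lm' K k)^T (Lm K e)^T (Lm' K e)^T -> (j <= e)%N -> (k <= i + j)%N ->
    P Y i j = 0.
  move/memP=> H; elim: j i => [|j IH] i hj hij; first by rewrite P0 // -(addn0 i).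
  have [hi|hi] := leqP k i; first exact: P0.
  by have := H i.+1 j hi hj => /= <-; apply: IH; rewrite ?(ltnW hj) // addSnnS.
have PC Y i j : Y \in sol (Lm K k)^T (Lm' K k)^T (Lm K e)^T (Lm' K e)^T -> (i + j < e)%N -> P Y i j = 0.
  move/memP=> H; elim: i j => [|i IH] j hij.
    by rewrite H.
  have [hi|hi] := leqP k i; first by rewrite P0 // ltnW.
  by rewrite H ?IH ?addnS //; apply: leq_ltn_trans hij; rewrite leq_addl.
rewrite -[RHS]muln1 -[RHS](dim_matrix K (k - e) 1) -dimvf.
(* The free values are read off in the first column, from row [e] to row [k - 1]. *)
have ht (t : 'I_(k - e)) : (e + t < k)%N by have := ltn_ord t; clear; lia.
apply: (@dim_bij _ _ _ (@mxsub K k e.+1 (k - e) 1 (fun t => Ordinal (ht t)) (fun=> ord0))).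
- by move=> *; apply: memvf.
- move=> Y YS f0; apply/matrixP=> i j; rewrite mxE.
  have -> : Y i j = P Y i j.
    by rewrite PE; congr (Y _ _); apply: val_inj.
  have hj : (j <= e)%N by rewrite -ltnS.
  have [h1|h1] := leqP k (i + j); first exact: PB.
  have [h2|h2] := ltnP (i + j) e; first exact: PC.
  rewrite PA // ?(ltnW h1) // (PE _ _ _ h1 (ltn0Sn e)).
  have ht' : (i + j - e < k - e)%N by move: h1 h2; clear; lia.
  move/matrixP: f0 => /(_ (Ordinal ht') 0); rewrite !mxE => <-.
  by congr (Y _ _); apply: val_inj => //=; rewrite subnKC.
move=> c _; pose c' i := if insub i is Some t then c t 0 else 0.
pose Y : 'M[K]_(k, e.+1) := \matrix_(i, j) (if (e <= i + j)%N then c' (i + j - e)%N else 0).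
have YP i j (hj : (j <= e)%N) : P Y i j = if (i < k)%N && (e <= i + j)%N then c' (i + j - e)%N else 0.
  by case: ltnP => hi /=; [rewrite (PE _ _ _ hi (hj : j < e.+1)%N) mxE | rewrite P0].
exists Y; last first.
  apply/matrixP=> t j; rewrite !mxE /= addn0 leq_addr addKn /c'.
  by rewrite valK (ord1 j).
apply/memP=> i j hi hj; rewrite YP ?(ltnW hj) //.
case: i hi => [|i] hi /=; first by rewrite add0n (leqNgt e) hj andbF.
rewrite YP // addSnnS hi /=; case: ltnP => //= hi'.
case: ifP => // h; rewrite /c' insubF //; apply/negbTE; move: hi' hi h; clear; lia.
Qed.
End CompanionKernels.

(** * Multiplicities as second differences of test dimensions *)

Section Uniqueness.
Variable K : fieldType.
Implicit Types (g h : bpoly K) (p q f : {poly K}).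

Lemma irreducible_coprime f f' : f \is monic -> f' \is monic ->
  irreducible_poly f -> irreducible_poly f' -> f != f' -> coprimep f f'.
Proof.
move=> mf mf' [_ irf] [_ irf'] ne; apply/coprimepP=> d df df'; rewrite -size_poly_eq1.
apply: contraNT ne => sd; rewrite -eqp_monic //.
by apply: eqp_trans (irf' d sd df'); rewrite eqp_sym; apply: irf.
Qed.

Lemma size_exp_pred f k : f \is monic -> (1 < size f)%N -> (0 < k)%N ->
  size (f ^+ k) = ((size f).-1 * k).-1.+2.
Proof.
move=> mf sf k0; rewrite prednK; first last.
  by rewrite muln_gt0 k0 andbT -subn1 subn_gt0.
by rewrite -size_exp prednK // size_poly_gt0 expf_neq0 // monic_neq0.
Qed.

Lemma nullity_same f k d n : f \is monic -> (1 < size f)%N -> size (f ^+ d) = n.+2 ->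
  (n.+1 - \rank (horner_mx (comp_mx n.+1 (f ^+ d)) (f ^+ k)) = (size f).-1 * minn k d)%N.
Proof.
move=> mf sf sd; have f0 := monic_neq0 mf; have md := monic_exp d mf.
case: (leqP k d) => kd.
  rewrite (@rank_horner_comp _ _ _ _ (f ^+ k) (f ^+ (d - k))) ?size_exp //.
    by rewrite -exprD subnKC.
  by move=> v; rewrite -{1}(subnK kd) exprD dvdp_mul2r // expf_neq0.
rewrite (@rank_horner_comp _ _ _ _ (f ^+ d) 1) ?mulr1 ?size_exp // => v.
by rewrite dvd1p -(subnK (ltnW kd)) exprD mulrA dvdp_mull.
Qed.

Lemma nullity_coprime f f' k d n : f' \is monic -> coprimep f f' -> size (f' ^+ d) = n.+2 ->
  (n.+1 - \rank (horner_mx (comp_mx n.+1 (f' ^+ d)) (f ^+ k)) = 0)%N.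
Proof.
move=> mf' co sd; rewrite (@rank_horner_comp _ _ _ _ 1 (f' ^+ d)) ?mul1r ?size_poly1 ?monic_exp //.
by move=> v; rewrite Gauss_dvdpl // coprimep_sym coprimep_expl // coprimep_expr.
Qed.

Lemma sol_swap l m n n' (L L' : 'M[K]_(l, m)) (A B : 'M[K]_(n, n')) :
  \dim (sol L L' A B) = \dim (sol L' L B A).
Proof. by congr (\dim _); apply/vspaceP=> Y; rewrite !mem_sol eq_sym. Qed.

(* The dimension of the test space attached to [g ^+ k] on the block [(x, d)]: its second
   difference in [k] detects exactly the blocks [(Some g, k)]. *)
Definition weight g D k (x : ptilde K) d :=
  if x is Some h then (if h == g then 2 * (D * minn k d) else 0)%N else (D * k)%N.

(** The empty pencil is the test of exponent 0, which the second difference needs at d = 1. *)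
Lemma nul_empty (L : 'M[K]_(0, 0)) A : nul L L A = 0%N.
Proof.
by apply/eqP; rewrite -leqn0 (leq_trans (dimvS (subvf _))) // dimvf dim_matrix mul0r.
Qed.

Lemma weight0 g D x d : weight g D 0 x d = 0%N.
Proof. by case: x => [h|] /=; rewrite ?min0n muln0 // muln0 if_same. Qed.

(** The test pencil is the regular one of [f ^+ k]. A finite block contributes the nullity of
    [f ^+ k] at its companion matrix and at the transpose; an infinite block contributes nothing by
    nilpotency. *)
Lemma test_fin f k : f \is monic -> irreducible_poly f -> (0 < k)%N ->
  exists m (L L' : 'M[K]_m), forall x d, valid_block (x, d) ->
    nul L L' (Rblock x d) = weight (hom (size f).-1 f) (size f).-1 k x d.
Proof.
move=> mf irf k0; have sf := irf.1; have sq := size_exp_pred mf sf k0.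
have mq := monic_exp k mf; have D0 : (0 < (size f).-1 * k)%N.
  by rewrite muln_gt0 k0 andbT -subn1 subn_gt0.
exists ((size f).-1 * k).-1.+1, (comp_mx _ (f ^+ k)), 1%:M => x d [/= d0 vx].
case: x vx => [h|] vx; last first.
  case: d d0 => // e _; rewrite [Rblock _ _]R_minusE nul_plus sol_C1_Lm sol_C1_LmT.
  by rewrite add0n prednK.
have Ph := vx _ erefl; rewrite /Rblock; case: eqP => [->|/eqP nX].
  rewrite R_infE nul_plus comp_Ush trmx1 /= eq_sym (negPf (X2_neq_hom mf)).
  by rewrite !sol_C1_U //; [left; apply: nilp_UshT | left; apply: nilp_Ush].
have [f' [mf' irf' eh]] := inP_monic Ph nX.
have -> : map_poly (fun c : {poly K} => c.[1]) h = f' by rewrite -/(dehom h) eh homK ?leqSpred.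
have sf' := irf'.1; have sp := size_exp_pred mf' sf' d0.
rewrite (@R_finE _ ((size f').-1 * d).-1.+1) ?sp // nul_plus trmx1 !dim_sol_C1 //.
rewrite horner_mx_tr mxrank_tr addnn -mul2n /=.
have [ef|nf] := eqVneq f f'.
  by rewrite eh -ef eqxx nullity_same // size_exp_pred.
rewrite (nullity_coprime _ mf' _ sp) ?irreducible_coprime //; case: eqP => // e.
case/eqP: nf; rewrite -(@homK _ (size f).-1 f) ?leqSpred // -e eh homK ?leqSpred //.
Qed.

Lemma test_inf k : (0 < k)%N ->
  exists m (L L' : 'M[K]_m), forall x d, valid_block (x, d) ->
    nul L L' (Rblock x d) = weight (X2 K) 1 k x d.
Proof.
case: k => // k _; have mX := monicX K; have sX := size_polyX K.
exists k.+1, 1%:M, (Ush K k.+1) => x d [/= d0 vx].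
case: x vx => [h|] vx; last first.
  case: d d0 => // e _; rewrite [Rblock _ _]R_minusE nul_plus sol_1C_Lm sol_1C_LmT.
  by rewrite /weight add0n mul1n.
have Ph := vx _ erefl; rewrite /Rblock /weight; case: eqP => [_|/eqP nX].
  case: d d0 {vx} => // d _; rewrite R_infE nul_plus trmx1 [X in (X + _)%N]sol_swap [X in (_ + X)%N]sol_swap.
  rewrite -(comp_Ush K k.+1).
  rewrite !dim_sol_C1 ?monicXn ?size_polyXn // horner_mx_tr mxrank_tr addnn -mul2n.
  by rewrite nullity_same ?sX ?size_polyXn.
have [f' [mf' irf' eh]] := inP_monic Ph nX.
rewrite (@R_finE _ _ _ erefl) nul_plus trmx1 !sol_1C_U //; right; exact: nilp_Ush.
Qed.

Lemma test_regular g : inP g -> exists2 D, (0 < D)%N & forall k,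
  exists m (L L' : 'M[K]_m), forall x d, valid_block (x, d) ->
    nul L L' (Rblock x d) = weight g D k x d.
Proof.
move=> Pg; have [->|nX] := eqVneq g (X2 K).
  exists 1%N => // -[|k]; last exact: test_inf.
  by exists 0%N, 0, 0 => x d _; rewrite nul_empty weight0.
have [f [mf irf ->]] := inP_monic Pg nX; have sf := irf.1.
exists (size f).-1; first by rewrite -subn1 subn_gt0.
move=> [|k]; last exact: test_fin.
by exists 0%N, 0, 0 => x d _; rewrite nul_empty weight0.
Qed.

Lemma test_minus k : exists l m (L L' : 'M[K]_(l, m)), forall x d, valid_block (x, d) ->
    nul L L' (Rblock x d) = if x is None then (k.+1 - d)%N else 0%N.
Proof.
exists k.+1, k, (Lm K k)^T, (Lm' K k)^T => x d [/= d0 vx].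
case: x vx => [h|] vx; last first.
  by case: d d0 => // e _; rewrite [Rblock _ _]R_minusE nul_plus sol_E_Lm dim_sol_E_LmT.
rewrite /Rblock; case: eqP => _.
  by rewrite R_infE nul_plus trmx1 !sol_E_T1.
by rewrite (@R_finE _ _ _ erefl) nul_plus trmx1 !sol_E_1.
Qed.

Lemma cong_sum l m (L L' : 'M[K]_(l, m)) (w : ptilde K -> nat -> nat) s s' :
  (forall x d, valid_block (x, d) -> nul L L' (Rblock x d) = w x d) ->
  (forall xd, xd \in s -> valid_block xd) -> (forall xd, xd \in s' -> valid_block xd) ->
  cong (Atilde_seq s) (Atilde_seq s') ->
  (\sum_(x <- s) w x.1 x.2 = \sum_(x <- s') w x.1 x.2)%N.
Proof.
move=> H vs vs' c.
have E (t : seq (ptilde K * nat)) : (forall xd, xd \in t -> valid_block xd) ->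
    (\sum_(x <- t) w x.1 x.2 = nul L L' (Atilde_seq t))%N.
  move=> vt; rewrite nul_Atilde !big_seq; apply: eq_bigr => -[x d] xt /=.
  by rewrite H //; apply: vt.
by rewrite !E // (nul_cong _ _ c).
Qed.

Lemma count_sum (T : eqType) (a : T) (s : seq T) : count_mem a s = (\sum_(x <- s) (x == a))%N.
Proof. by elim: s => [|x s IH]; rewrite ?big_nil ?big_cons //= -IH. Qed.

Lemma cong_perm (s s' : seq (ptilde K * nat)) :
  (forall xd, xd \in s -> valid_block xd) -> (forall xd, xd \in s' -> valid_block xd) ->
  cong (Atilde_seq s) (Atilde_seq s') -> perm_eq s s'.
Proof.
move=> vs vs' c; apply/allP=> -[x d] _ /=; apply/eqP.
have [v|nv] := classic (valid_block (x, d)); last first.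
  have z (t : seq (ptilde K * nat)) : (forall xd, xd \in t -> valid_block xd) -> count_mem (x, d) t = 0%N.
    by move=> vt; apply/count_memPn/negP=> /vt.
  by rewrite !z.
have [/= d0 vx] := v; case: x v vx => [g|] v vx; last first.
  (* Written with [k.-1.+1] so that the tests at [d.+1], [d], [d.-1] give these very numbers. For d
     = 1 the last one is 1 instead of 0, which changes nothing since [y.2] is positive. *)
  have S k : (\sum_(y <- s) (if y.1 is None then k.-1.+1 - y.2 else 0) =
              \sum_(y <- s') (if y.1 is None then k.-1.+1 - y.2 else 0))%N.
    have [l [m [L [L' H]]]] := test_minus k.-1.
    exact: (cong_sum H vs vs' c).
  have E (t : seq (ptilde K * nat)) : (forall xd, xd \in t -> valid_block xd) ->
      (\sum_(y <- t) (if y.1 is None then (d.+1.-1.+1 - y.2)%N else 0%N) +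
       \sum_(y <- t) (if y.1 is None then (d.-1.-1.+1 - y.2)%N else 0%N) =
       (\sum_(y <- t) (if y.1 is None then (d.-1.+1 - y.2)%N else 0%N)).*2
       + count_mem (None, d) t)%N.
    move=> vt; rewrite count_sum -addnn -!big_split !big_seq /=; apply: eq_bigr => -[[h|] j] jt //=.
    have [/= j0 _] := vt _ jt; rewrite xpair_eqE eqxx /=.
    by case: eqP => [->|ne]; move: d0 j0; [|move: ne]; clear; lia.
  have := E s vs; rewrite !S E // => /addnI; exact.
have Pg := vx _ erefl; have [D D0 T] := test_regular Pg.
have S k : (\sum_(y <- s) weight g D k y.1 y.2 = \sum_(y <- s') weight g D k y.1 y.2)%N.
  have [m [L [L' H]]] := T k; exact: (cong_sum H vs vs' c).
(* The function min(k, j) of k is concave with its only break at k = j; the factor 2 comes from the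
   doubling and [D] is the degree of [g]. *)
have E (t : seq (ptilde K * nat)) : (forall xd, xd \in t -> valid_block xd) ->
   ((\sum_(y <- t) weight g D d y.1 y.2).*2 =
    \sum_(y <- t) weight g D d.+1 y.1 y.2 + \sum_(y <- t) weight g D d.-1 y.1 y.2 +
    2 * D * count_mem (Some g, d) t)%N.
  move=> vt; rewrite count_sum -addnn big_distrr -!big_split !big_seq /=; apply: eq_bigr => -[x j] jt /=.
  have [/= j0 _] := vt _ jt; rewrite /weight xpair_eqE; case: x jt => [h|] jt; last first.
    by rewrite muln0 addn0 -!mulnDr; congr muln; move: d0; clear; lia.
  rewrite (inj_eq Some_inj); case: eqP => _ /=; last by rewrite muln0.
  have -> : (j == d : nat) = (2 * minn d j - minn d.+1 j - minn d.-1 j)%N.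
    by case: eqP => [->|]; move: d0; clear; lia.
  have hle : (minn d.+1 j + minn d.-1 j <= 2 * minn d j)%N by move: d0; clear; lia.
  move: (minn d.+1 j) (minn d.-1 j) (minn d j) hle => a b c' hle.
  rewrite -!(mulnA 2%N) -!mulnDr addnn -mul2n; congr muln; congr muln.
  by move: hle; clear; lia.
have := E s vs; rewrite !S (E s') // => /addnI /eqP.
by rewrite eqn_pmul2l ?muln_gt0 ?D0 // => /eqP ->.
Qed.
End Uniqueness.

(** * Splitting off blocks *)

Section Splitting.
Variable K : fieldType.

(** Both products X A_i have rows in the span of [H], which has only r + s rows. The kernel of [H^T]
    is thus orthogonal to [X] for both forms at once and has the complementary dimension;
    invertibility of X H^T makes the sum direct. *)
Lemma split_plus n (A1 A2 : 'M[K]_n) r s (W : 'M[K]_(r, n)) (U : 'M[K]_(s, n))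
    (R1 R2 : 'M[K]_(r, s)) (H : 'M[K]_(r + s, n)) (D1 D2 : 'M[K]_(r + s)) :
  A1^T = - A1 -> A2^T = - A2 ->
  W *m A1 *m W^T = 0 -> W *m A2 *m W^T = 0 -> U *m A1 *m U^T = 0 -> U *m A2 *m U^T = 0 ->
  W *m A1 *m U^T = R1 -> W *m A2 *m U^T = R2 ->
  col_mx W U *m H^T \in unitmx ->
  col_mx W U *m A1 = D1 *m H -> col_mx W U *m A2 = D2 *m H ->
  exists A' : mpair K, [/\ skew_pair A', (r + s + msz A')%N = n &
    cong (MPair A1 A2) (dsum (plus_pair R1 R2) A')].
Proof.
set X := col_mx W U => sk1 sk2 W1 W2 U1 U2 E1 E2 uXH XD1 XD2.
have fH : row_full H^T.
  by apply/row_fullP; exists (invmx (X *m H^T) *m X); rewrite -mulmxA mulVmx.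
have [m [Z [ZH fZ em]]] :
    exists m (Z : 'M[K]_(m, n)), [/\ Z *m H^T = 0, row_free Z & (r + s + m)%N = n].
  exists (\rank (kermx H^T)), (row_base (kermx H^T)); split.
  - by apply/sub_kermxP; rewrite eq_row_base.
  - exact: row_base_free.
  by rewrite mxrank_ker (eqP fH) subnKC // -(eqP fH) rank_leq_row.
have HZ : H *m Z^T = 0 by apply: trmx_inj; rewrite trmx_mul trmxK ZH trmx0.
pose P := col_mx X Z.
have fP : row_free P.
  apply: inj_row_free => v; rewrite -[v]hsubmxK mul_row_col => e0.
  have x0 : lsubmx v = 0.
    have := congr1 (mulmxr (H^T)) e0.
    rewrite /= mulmxDl -!mulmxA ZH mulmx0 addr0 mul0mx => /(congr1 (mulmxr (invmx (X *m H^T)))) /=.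
    by rewrite mulmxK // mul0mx.
  rewrite x0 mul0mx add0r in e0; rewrite x0.
  have -> : rsubmx v = 0 by apply: (row_free_inj fZ); rewrite e0 mul0mx.
  by rewrite row_mx0.
have gP : row_full P by rewrite /row_full (eqP fP) em.
have blk (Ai : 'M[K]_n) (Ri : 'M[K]_(r, s)) (Di : 'M[K]_(r + s)) : Ai^T = - Ai ->
    W *m Ai *m W^T = 0 -> U *m Ai *m U^T = 0 -> W *m Ai *m U^T = Ri -> X *m Ai = Di *m H ->
    block_mx (block_mx 0 Ri (- Ri^T) 0) 0 0 (Z *m Ai *m Z^T) = P *m Ai *m P^T.
  move=> sk Wi Ui Ei XDi; rewrite /P mul_col_mx tr_col_mx mul_col_row; congr block_mx.
  - rewrite /X mul_col_mx tr_col_mx mul_col_row Wi Ui Ei; congr block_mx.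
    by rewrite -Ei !trmx_mul trmxK sk mulNmx mulmxN opprK mulmxA.
  - by rewrite XDi -mulmxA HZ mulmx0.
  have -> : Z *m Ai *m X^T = - (X *m Ai *m Z^T)^T.
    by rewrite !trmx_mul trmxK sk mulNmx mulmxN opprK mulmxA.
  by rewrite XDi -mulmxA HZ mulmx0 trmx0 oppr0.
exists (MPair (Z *m A1 *m Z^T) (Z *m A2 *m Z^T)); split=> //.
  by split; rewrite /= !trmx_mul trmxK ?sk1 ?sk2 mulNmx mulmxN mulmxA.
exists P, (pinvmx P); split.
- exact: mulmxVp.
- exact: mulVpmx.
- exact: blk XD1.
exact: blk XD2.
Qed.

Lemma tr_mxvec m n (X Y : 'M[K]_(m, n)) : (mxvec X *m (mxvec Y)^T) 0 0 = \tr (X *m Y^T).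
Proof.
rewrite mxE (reindex _ (curry_mxvec_bij _ _)) /= /mxtrace.
under [RHS]eq_bigr do rewrite mxE.
by rewrite pair_bigA; apply: eq_bigr => -[i j] _ /=; rewrite !mxE !mxvecE.
Qed.

Lemma tr_nondeg m n (Y : 'M[K]_(m, n)) : (forall X, \tr (X *m Y^T) = 0) -> Y = 0.
Proof.
move=> H; apply/matrixP=> i j; rewrite mxE -[RHS](H (delta_mx i j)).
rewrite /mxtrace (bigD1 i) //= big1 ?addr0 => [|k /negPf ki].
  rewrite mxE (bigD1 j) //= big1 ?addr0 ?mxE ?eqxx ?mul1r // => k /negPf kj.
  by rewrite !mxE kj andbF mul0r.
by rewrite mxE big1 // => l _; rewrite !mxE ki mul0r.
Qed.

(** Fredholm alternative for the trace pairing: [G] is the adjoint of (F1, F2), and (0, b) lies in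
    the image once it is orthogonal to the kernel of [G]. *)
Lemma linear_duality p q r1 s1 r2 s2
    (F1 : {linear 'M[K]_(p, q) -> 'M[K]_(r1, s1)}) (F2 : {linear 'M[K]_(p, q) -> 'M[K]_(r2, s2)})
    (G : 'M[K]_(r1, s1) -> 'M[K]_(r2, s2) -> 'M[K]_(p, q)) (b : 'M[K]_(r2, s2)) :
  (forall X Y1 Y2, \tr (F1 X *m Y1^T) + \tr (F2 X *m Y2^T) = \tr (X *m (G Y1 Y2)^T)) ->
  (forall Y1 Y2, G Y1 Y2 = 0 -> \tr (b *m Y2^T) = 0) ->
  exists X, F1 X = 0 /\ F2 X = b.
Proof.
move=> adj H; pose B := row_mx (lin_mx F1) (lin_mx F2).
suff : (row_mx 0 (mxvec b) <= B)%MS.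
  case/submxP=> x; rewrite -[x]vec_mxK mul_mx_row !mul_vec_lin => /eq_row_mx [e1 e2].
  exists (vec_mx x); split; apply: (can_inj mxvecK); rewrite -?e1 -?e2 ?linear0 //.
rewrite submxE; apply/eqP/matrixP=> i j; rewrite [RHS]mxE (ord1 i).
(* A column of the cokernel matrix is an annihilator of the image; cut in two and reshaped, it
   becomes an element of the kernel of [G]. *)
pose c := col j (cokermx B).
have Bc : B *m c = 0 by rewrite /c colE mulmxA mulmx_coker mul0mx.
have [Y1 [Y2 ec]] : exists (Y1 : 'M[K]_(r1, s1)) (Y2 : 'M[K]_(r2, s2)),
    c = col_mx (mxvec Y1)^T (mxvec Y2)^T.
  exists (vec_mx (usubmx c)^T), (vec_mx (dsubmx c)^T).
  by rewrite !vec_mxK !trmxK vsubmxK.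
have G0 : G Y1 Y2 = 0.
  apply: tr_nondeg => X; rewrite -adj -!tr_mxvec -(mul_vec_lin F1) -(mul_vec_lin F2) -!mulmxA.
  have := congr1 (fun M => (mxvec X *m M) 0 0) Bc.
  by rewrite ec mul_row_col mulmxDr mulmx0 mxE => e; apply: etrans e _; rewrite mxE.
have := H _ _ G0; rewrite -tr_mxvec => <-.
transitivity ((row_mx 0 (mxvec b) *m c) 0 0); first by rewrite /c !mxE; apply: eq_bigr => k _; rewrite !mxE.
by rewrite ec mul_row_col mul0mx add0r.
Qed.

(** A Hankel matrix is symmetric, so a skew one is zero in characteristic other than 2. The
    induction moves towards the diagonal two steps at a time, from both ends. *)
Lemma skew_hankel d (S : 'M[K]_d) : 2%N \notin [pchar K] -> S^T = - S ->
  (forall i j (hi : (i.+1 < d)%N) (hj : (j.+1 < d)%N),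
     S (Ordinal (ltnW hi)) (Ordinal hj) = S (Ordinal hi) (Ordinal (ltnW hj))) -> S = 0.
Proof.
move=> h2 sk hk.
have half (x : K) : x = - x -> x = 0.
  move/eqP; rewrite -addr_eq0 -mulr2n -mulr_natl mulf_eq0 => /orP[e|/eqP //].
  by case/negP: h2; rewrite inE /= e.
have sS i j : S i j = - S j i by have /matrixP /(_ j i) := sk; rewrite !mxE.
have up k i (hi : (i < d)%N) (hk' : (i + k < d)%N) : S (Ordinal hi) (Ordinal hk') = 0.
  elim/ltn_ind: k i hi hk' => -[|[|k]] IH i hi hik.
  - have -> : Ordinal hik = Ordinal hi by apply: val_inj; rewrite /= addn0.
    by apply: half; rewrite {1}sS.
  - have hi1 : (i.+1 < d)%N by rewrite -addn1.
    have -> : Ordinal hik = Ordinal hi1 by apply: val_inj; rewrite /= addn1.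
    rewrite (bool_irrelevance hi (ltnW hi1)); apply: half.
    by rewrite {1}(hk i i hi1 hi1) sS.
  have hi1 : (i.+1 < d)%N by move: hik; clear; lia.
  have hj1 : ((i.+1 + k).+1 < d)%N by move: hik; clear; lia.
  have -> : Ordinal hik = Ordinal hj1 by apply: val_inj; rewrite /= addSn !addnS.
  rewrite (bool_irrelevance hi (ltnW hi1)) hk.
  have := IH k _ i.+1 hi1 (ltnW hj1); apply; exact: leqnSn.
apply/matrixP=> i j; rewrite mxE.
wlog ij : i j / (i <= j)%N.
  by move=> W; case/orP: (leq_total i j) => /W // e; rewrite sS e oppr0.
have hij : (i + (j - i) < d)%N by rewrite subnKC.
rewrite -[RHS](up (j - i)%N i (ltn_ord i) hij); congr (S _ _); apply: val_inj => //=.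
by rewrite subnKC.
Qed.
End Splitting.

(** * Kernel chains and chains at infinity *)

Section MinusSplitting.
Variable K : fieldType.

Lemma mul_UshT k m (X : 'M[K]_(k, m)) i (hi : (i.+1 < k)%N) j :
  ((Ush K k)^T *m X) (Ordinal hi) j = X (Ordinal (ltnW hi)) j.
Proof.
rewrite mxE (bigD1 (Ordinal (ltnW hi))) //= !mxE eqxx mul1r big1 ?addr0 // => l.
by rewrite -val_eqE /= !mxE eqSS => /negPf ->; rewrite mul0r.
Qed.

Lemma mul_UshT0 k m (X : 'M[K]_(k, m)) (h0 : (0 < k)%N) j :
  ((Ush K k)^T *m X) (Ordinal h0) j = 0.
Proof. by rewrite mxE big1 // => l _; rewrite !mxE mul0r. Qed.

Lemma mul_Ush k m (X : 'M[K]_(k, m)) i (hi : (i.+1 < k)%N) j :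
  (Ush K k *m X) (Ordinal (ltnW hi)) j = X (Ordinal hi) j.
Proof.
rewrite mxE (bigD1 (Ordinal hi)) //= !mxE eqxx mul1r big1 ?addr0 // => l.
by rewrite -val_eqE /= !mxE eq_sym => /negPf ->; rewrite mul0r.
Qed.

Lemma mulr_Ush k m (X : 'M[K]_(m, k)) i j (hj : (j.+1 < k)%N) :
  (X *m Ush K k) i (Ordinal hj) = X i (Ordinal (ltnW hj)).
Proof.
rewrite mxE (bigD1 (Ordinal (ltnW hj))) //= !mxE eqxx mulr1 big1 ?addr0 // => l.
by rewrite -val_eqE /= !mxE eqSS => /negPf ->; rewrite mulr0.
Qed.

Lemma mul_Ush_last k m (X : 'M[K]_(k, m)) i (hi : (i < k)%N) j : i.+1 = k ->
  (Ush K k *m X) (Ordinal hi) j = 0.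
Proof.
move=> ek; rewrite mxE big1 // => l _; rewrite !mxE /=.
by rewrite ek eq_sym (ltn_eqF (ltn_ord l)) mul0r.
Qed.

Lemma LmT_Lm' e : (Lm K e)^T *m Lm' K e = Ush K e.+1.
Proof.
apply/matrixP=> i j; rewrite mxE; under eq_bigr => k _ do rewrite !mxE.
rewrite mxE; have [hi|hi] := ltnP i e.
  rewrite (bigD1 (Ordinal hi)) //= eqxx mul1r big1 ?addr0 // => k.
  by rewrite -val_eqE /= => /negPf ->; rewrite mul0r.
rewrite big1 => [|k _]; last by rewrite (ltn_eqF (leq_trans (ltn_ord k) hi)) mul0r.
by rewrite gtn_eqF // ltnS (leq_trans _ hi) // -ltnS.
Qed.

(* The rows of [Y] are the coefficients of a vector of forms of degree [k - 1] killed by the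
   pencil: [y_0 A1 = 0], [y_i A1 = y_(i-1) A2] and [y_(k-1) A2 = 0]. *)
Definition kchain n (A1 A2 : 'M[K]_n) k (Y : 'M[K]_(k, n)) :=
  (Lm K k)^T *m Y *m A1 = (Lm' K k)^T *m Y *m A2.

(** A Jordan chain at infinity, u_0 A1 = 0 and u_i A1 = u_(i-1) A2: a [kchain] without its closing
    equation. *)
Definition chain n (A1 A2 : 'M[K]_n) k (U : 'M[K]_(k, n)) :=
  U *m A1 = (Ush K k)^T *m U *m A2.

Lemma kchain_chain n (A1 A2 : 'M[K]_n) k (U : 'M[K]_(k, n)) :
  kchain A1 A2 U -> chain A1 A2 U /\ U *m A2 = Ush K k *m U *m A1.
Proof.
move=> e; split.
  have := congr1 (mulmx (Lm K k)) e.
  by rewrite !mulmxA Lm_LmT Lm_Lm'T mul1mx.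
have := congr1 (mulmx (Lm' K k)) e.
by rewrite !mulmxA Lm'_LmT Lm'_Lm'T mul1mx => <-.
Qed.

(** By skewness u_(i-1) A2 u_j^T = u_i A1 u_j^T = u_i A2 u_(j-1)^T, so the Gram matrix of [A2] is
    Hankel, and that of [A1] is a shift of it. *)
Lemma chain_isotropic n (A1 A2 : 'M[K]_n) k (U : 'M[K]_(k, n)) : 2%N \notin [pchar K] ->
  A1^T = - A1 -> A2^T = - A2 -> chain A1 A2 U ->
  U *m A1 *m U^T = 0 /\ U *m A2 *m U^T = 0.
Proof.
move=> h2 s1 s2 cU; set S := U *m A2 *m U^T.
have skS : S^T = - S by rewrite !trmx_mul trmxK s2 mulNmx mulmxN mulmxA.
have E1 : U *m A1 *m U^T = (Ush K k)^T *m S by rewrite cU !mulmxA.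
suff S0 : S = 0 by rewrite E1 S0 mulmx0.
have SN : S *m Ush K k = (Ush K k)^T *m S.
  have : (U *m A1 *m U^T)^T = - (U *m A1 *m U^T).
    by rewrite !trmx_mul trmxK s1 mulNmx mulmxN mulmxA.
  by rewrite E1 trmx_mul trmxK skS mulNmx => /oppr_inj.
apply: skew_hankel => // i j hi hj.
have /matrixP /(_ (Ordinal hi) (Ordinal hj)) := SN; rewrite mul_UshT => <-.
by rewrite mulr_Ush.
Qed.

(* A relation [c] between the rows makes [c (N^T)^j U], for [j] from [k] down to [1], a
   [kchain]. *)
Lemma chain_free n (A1 A2 : 'M[K]_n) k (U : 'M[K]_(k.+1, n)) :
  (forall Y : 'M[K]_(k, n), kchain A1 A2 Y -> Y = 0) -> chain A1 A2 U -> row ord0 U != 0 ->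
  row_free U.
Proof.
move=> min cU u0; apply: inj_row_free => c cU0.
pose N := (Ush K k.+1)^T; pose y j := c *m mpow N j *m U.
have yS j : y j *m A1 = y j.+1 *m A2 by rewrite /y mpowSr -!mulmxA cU !mulmxA.
have yk : y k.+1 = 0.
  rewrite /y (_ : mpow N k.+1 = 0) ?mulmx0 ?mul0mx //; apply/matrixP=> i j.
  by rewrite /N mpow_tr [LHS]mxE mpow_Ush [RHS]mxE gtn_eqF // (leq_trans (ltn_ord i)) // leq_addl.
have y0 : y 0%N = 0 by rewrite /y /mpow /= mulmx1.
pose Y : 'M[K]_(k, n) := \matrix_(i < k) y (k - i)%N.
have Y0 : Y = 0.
  have E1 : (Lm K k)^T *m Y = \matrix_(i < k.+1) y (k - i)%N.
    apply/row_matrixP=> i; rewrite rowK row_mul mulmx_sum_row.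
    have [hi|hi] := ltnP i k.
      rewrite (bigD1 (Ordinal hi)) //= rowK !mxE eqxx scale1r big1 ?addr0 // => l.
      by rewrite -val_eqE /= !mxE => /negPf ->; rewrite scale0r.
    rewrite big1 => [|l _]; last by rewrite !mxE (ltn_eqF (leq_trans (ltn_ord l) hi)) scale0r.
    by have /eqP -> : (k - i == 0)%N.
  have E2 : (Lm' K k)^T *m Y = \matrix_(i < k.+1) y (k.+1 - i)%N.
    apply/row_matrixP=> -[[|i] hi]; rewrite rowK row_mul mulmx_sum_row.
      by rewrite subn0 yk big1 // => l _; rewrite !mxE scale0r.
    rewrite (bigD1 (Ordinal (hi : i < k)%N)) //= rowK !mxE eqxx scale1r big1 ?addr0 // => l.
    by rewrite -val_eqE /= !mxE eqSS => /negPf ->; rewrite scale0r.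
  apply: min; rewrite /kchain E1 E2; apply/row_matrixP=> i.
  have hi : (i <= k)%N by rewrite -ltnS.
  by rewrite !row_mul !rowK (subSn hi) yS.
have yz j : (j <= k)%N -> y j = 0.
  case: j => [|j] hj; first exact: y0.
  have hi : (k - j.+1 < k)%N by move: hj; clear; lia.
  have := congr1 (row (Ordinal hi)) Y0; rewrite rowK row0 /= subKn //.
have cN j l : (c *m mpow N j) 0 l = if insub (l + j)%N is Some i then c 0 i else 0.
  rewrite mxE; case: insubP => [i hi ei|hi].
    rewrite (bigD1 i) //= /N mpow_tr mxE mpow_Ush ei eqxx mulr1 big1 ?addr0 // => m mi.
    by rewrite mxE mpow_Ush -ei val_eqE eq_sym (negPf mi) mulr0.
  rewrite big1 // => m _; rewrite /N mpow_tr mxE mpow_Ush; case: eqP => [e|]; last by rewrite mulr0.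
  by rewrite e ltn_ord in hi.
(* Since y_i is the sum of the c_(l+i) u_l, once [c] vanishes beyond [i] the equation y_i = 0 reads
   c_i u_0 = 0. *)
have c0 d (i : 'I_k.+1) : (k - i)%N = d -> c 0 i = 0.
  elim/ltn_ind: d i => d IH i ed.
  have : y i = c 0 i *: row ord0 U.
    rewrite /y mulmx_sum_row (bigD1 ord0) //= cN /= add0n valK big1 ?addr0 // => l l0.
    rewrite cN; case: insubP => [j hj ej|]; last by rewrite scale0r.
    rewrite (IH (k - j)%N _ j) ?scale0r //.
    have := ltn_ord i; have := ltn_ord j; move: l0; rewrite -val_eqE /= -ed ej; clear; lia.
  have hi : (i <= k)%N by rewrite -ltnS.
  by rewrite (yz _ hi) => /esym /eqP; rewrite scaler_eq0 (negPf u0) orbF => /eqP.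
by apply/rowP=> i; rewrite mxE; apply: c0.
Qed.
End MinusSplitting.

(** * Splitting off a block of type epsilon *)

Section MinusCase.
Variable K : fieldType.

(** On combinations [b *m U] of the rows of a kernel chain, the defect in the [kchain] equation is
    [shiftT b] times a fixed matrix. *)
Definition shiftT e (b : 'M[K]_(e, e.+1)) : 'M[K]_(e.+1, e) :=
  (Lm K e)^T *m b *m (Lm' K e)^T - (Lm' K e)^T *m b *m (Lm K e)^T.

(** The equation makes [b] constant along diagonals, and each diagonal ends in a forced zero: those
    strictly above the main one in the first row, the others in the last row. *)
Lemma shiftT_eq0 e (b : 'M[K]_(e, e.+1)) : shiftT b = 0 -> b = 0.
Proof.
move=> /eqP; rewrite subr_eq0 => /eqP T0.
have cL (X : 'M[K]_(e, e.+1)) i (j : 'I_e) :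
    (X *m (Lm K e)^T) i j = X i (widen_ord (leqnSn e) j).
  by rewrite -[X]trmxK -trmx_mul mxE mul_Lm !mxE.
have cL' (X : 'M[K]_(e, e.+1)) i (j : 'I_e) : (X *m (Lm' K e)^T) i j = X i (lift ord0 j).
  by rewrite -[X]trmxK -trmx_mul mxE mul_Lm' !mxE.
have A1 : b *m (Lm' K e)^T = (Ush K e)^T *m (b *m (Lm K e)^T).
  by have := congr1 (mulmx (Lm K e)) T0; rewrite !mulmxA Lm_LmT Lm_Lm'T mul1mx.
have A2 : b *m (Lm K e)^T = Ush K e *m (b *m (Lm' K e)^T).
  by have := congr1 (mulmx (Lm' K e)) T0; rewrite !mulmxA Lm'_LmT Lm'_Lm'T mul1mx => <-.
have up i (hi : (i < e)%N) j (hj : (j < e.+1)%N) : (i < j)%N -> b (Ordinal hi) (Ordinal hj) = 0.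
  elim: i hi j hj => [|i IH] hi [|j] hj ij //.
    have := cL' b (Ordinal hi) (Ordinal (hj : j < e)%N); rewrite A1 mul_UshT0 => ->.
    by congr (b _ _); apply: val_inj.
  have := cL' b (Ordinal hi) (Ordinal (hj : j < e)%N); rewrite A1 mul_UshT cL.
  rewrite (_ : widen_ord _ _ = Ordinal (ltnW hj)); last exact: val_inj.
  by rewrite IH // => ->; congr (b _ _); apply: val_inj.
have down d i (hi : (i < e)%N) j (hj : (j < e.+1)%N) : (i + d = e.-1)%N -> (j <= i)%N ->
    b (Ordinal hi) (Ordinal hj) = 0.
  elim: d i hi j hj => [|d IH] i hi j hj ed ji.
    have hj' : (j < e)%N by apply: leq_ltn_trans ji hi.
    have := cL b (Ordinal hi) (Ordinal hj'); rewrite A2 mul_Ush_last; last first.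
      by move: ed hi; clear; lia.
    by move=> ->; congr (b _ _); apply: val_inj.
  have hi' : (i.+1 < e)%N by move: ed hi; clear; lia.
  have hj' : (j < e)%N by apply: leq_ltn_trans ji hi.
  have := cL b (Ordinal (ltnW hi')) (Ordinal hj'); rewrite A2 mul_Ush cL'.
  rewrite (_ : lift _ _ = Ordinal (hj' : j.+1 < e.+1)%N); last exact: val_inj.
  rewrite IH //; last by rewrite addSnnS.
  by move=> ->; congr (b _ _); apply: val_inj.
apply/matrixP=> -[i hi] [j hj]; rewrite mxE; have [ij|ij] := ltnP i j; first exact: up.
by apply: (down (e.-1 - i)%N) => //; move: hi; clear; lia.
Qed.

Lemma shiftT_surj e (c : 'M[K]_(e.+1, e)) : exists b, shiftT b = c.
Proof.
pose F : 'M[K]_(e, e.+1) -> 'M[K]_(e.+1, e) :=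
  (mulmxr (Lm' K e)^T \o mulmx (Lm K e)^T) \- (mulmxr (Lm K e)^T \o mulmx (Lm' K e)^T).
have FE b : linfun F b = shiftT b by rewrite lfunE.
have : c \in limg (linfun F).
  have -> : limg (linfun F) = fullv.
    apply/eqP; rewrite eqEdim subvf limg_dim_eq.
      by rewrite !dimvf !dim_matrix -[leqLHS]/(e.+1 * e)%N mulnC; apply: leqnn.
    apply/eqP; rewrite -subv0; apply/subvP=> b; rewrite memv_cap memv_ker FE => /andP[_ /eqP h].
    by rewrite (shiftT_eq0 h) mem0v.
  exact: memvf.
by case/memv_imgP=> b _ ->; exists b; rewrite FE.
Qed.

Lemma Lm_prod0 e : (Lm' K e)^T *m Lm' K e + delta_mx 0 0 = 1%:M.
Proof.
apply/matrixP=> i j; rewrite !mxE; under eq_bigr => k _ do rewrite !mxE.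
case: i => [[|i] hi].
  rewrite big1 => [|k _]; last by rewrite mul0r.
  by rewrite add0r -!val_eqE /= eq_sym.
rewrite (bigD1 (Ordinal (hi : i < e)%N)) //= eqxx mul1r big1 ?addr0 => [|k]; last first.
  by rewrite -val_eqE /= eqSS => /negPf ->; rewrite mul0r.
by rewrite -!val_eqE.
Qed.

(** A vector of forms with zero first coefficient is divisible by a variable, which yields a shorter
    chain; hence a shortest chain has the nonzero first row that [chain_free] asks for. *)
Lemma kchain_pad e n (A1 A2 : 'M[K]_n) (U : 'M[K]_(e.+1, n)) :
  kchain A1 A2 U -> row ord0 U = 0 -> kchain A1 A2 (Lm' K e *m U) /\ U = (Lm' K e)^T *m (Lm' K e *m U).
Proof.
move=> /kchain_chain [e1 e2] u0.
have eU : U = (Lm' K e)^T *m (Lm' K e *m U).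
  rewrite -{1}[U]mul1mx -Lm_prod0 mulmxDl mulmxA (_ : delta_mx 0 0 *m U = 0) ?addr0 //.
  apply/matrixP=> i j; have /rowP /(_ j) := u0; rewrite !mxE => Uj.
  by rewrite (bigD1 0) //= Uj mulr0 add0r big1 // => k /negPf k0; rewrite mxE k0 andbF mul0r.
split=> //; rewrite /kchain -eU mulmxA LmT_Lm' -e2 //.
Qed.

(* The obstruction to solving for [W] and [h] is the trace of [alpha] with
   [alpha U = L'^T Ya + L^T Yb] and [Ya A1 + Yb A2 = 0]. By minimality of [e], [Ya] and [Yb]
   are combinations [ba U], [bb U] of the rows of [U], and then [ba L'^T = - bb L^T]. *)
Lemma minus_dual e n (A1 A2 : 'M[K]_n) (U : 'M[K]_(e.+1, n)) :
  A1^T = - A1 -> A2^T = - A2 ->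
  (forall Y : 'M[K]_(e, n), kchain A1 A2 Y -> Y = 0) -> kchain A1 A2 U -> U != 0 ->
  exists (W : 'M[K]_(e, n)) (h : 'M[K]_(e.+1, n)),
    [/\ W *m A1 = Lm' K e *m h, W *m A2 = Lm K e *m h & h *m U^T = 1%:M].
Proof.
move=> sk1 sk2 min kU U0; have [cU e2] := kchain_chain kU.
have u0 : row ord0 U != 0.
  apply: contra_neq U0 => u0; have [kY ->] := kchain_pad kU u0.
  by rewrite (min _ kY) mulmx0.
have fU := chain_free min cU u0.
(* Row i of [f] is u_(i+1) A1 = u_i A2: these are the rows common to U A1 and U A2, up to one zero
   row. *)
pose f := (Lm' K e) *m U *m A1.
have UA2 : U *m A2 = (Lm K e)^T *m f by rewrite e2 -LmT_Lm' !mulmxA.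
have UA1 : U *m A1 = (Lm' K e)^T *m f.
  rewrite cU -mulmxA UA2 -LmT_Lm' trmx_mul trmxK -!mulmxA (mulmxA (Lm K e)) Lm_LmT mul1mx //.
pose F1 : 'M[K]_(e + e.+1, n) -> 'M[K]_(e, n + n) :=
  ((mulmxr (row_mx A1 A2) \o usubmx) \- (mulmxr (row_mx 1%:M 0) \o mulmx (Lm' K e) \o dsubmx))
  \- (mulmxr (row_mx 0 1%:M) \o mulmx (Lm K e) \o dsubmx).
pose F2 : 'M[K]_(e + e.+1, n) -> 'M[K]_(e.+1) := mulmxr U^T \o dsubmx.
have F1E X : F1 X = row_mx (usubmx X *m A1 - (Lm' K e) *m dsubmx X) (usubmx X *m A2 - (Lm K e) *m dsubmx X).
  rewrite /F1 /= !mul_mx_row !mulmx0 !mulmx1 !opp_row_mx !add_row_mx.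
  by rewrite !oppr0 !addr0.
pose G (Y1 : 'M[K]_(e, n + n)) (Y2 : 'M[K]_e.+1) : 'M[K]_(e + e.+1, n) :=
  col_mx (- (lsubmx Y1 *m A1 + rsubmx Y1 *m A2))
         (Y2 *m U - ((Lm' K e)^T *m lsubmx Y1 + (Lm K e)^T *m rsubmx Y1)).
have adj X Y1 Y2 : \tr (F1 X *m Y1^T) + \tr (F2 X *m Y2^T) = \tr (X *m (G Y1 Y2)^T).
  rewrite F1E /F2 /G /= -{1}[Y1]hsubmxK -[Z in Z *m (col_mx _ _)^T]vsubmxK.
  set W := usubmx X; set h := dsubmx X; set Ya := lsubmx Y1; set Yb := rsubmx Y1.
  rewrite tr_row_mx mul_row_col tr_col_mx mul_col_row mxtrace_block.
  have -> : (- (Ya *m A1 + Yb *m A2))^T = A1 *m Ya^T + A2 *m Yb^T.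
    by rewrite linearN linearD /= !trmx_mul sk1 sk2 !mulNmx -opprD opprK.
  have -> : (Y2 *m U - ((Lm' K e)^T *m Ya + (Lm K e)^T *m Yb))^T =
      U^T *m Y2^T - (Ya^T *m Lm' K e + Yb^T *m Lm K e).
    by rewrite linearB linearD /= !trmx_mul !trmxK.
  have t1 (Z : 'M[K]_(e, e.+1)) (Y : 'M[K]_(e, n)) : \tr (Z *m h *m Y^T) = \tr (h *m (Y^T *m Z)).
    by rewrite -mulmxA mxtrace_mulC mulmxA.
  have tN m (Z : 'M[K]_m) : \tr (- Z) = - \tr Z by rewrite raddfN.
  rewrite !mulmxBl mulmxBr !mulmxDr !mxtraceD !tN !mxtraceD !t1 !mulmxA; ring.
pose D (Y : 'M[K]_(e, n)) := (Lm K e)^T *m Y *m A1 - (Lm' K e)^T *m Y *m A2.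
have DbU b : D (b *m U) = shiftT b *m f.
  by rewrite /D /shiftT mulmxBl -!mulmxA UA1 UA2.
have Duniq Y b : D Y = shiftT b *m f -> Y = b *m U.
  have DB : D (Y - b *m U) = D Y - D (b *m U).
    rewrite /D !mulmxBr !mulmxBl !opprB addrACA [RHS]addrACA; congr (_ + _).
    exact: addrC.
  rewrite -DbU => e0; apply/eqP; rewrite -subr_eq0; apply/eqP/min/eqP.
  by rewrite -subr_eq0; apply/eqP; rewrite -[LHS]/(D _) DB e0 subrr.
have [Y1 Y2|X [X1 X2]] := @linear_duality K _ _ _ _ _ _ F1 F2 G 1%:M adj.
  rewrite /G; set Ya := lsubmx Y1; set Yb := rsubmx Y1.
  move/eqP; rewrite -[0]vsubmxK => /eqP /eq_col_mx; rewrite !linear0 => -[/eqP].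
  rewrite oppr_eq0 addr_eq0 => /eqP a1 /eqP; rewrite subr_eq0 => /eqP a2.
  have aA1 : Y2 *m (Lm' K e)^T *m f = D Yb.
    rewrite -mulmxA -UA1 mulmxA a2 mulmxDl -mulmxA a1 mulmxN addrC mulmxA //.
  have aA2 : Y2 *m (Lm K e)^T *m f = - D Ya.
    rewrite -mulmxA -UA2 mulmxA a2 mulmxDl -(mulmxA _ Yb) -[Yb *m A2]opprK -a1.
    by rewrite mulmxN mulmxA opprB.
  have [ba eba] := shiftT_surj (- (Y2 *m (Lm K e)^T)).
  have [bb ebb] := shiftT_surj (Y2 *m (Lm' K e)^T).
  have eYa : Ya = ba *m U by apply: Duniq; rewrite eba mulNmx aA2 opprK.
  have eYb : Yb = bb *m U by apply: Duniq; rewrite ebb aA1.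
  have eY2 : Y2 = (Lm' K e)^T *m ba + (Lm K e)^T *m bb.
    by apply: (row_free_inj fU); rewrite a2 eYa eYb mulmxDl !mulmxA.
  have e3 : ba *m (Lm' K e)^T = - (bb *m (Lm K e)^T).
    move: ebb; rewrite eY2 mulmxDl /shiftT addrC => /addIr /(congr1 (mulmx (Lm' K e))).
    by rewrite mulmxN !mulmxA Lm'_Lm'T !mul1mx => <-.
  rewrite mul1mx mxtrace_tr eY2 mxtraceD mxtrace_mulC e3 [X in _ + X]mxtrace_mulC.
  by rewrite raddfN addNr.
have X1' : F1 X = 0 := X1.
rewrite F1E -[0]hsubmxK !linear0 in X1'; case/eq_row_mx: X1' => b1 b2.
exists (usubmx X), (dsubmx X); split=> //; apply/eqP; rewrite -subr_eq0; exact/eqP.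
Qed.

Lemma minus_case e n (A1 A2 : 'M[K]_n) (U : 'M[K]_(e.+1, n)) : 2%N \notin [pchar K] ->
  A1^T = - A1 -> A2^T = - A2 ->
  (forall Y : 'M[K]_(e, n), kchain A1 A2 Y -> Y = 0) -> kchain A1 A2 U -> U != 0 ->
  exists A' : mpair K, [/\ skew_pair A', (e + e.+1 + msz A')%N = n &
    cong (MPair A1 A2) (dsum (R_minus K e.+1) A')].
Proof.
move=> h2 sk1 sk2 min kU U0; have [cU e2] := kchain_chain kU.
have [W [h [WA1 WA2 hU]]] := minus_dual sk1 sk2 min kU U0.
have [U1 U2] := chain_isotropic h2 sk1 sk2 cU.
pose f := Lm' K e *m U *m A1.
have UA2 : U *m A2 = (Lm K e)^T *m f by rewrite e2 -LmT_Lm' !mulmxA.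
have UA1 : U *m A1 = (Lm' K e)^T *m f.
  by rewrite cU -mulmxA UA2 -LmT_Lm' trmx_mul trmxK -!mulmxA (mulmxA (Lm K e)) Lm_LmT mul1mx.
have S1 : W *m A1 *m W^T = Lm' K e *m (h *m W^T) by rewrite WA1 mulmxA.
have S2 : W *m A2 *m W^T = Lm K e *m (h *m W^T) by rewrite WA2 mulmxA.
have k1 : (W *m A1 *m W^T)^T = - (W *m A1 *m W^T).
  by rewrite !trmx_mul trmxK sk1 mulNmx mulmxN mulmxA.
have k2 : (W *m A2 *m W^T)^T = - (W *m A2 *m W^T).
  by rewrite !trmx_mul trmxK sk2 mulNmx mulmxN mulmxA.
have E12 i (hi : (i.+1 < e)%N) j :
    (W *m A1 *m W^T) (Ordinal (ltnW hi)) j = (W *m A2 *m W^T) (Ordinal hi) j.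
  by rewrite S1 S2 mul_Lm mul_Lm'; congr ((h *m W^T) _ j); apply: val_inj.
have s1 i j : (W *m A1 *m W^T) i j = - (W *m A1 *m W^T) j i.
  by have /matrixP /(_ j i) := k1; rewrite [LHS]mxE [X in _ = X -> _]mxE.
have W2 : W *m A2 *m W^T = 0.
  apply: skew_hankel => // i j hi hj; rewrite -(E12 _ hi) s1 (E12 _ hj).
  by have /matrixP /(_ (Ordinal (ltnW hi)) (Ordinal hj)) := k2; rewrite [LHS]mxE [X in _ = X -> _]mxE => ->; rewrite opprK.
(* All rows but the last are rows of the Gram matrix of [A2]; the last one follows by skewness, and
   its diagonal entry from the characteristic. *)
have W1 : W *m A1 *m W^T = 0.
  have z i (hi : (i < e)%N) j : (i.+1 < e)%N -> (W *m A1 *m W^T) (Ordinal hi) j = 0.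
    move=> hi1; rewrite (bool_irrelevance hi (ltnW hi1)) E12.
    by rewrite W2 mxE.
  apply/matrixP=> -[i hi] [j hj]; rewrite [RHS]mxE.
  have [hi1|hi1] := ltnP i.+1 e; first exact: z.
  have [hj1|hj1] := ltnP j.+1 e; first by rewrite s1 z // oppr0.
  have -> : Ordinal hj = Ordinal hi by apply: val_inj => /=; move: hi hj hi1 hj1; clear; lia.
  have /eqP := s1 (Ordinal hi) (Ordinal hi).
  rewrite -addr_eq0 -mulr2n -mulr_natl mulf_eq0 => /orP[e0|/eqP //].
  by case/negP: h2; rewrite inE /= e0.
have fU : U *m f^T = 0.
  apply: trmx_inj; rewrite trmx_mul trmxK trmx0 /f -!mulmxA.
  by rewrite (mulmxA U) U1 mulmx0.
have hU' : U *m h^T = 1%:M by apply: trmx_inj; rewrite trmx_mul trmxK hU trmx1.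
have fW : W *m f^T = - 1%:M.
  apply: trmx_inj; rewrite trmx_mul trmxK linearN /= trmx1.
  have -> : f = Lm K e *m (U *m A2) by rewrite UA2 mulmxA Lm_LmT mul1mx.
  have -> : Lm K e *m (U *m A2) *m W^T = - (Lm K e *m (W *m A2 *m U^T)^T).
    by rewrite !trmx_mul trmxK sk2 mulNmx !mulmxN opprK !mulmxA.
  by rewrite WA2 -mulmxA hU mulmx1 Lm_LmT.
have R1 : W *m A1 *m U^T = Lm' K e by rewrite WA1 -mulmxA hU mulmx1.
have R2 : W *m A2 *m U^T = Lm K e by rewrite WA2 -mulmxA hU mulmx1.
(* Here [H] in [split_plus] consists of [f] and [h]; the product is block triangular with diagonal
   blocks -1 and 1. *)
have uX : col_mx W U *m (col_mx f h)^T \in unitmx.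
  rewrite tr_col_mx mul_col_row fU fW hU' unitmxE det_ublock det1 mulr1 -unitmxE.
  have /mulmx1_unit [] // : - 1%:M *m - 1%:M = 1%:M :> 'M[K]_e.
  by rewrite mulNmx mulmxN opprK mulmx1.
have X1 : col_mx W U *m A1 = block_mx 0 (Lm' K e) (Lm' K e)^T 0 *m col_mx f h.
  by rewrite mul_col_mx mul_block_col !mul0mx add0r addr0 WA1 UA1.
have X2 : col_mx W U *m A2 = block_mx 0 (Lm K e) (Lm K e)^T 0 *m col_mx f h.
  by rewrite mul_col_mx mul_block_col !mul0mx add0r addr0 WA2 UA2.
have [A' [skA' szA' cA']] := split_plus sk1 sk2 W1 W2 U1 U2 R1 R2 uX X1 X2.
exists A'; split=> //; apply: cong_trans cA' _; apply: cong_dsum; last exact: cong_refl.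
(* The pairing of [W] with [U] came out as ([Lm'], [Lm]), the block with its matrices exchanged;
   invariance of [R_minus] under the swap repairs this. *)
have := @R_minus_act K e.+1 (swap2 K) isT (swap2_unit K).
rewrite R_minusE plus_pair_act !mxE /= !scale0r !scale1r add0r addr0 => c; exact: c.
Qed.
End MinusCase.

(** * Splitting off a block at infinity *)

Section RegularSplitting.
Variable K : fieldType.

(** [split_plus] with [H] equal to X B1: [B1] pairs the two spaces perfectly, and isotropy for [B2]
    follows because [B2] acts on each through [B1]. *)
Lemma square_split n (B1 B2 : 'M[K]_n) d (P1 P2 : 'M[K]_(d, n)) (C1 C2 : 'M[K]_d) :
  B1^T = - B1 -> B2^T = - B2 ->
  P1 *m B1 *m P1^T = 0 -> P2 *m B1 *m P2^T = 0 -> P1 *m B1 *m P2^T = 1%:M ->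
  P1 *m B2 = C1 *m P1 *m B1 -> P2 *m B2 = C2 *m P2 *m B1 ->
  exists A' : mpair K, [/\ skew_pair A', (d + d + msz A')%N = n &
    cong (MPair B1 B2) (dsum (plus_pair 1%:M C1) A')].
Proof.
move=> s1 s2 I1 I2 P12 E1 E2.
have J1 : P1 *m B2 *m P1^T = 0 by rewrite E1 -!mulmxA (mulmxA P1) I1 mulmx0.
have J2 : P2 *m B2 *m P2^T = 0 by rewrite E2 -!mulmxA (mulmxA P2) I2 mulmx0.
have P12' : P1 *m B2 *m P2^T = C1 by rewrite E1 -!mulmxA (mulmxA P1) P12 mulmx1.
have P21 : P2 *m B1 *m P1^T = - 1%:M.
  apply: trmx_inj; rewrite !trmx_mul trmxK s1 mulNmx mulmxN mulmxA P12.
  by rewrite linearN /= trmx1.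
have uX : col_mx P1 P2 *m (col_mx P1 P2 *m B1)^T \in unitmx.
  rewrite trmx_mul s1 mulNmx mulmxN mulmxA mul_col_mx tr_col_mx mul_col_row I1 I2 P12 P21.
  set Z := block_mx _ _ _ _.
  have /mulmx1_unit [] // : - Z *m Z = 1%:M.
  rewrite /Z mulNmx mulmx_block !mulmx0 !mul0mx !add0r !addr0 mul1mx mulNmx mulmx1.
  by rewrite opp_block_mx !oppr0 !opprK -scalar_mx_block.
apply: (split_plus s1 s2 I1 J1 I2 J2 P12 P12' uX (D1 := 1%:M) (D2 := block_mx C1 0 0 C2)).
  by rewrite mul1mx.
by rewrite (mul_col_mx P1 P2 B2) (mul_col_mx P1 P2 B1) mul_block_col !mul0mx addr0 add0r E1 E2 !mulmxA.
Qed.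

Lemma chain_isotropic_rev n (A1 A2 : 'M[K]_n) k (W : 'M[K]_(k, n)) : 2%N \notin [pchar K] ->
  A1^T = - A1 -> A2^T = - A2 -> W *m A1 = Ush K k *m W *m A2 -> W *m A2 *m W^T = 0.
Proof.
move=> h2 s1 s2 cW; set S := W *m A2 *m W^T.
have skS : S^T = - S by rewrite !trmx_mul trmxK s2 mulNmx mulmxN mulmxA.
have E1 : W *m A1 *m W^T = Ush K k *m S by rewrite cW !mulmxA.
have SN : S *m (Ush K k)^T = Ush K k *m S.
  have : (W *m A1 *m W^T)^T = - (W *m A1 *m W^T).
    by rewrite !trmx_mul trmxK s1 mulNmx mulmxN mulmxA.
  by rewrite E1 trmx_mul skS mulNmx => /oppr_inj.
apply: skew_hankel => // i j hi hj.
have /matrixP /(_ (Ordinal (ltnW hi)) (Ordinal (ltnW hj))) := SN; rewrite mul_Ush => <-.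
by rewrite -[S in RHS]trmxK -trmx_mul [RHS]mxE mul_Ush [RHS]mxE.
Qed.

Lemma nat_last (P : nat -> Prop) n : P 0%N -> ~ P n -> exists2 d, P d & ~ P d.+1.
Proof.
move=> P0; elim: n => [//|n IH] nP; have [Pn|/IH //] := classic (P n).
by exists n.
Qed.

(** The commutant of the nilpotent shift consists of upper triangular Toeplitz matrices, so the
    corner entry fills the diagonal. *)
Lemma Ush_comm_unit d (M : 'M[K]_d.+1) :
  Ush K d.+1 *m M = M *m Ush K d.+1 -> M 0 0 = 1 -> M \in unitmx.
Proof.
move=> cM M00.
have MS i (hi : (i.+1 < d.+1)%N) j (hj : (j.+1 < d.+1)%N) :
    M (Ordinal hi) (Ordinal hj) = M (Ordinal (ltnW hi)) (Ordinal (ltnW hj)).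
  have /matrixP /(_ (Ordinal (ltnW hi)) (Ordinal hj)) := cM.
  by rewrite mul_Ush mulr_Ush.
have M0 i (hi : (i.+1 < d.+1)%N) : M (Ordinal hi) ord0 = 0.
  have /matrixP /(_ (Ordinal (ltnW hi)) ord0) := cM; rewrite mul_Ush => ->.
  by rewrite mxE big1 // => k _; rewrite mxE mulr0.
have tr : is_trig_mx M^T.
  apply/is_trig_mxP=> -[i hi] [j hj] /= ij; rewrite mxE.
  elim: i j hi hj ij => [|i IH] [|j] hi hj ij //.
    by rewrite -[RHS](M0 _ hj); congr (M _ _); apply: val_inj.
  by rewrite MS IH.
rewrite unitmxE -det_tr det_trig // big1 ?unitr1 // => -[i hi] _; rewrite mxE.
elim: i hi => [|i IH] hi; last by rewrite MS.
by rewrite -M00; congr (M _ _); apply: val_inj.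
Qed.

(* For a chain [U] of maximal length, the obstruction to finding the dual chain [W] would
   prolong [U] by one row. *)
Lemma inf_case n (A1 A2 : 'M[K]_n) (u : 'rV[K]_n) : 2%N \notin [pchar K] ->
  A1^T = - A1 -> A2^T = - A2 ->
  (forall k (Y : 'M[K]_(k, n)), kchain A1 A2 Y -> Y = 0) -> u != 0 -> u *m A1 = 0 ->
  exists d (A' : mpair K), [/\ skew_pair A', (d.+1 + d.+1 + msz A')%N = n &
    cong (MPair A1 A2) (dsum (R_inf K d.+1) A')].
Proof.
move=> h2 s1 s2 min u0 uA1.
pose P d := exists2 U : 'M[K]_(d.+1, n), chain A1 A2 U & row ord0 U != 0.
have P0 : P 0%N.
  exists u; last by rewrite (_ : row ord0 u = u) //; apply/rowP=> j; rewrite mxE.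
  rewrite /chain uA1 (_ : Ush K 1 = 0) ?trmx0 ?mul0mx //; apply/matrixP=> i j.
  by rewrite !mxE !ord1.
(* [P n] speaks of n + 1 rows, independent by [chain_free], in a space of dimension n. *)
have Pn : ~ P n.
  case=> U cU r0; have := chain_free (@min n) cU r0.
  by rewrite /row_free => /eqP rU; have := rank_leq_col U; rewrite rU ltnn.
have [d [U cU r0] nP] := nat_last P0 Pn.
have [w ew] : exists w : 'rV[K]_n, w = row ord0 U by eexists.
rewrite -ew in r0.
(* [W] must be a reversed chain and satisfy the single normalization w_0 A2 u_0^T = 1; commutation
   with the shift then makes the whole pairing invertible. *)
pose F1 : 'M[K]_(d.+1, n) -> 'M[K]_(d.+1, n) :=
  mulmxr A1 \- (mulmxr A2 \o mulmx (Ush K d.+1)).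
pose F2 : 'M[K]_(d.+1, n) -> 'M[K]_1 :=
  mulmxr (A2 *m w^T) \o mulmx (delta_mx (0 : 'I_1) (0 : 'I_d.+1)).
pose G (Y1 : 'M[K]_(d.+1, n)) (Y2 : 'M[K]_1) : 'M[K]_(d.+1, n) :=
  Y1 *m A1^T - (Ush K d.+1)^T *m Y1 *m A2^T +
  (delta_mx (0 : 'I_1) (0 : 'I_d.+1))^T *m Y2 *m w *m A2^T.
have adj X Y1 Y2 : \tr (F1 X *m Y1^T) + \tr (F2 X *m Y2^T) = \tr (X *m (G Y1 Y2)^T).
  rewrite /F1 /F2 /G /= linearD linearB /= !trmx_mul !trmxK !mulmxDr !mulmxN mulmxBl.
  rewrite !mxtraceD !raddfN /= !mulmxA; congr (_ - _ + _).
    by rewrite -!mulmxA mxtrace_mulC !mulmxA.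
  by rewrite -!mulmxA mxtrace_mulC !mulmxA.
have [Y1 Y2|W [X1 X2]] := @linear_duality K _ _ _ _ _ _ F1 F2 G 1%:M adj.
  rewrite /G s1 s2 !mulmxN opprK => e0; rewrite mul1mx mxtrace_tr [Y2]mx11_scalar mxtrace_scalar.
  set a := Y2 0 0; rewrite -[RHS](mul0rn _ 1); congr (_ *+ _).
  apply/eqP/negP=> /negP a0; case: nP.
  pose Z := (delta_mx (0 : 'I_1) (0 : 'I_d.+1))^T *m Y2 *m w *m A2.
  have e1 : Y1 *m A1 = (Ush K d.+1)^T *m (Y1 *m A2) - Z.
    by move/eqP: e0; rewrite -addrA addrC addr_eq0 opprK mulmxA => /eqP <-.
  have Zi i j : Z i j = (i == 0)%:R * (a * (w *m A2) 0 j).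
    rewrite /Z /a -!mulmxA; move: (w *m A2) => B; rewrite mxE big_ord1 mxE mxE mxE big_ord1.
    by rewrite eqxx.
  have wA1 : w *m A1 = 0.
    by rewrite ew -row_mul cU -mulmxA; apply/rowP=> j; rewrite [LHS]mxE [RHS]mxE; exact: (mul_UshT0 _ (ltn0Sn d)).
  (* The longer chain starts with a nonzero multiple of the first row of [U] and continues with the
     rows of the obstruction [Y1]. *)
  pose V : 'M[K]_(d.+2, n) :=
    \matrix_(i < d.+2) (if unlift ord0 i is Some j then row j Y1 else - a *: w).
  have V0 : row ord0 V = - a *: w by rewrite rowK unlift_none.
  have VS i (hi : (i.+1 < d.+2)%N) : row (Ordinal hi) V = row (Ordinal (hi : (i < d.+1)%N)) Y1.
    by rewrite (_ : Ordinal hi = lift ord0 (Ordinal (hi : (i < d.+1)%N))) ?rowK ?liftK //; apply: val_inj.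
  have rU m k (X : 'M[K]_(m, k)) i (hi : (i.+1 < m)%N) :
    row (Ordinal hi) ((Ush K m)^T *m X) = row (Ordinal (ltnW hi)) X.
    by apply/rowP=> j; rewrite [LHS]mxE mul_UshT [RHS]mxE.
  exists V; last by rewrite V0 scaler_eq0 oppr_eq0 negb_or a0.
  rewrite /chain -mulmxA; apply/row_matrixP=> -[[|[|i]] hi].
  - rewrite row_mul (_ : Ordinal hi = ord0); last exact: val_inj.
    rewrite V0 -scalemxAl wA1 scaler0; apply/rowP=> j.
    by rewrite [RHS]mxE (mul_UshT0 _ (ltn0Sn d.+1)) mxE.
  - rewrite row_mul VS rU row_mul (_ : Ordinal (ltnW hi) = ord0); last exact: val_inj.
    rewrite V0 -row_mul e1; apply/rowP=> j; rewrite [LHS]mxE [LHS]mxE mul_UshT0 [X in _ + X]mxE Zi.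
    by rewrite mul1r add0r -scalemxAl [RHS]mxE mulNr.
  rewrite row_mul VS rU row_mul (VS i (ltnW hi)) -row_mul e1.
  apply/rowP=> j; rewrite [LHS]mxE [LHS]mxE mul_UshT [X in _ + X]mxE Zi mul0r subr0.
  by rewrite -row_mul [RHS]mxE; congr ((Y1 *m A2) _ j); apply: val_inj.
have WA1 : W *m A1 = Ush K d.+1 *m W *m A2.
  by apply/eqP; rewrite -subr_eq0; apply/eqP.
pose M := W *m A2 *m U^T.
have cM : Ush K d.+1 *m M = M *m Ush K d.+1.
  have e1 : W *m A1 *m U^T = Ush K d.+1 *m M by rewrite WA1 !mulmxA.
  rewrite -e1 /M; apply: trmx_inj.
  by rewrite !trmx_mul !trmxK s1 s2 !(mulNmx, mulmxN) !mulmxA cU.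
have M00 : M 0 0 = 1.
  have E (X : 'M[K]_(d.+1, n)) (Y : 'M[K]_(n, d.+1)) : (X *m Y) 0 0 = (row 0 X *m col 0 Y) 0 0.
    by rewrite !mxE; apply: eq_bigr => k _; rewrite !mxE.
  have e2 : F2 W 0 0 = 1 by move/matrixP: X2 => /(_ 0 0) X2; rewrite [LHS]X2 mxE eqxx.
  by rewrite -e2 /M E row_mul -tr_row -ew /F2 /= -rowE !mulmxA.
have uM := Ush_comm_unit cM M00.
have cV : invmx M *m Ush K d.+1 = Ush K d.+1 *m invmx M.
  by apply: (can_inj (mulKmx uM)); rewrite mulmxA mulmxV // mul1mx mulmxA -cM mulmxK.
have U2 := (chain_isotropic h2 s1 s2 cU).2.
have W2 := chain_isotropic_rev h2 s1 s2 WA1.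
(* As [A1] is singular, [A2] serves as the pairing form; the roles are swapped back at the end. *)
have [||||A' [skA' szA' cA']] := @square_split n A2 A1 d.+1 (invmx M *m W) U (Ush K d.+1)
  (Ush K d.+1)^T s2 s1 _ U2.
- by rewrite trmx_mul -!mulmxA (mulmxA A2) (mulmxA W) (mulmxA W) W2 mul0mx mulmx0.
- by rewrite -!mulmxA (mulmxA W) mulVmx.
- by rewrite -!mulmxA WA1 -!mulmxA !mulmxA cV.
- exact: cU.
exists d, (act_right A' (swap2 K)); split.
- by case: skA' => k1 k2; split; rewrite /= !mxE /= !scale0r !scale1r ?add0r ?addr0.
- exact: szA'.
have := cong_act (swap2 K) cA'; rewrite dsum_act plus_pair_act.
rewrite {1}/act_right /= !mxE /= !scale0r !scale1r !add0r !addr0.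
by rewrite R_infE comp_Ush.
Qed.
End RegularSplitting.

(** * Splitting off a finite regular block *)

Section FiniteCase.
Variable K : fieldType.
Implicit Types p q f : {poly K}.

Lemma monic_irreducible_factor p : (1 < size p)%N ->
  exists f, [/\ f \is monic, irreducible_poly f & f %| p].
Proof.
have [n] := ubnP (size p); elim: n p => // n IH p sp sp1.
have p0 : p != 0 by rewrite -size_poly_gt0 ltnW.
have lp : lead_coef p != 0 by rewrite lead_coef_eq0.
have [irp|nirp] := classic (irreducible_poly p).
  exists ((lead_coef p)^-1 *: p); split.
  - by rewrite monicE lead_coefZ mulVf.
  - split; first by rewrite size_scale ?invr_eq0.
    move=> q sq; rewrite dvdpZr ?invr_eq0 // => qp.
    by rewrite (eqp_trans (irp.2 q sq qp)) // eqp_sym eqp_scale ?invr_eq0.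
  by rewrite dvdpZl ?invr_eq0.
have [q [sq qp nq]] : exists q, [/\ size q != 1%N, q %| p & ~~ (q %= p)].
  apply: NNPP => H; apply: nirp; split=> // q sq qp; apply/negPn/negP=> nq.
  by apply: H; exists q.
have q0 : q != 0 by apply: contraNneq p0 => q0; rewrite -dvd0p -q0.
have sqp : (size q < size p)%N.
  by rewrite ltn_neqAle dvdp_leq // andbT (dvdp_size_eqp qp).
have [||f [mf irf fq]] := IH q.
- by apply: leq_trans sqp _; rewrite -ltnS.
- by rewrite ltn_neqAle eq_sym sq size_poly_gt0.
by exists f; split=> //; apply: dvdp_trans qp.
Qed.

Lemma irreducible_coprimep f q : irreducible_poly f -> ~~ (f %| q) -> coprimep f q.
Proof.
move=> irf nfq; apply/coprimepP=> d df dq; rewrite -size_poly_eq1; apply: contraNT nfq => sd.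
by rewrite -(eqp_dvdl _ (irf.2 d sd df)).
Qed.

Lemma irreducible_valuation f p : irreducible_poly f -> p != 0 ->
  exists k q, p = f ^+ k * q /\ ~~ (f %| q).
Proof.
move=> irf; have [n] := ubnP (size p); elim: n p => // n IH p sp p0.
have [fp|nfp] := boolP (f %| p); last by exists 0%N, p; rewrite expr0 mul1r.
have [r er] := dvdpP _ _ fp.
have r0 : r != 0 by apply: contraNneq p0 => r0; rewrite er r0 mul0r.
have f0 := irredp_neq0 irf.
have [|k [q [eq nq]]] := IH r _ r0.
  apply: leq_trans (_ : (size p <= n)%N); last by rewrite -ltnS.
  rewrite er size_mul //; have := irf.1; have := size_poly_gt0 r; rewrite r0.
  by move: (size r) (size f) => a b; clear; lia.
by exists k.+1, q; split=> //; rewrite er eq exprS; ring.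
Qed.

Lemma horner_intertwine n (T S A : 'M[K]_n.+1) p :
  T *m A = A *m S -> horner_mx T p *m A = A *m horner_mx S p.
Proof.
move=> e; elim/poly_ind: p => [|p c IH]; first by rewrite !rmorph0 mul0mx mulmx0.
rewrite !rmorphD !rmorphM /= !horner_mx_X !horner_mx_C mulmxDl mulmxDr scalar_mxC.
by congr (_ + _); rewrite -mulmxA e mulmxA IH -!mulmxA.
Qed.

Lemma horner_mxM n (T : 'M[K]_n.+1) p q : horner_mx T (p * q) = horner_mx T p *m horner_mx T q.
Proof. by rewrite rmorphM. Qed.

Lemma horner_mxD n (T : 'M[K]_n.+1) p q : horner_mx T (p + q) = horner_mx T p + horner_mx T q.
Proof. by rewrite rmorphD. Qed.

Lemma horner_mxB n (T : 'M[K]_n.+1) p q : horner_mx T (p - q) = horner_mx T p - horner_mx T q.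
Proof. by rewrite rmorphB. Qed.

Lemma mul_orbit m n (T : 'M[K]_n.+1) (v : 'rV_n.+1) (c : 'rV_m) :
  c *m orbit_mx m T v = v *m horner_mx T (rVpoly c).
Proof.
rewrite mulmx_sum_row rVpoly_sum linear_sum mulmx_sumr; apply: eq_bigr => i _.
by rewrite rowK linearZ /= rmorphXn /= horner_mx_X scalemxAr.
Qed.

Lemma mul_horner_mod n (T : 'M[K]_n.+1) (v : 'rV_n.+1) p g : v *m horner_mx T p = 0 ->
  v *m horner_mx T g = v *m horner_mx T (g %% p).
Proof.
move=> vp; rewrite [in LHS](divp_eq g p) horner_mxD mulmxDr [_ %/ _ * _]mulrC horner_mxM mulmxA vp.
by rewrite mul0mx add0r.
Qed.

(** Self-adjointness carries a factor [T] across the form, so the Gram matrix of the Krylov rows is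
    Hankel. *)
Lemma orbit_isotropic m n (T A1 : 'M[K]_n.+1) (v : 'rV_n.+1) : 2%N \notin [pchar K] ->
  A1^T = - A1 -> T *m A1 = A1 *m T^T -> orbit_mx m T v *m A1 *m (orbit_mx m T v)^T = 0.
Proof.
move=> h2 s1 sT; set U := orbit_mx m T v; apply: skew_hankel => //.
  by rewrite !trmx_mul trmxK s1 mulNmx mulmxN mulmxA.
move=> i j hi hj.
have E a b : (U *m A1 *m U^T) a b = (v *m T ^+ a *m A1 *m (v *m T ^+ b)^T) 0 0.
  rewrite -(rowK (fun i => v *m T ^+ i) a) -(rowK (fun i => v *m T ^+ i) b) -/U -row_mul tr_row.
  by rewrite !mxE; apply: eq_bigr => k _; rewrite !mxE.
have vS l : v *m T ^+ l.+1 = v *m T ^+ l *m T by rewrite exprSr mulmxA.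
by rewrite !E /= !vS [(_ *m T)^T]trmx_mul -[_ *m T *m A1]mulmxA sT !mulmxA.
Qed.

(* [v] and [w] generate cyclic submodules for [T = A2 A1^-1], with [v] of maximal order
   [f ^+ k] and [f ^+ k.-1] times [v] not orthogonal to [w]; self-adjointness of [T] makes
   both totally isotropic and the pairing between them perfect. *)
Lemma fin_case n (A1 A2 : 'M[K]_n) : 2%N \notin [pchar K] -> (0 < n)%N ->
  A1^T = - A1 -> A2^T = - A2 -> A1 \in unitmx ->
  exists f k (A' : mpair K), [/\ f \is monic, irreducible_poly f, (0 < k)%N, skew_pair A' &
    (msz A' < n)%N /\ cong (MPair A1 A2) (dsum (R_fin (f ^+ k)) A')].
Proof.
move=> h2; case: n A1 A2 => // n A1 A2 _ s1 s2 u1.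
pose T := A2 *m invmx A1.
have TA : T *m A1 = A2 by rewrite mulmxKV.
have sT : T *m A1 = A1 *m T^T.
  apply: oppr_inj; rewrite TA -s2 -[in LHS]TA trmx_mul s1 mulNmx //.
pose P := mxminpoly T; have mP : P \is monic := mxminpoly_monic T.
have P0 := monic_neq0 mP.
have sP : (1 < size P)%N by rewrite size_mxminpoly ltnS mxminpoly_nonconstant.
have [f [mf irf fP]] := monic_irreducible_factor sP.
have [k [q [eP nfq]]] := irreducible_valuation irf P0.
have k0 : (0 < k)%N.
  by rewrite lt0n; apply: contraNneq nfq => k0; rewrite -[q]mul1r -(expr0 f) -k0 -eP.
have f0 := monic_neq0 mf; have mfk := monic_exp k mf.
have q0 : q != 0 by apply: contraNneq P0 => q0; rewrite eP q0 mulr0.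
have sfk := size_exp_pred mf irf.1 k0; set m := ((size f).-1 * k).-1 in sfk.
have PT : horner_mx T P = 0 by apply: mx_root_minpoly.
(* The polynomial f^(k-1) q is a proper divisor of the minimal polynomial, so some vector survives
   it; applying q(T) makes its order exactly f^k. *)
have [v0 v0n] : exists v0 : 'rV_n.+1, v0 *m horner_mx T (f ^+ k.-1 * q) != 0.
  have : horner_mx T (f ^+ k.-1 * q) != 0.
    rewrite -dvd_mxminpoly; apply/negP=> /dvdp_leq; rewrite mulf_neq0 ?expf_neq0 // => /(_ isT).
    rewrite -/P eP -{1}(prednK k0) exprS -mulrA size_mul ?mulf_neq0 ?expf_neq0 //.
    have := irf.1; have : (0 < size (f ^+ k.-1 * q)%R)%N by rewrite size_poly_gt0 mulf_neq0 ?expf_neq0.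
    by move: (size f) (size _) => a b; clear; lia.
  by case/rowV0Pn=> _ /submxP [v0 ->]; exists v0.
pose v := v0 *m horner_mx T q.
have vfk : v *m horner_mx T (f ^+ k) = 0.
  by rewrite /v -mulmxA -horner_mxM mulrC -eP PT mulmx0.
pose x := v *m horner_mx T (f ^+ k.-1).
have xfk : x *m horner_mx T (f ^+ k) = 0.
  by rewrite /x -mulmxA -horner_mxM [f ^+ _ * _]mulrC horner_mxM mulmxA vfk mul0mx.
have x0 : x != 0 by rewrite /x /v -mulmxA -horner_mxM mulrC.
have [w0 xw0] : exists w0 : 'rV_n.+1, (x *m A1 *m w0^T) 0 0 != 0.
  have : x *m A1 != 0 by apply: contraNneq x0 => e; rewrite -(mulmxK u1 x) e mul0mx.
  case/rV0Pn=> j xj; exists (delta_mx 0 j).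
  by rewrite trmx_delta -colE mxE.
have coq : coprimep (f ^+ k) q by apply/coprimep_expl/irreducible_coprimep.
have [[a b] /= ab] := Bezout_eq1_coprimepP _ _ coq.
have hA h : horner_mx T h *m A1 = A1 *m (horner_mx T h)^T.
  by rewrite -horner_mx_tr; apply: horner_intertwine.
(* The f-primary component of [w0]: [b * q] is 1 modulo f^k and 0 modulo [q]. The pairing with [x],
   which f^k kills, is unchanged. *)
pose w := w0 *m horner_mx T (b * q).
have wfk : w *m horner_mx T (f ^+ k) = 0.
  by rewrite /w -mulmxA -horner_mxM -mulrA [q * _]mulrC -eP horner_mxM PT !mulmx0.
have xw : (x *m A1 *m w^T) 0 0 != 0.
  rewrite /w trmx_mul mulmxA -(mulmxA x) -hA mulmxA.
  have -> : b * q = 1 - a * f ^+ k by rewrite -ab addrC addKr.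
  rewrite horner_mxB rmorph1 mulmxBr mulmx1 [a * _]mulrC horner_mxM (mulmxA x).
  by rewrite xfk !mul0mx subr0.
pose U := orbit_mx m.+1 T v; pose W := orbit_mx m.+1 T w; pose C := comp_mx m.+1 (f ^+ k).
have CU : C *m U = U *m T by apply: comp_orbit.
have CW : C *m W = W *m T by apply: comp_orbit.
have IU : U *m A1 *m U^T = 0 by apply: orbit_isotropic.
have IW : W *m A1 *m W^T = 0 by apply: orbit_isotropic.
pose M := U *m A1 *m W^T.
(* A relation [c] makes every multiple of c(T) v orthogonal to w. Since c = f^i c' with i < k and c'
   prime to f, some multiple of c is f^(k-1) modulo f^k, so that x itself would be orthogonal to
   w. *)
have uM : M \in unitmx.
  rewrite -row_free_unit; apply: inj_row_free => c cM.
  apply: (can_inj (@rVpolyK K _)); rewrite linear0; apply/eqP/negP=> /negP c0.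
  have yg g : v *m horner_mx T (rVpoly c * g) *m A1 *m w^T = 0.
    rewrite horner_mxM !mulmxA -(mulmxA _ (horner_mx T g) A1) hA mulmxA.
    rewrite -[_ *m (horner_mx T g)^T *m w^T]mulmxA -trmx_mul (mul_horner_mod g wfk).
    have sg : (size (g %% f ^+ k)%R <= m.+1)%N by rewrite -ltnS -sfk ltn_modp -size_poly_gt0 sfk.
    rewrite -[g %% _](poly_rV_K sg) -(mul_orbit T w) -(mul_orbit T v) trmx_mul !mulmxA.
    by rewrite -/U -/W -(mulmxA c) -(mulmxA c) cM mul0mx.
  have [i [c' [ec nc']]] := irreducible_valuation irf c0.
  have ik : (i < k)%N.
    rewrite ltnNge; apply/negP=> ki.
    have : f ^+ k %| rVpoly c by rewrite ec dvdp_mulr // dvdp_exp2l.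
    by move/dvdp_leq => /(_ c0); rewrite sfk leqNgt ltnS size_rVpoly.
  have coc : coprimep c' (f ^+ k) by rewrite coprimep_sym; apply/coprimep_expl/irreducible_coprimep.
  have [[a' b'] /= ab'] := Bezout_eq1_coprimepP _ _ coc.
  have e : rVpoly c * (a' * f ^+ (k.-1 - i)) = f ^+ k.-1 - f ^+ k * (b' * f ^+ k.-1).
    have -> : f ^+ k.-1 = f ^+ i * f ^+ (k.-1 - i) by rewrite -exprD subnKC // -ltnS prednK.
    have -> : f ^+ k * (b' * (f ^+ i * f ^+ (k.-1 - i))) = (1 - a' * c') * (f ^+ i * f ^+ (k.-1 - i)).
      by rewrite -ab'; ring.
    by rewrite ec; ring.
  have := yg (a' * f ^+ (k.-1 - i)); rewrite e horner_mxB mulmxBr horner_mxM (mulmxA v) vfk mul0mx subr0.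
  by move=> e1; move: xw; rewrite /x e1 mxE eqxx.
pose P2 := (invmx M)^T *m W.
have [||||A' [skA' szA' cA']] := @square_split K n.+1 A1 A2 m.+1 U P2 C
   ((invmx M)^T *m C *m M^T) s1 s2 IU.
- rewrite /P2 trmx_mul -!mulmxA (mulmxA A1) (mulmxA W) (mulmxA W) IW.
  by rewrite mul0mx mulmx0.
- by rewrite /P2 trmx_mul trmxK !mulmxA mulmxV.
- by rewrite -TA mulmxA CU.
- rewrite /P2 -TA mulmxA -(mulmxA _ W) -CW -(mulmxA _ M^T) (mulmxA M^T).
  by rewrite -trmx_mul mulVmx // trmx1 mul1mx !mulmxA.
exists f, k, A'; split=> //; split; first by move: szA'; clear; lia.
by rewrite (@R_finE _ m.+1) ?sfk.
Qed.
End FiniteCase.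

(** * Existence *)

Section Existence.
Variable K : fieldType.

Lemma nat_least (P : nat -> Prop) : (exists k, P k) ->
  exists2 k, P k & forall j, (j < k)%N -> ~ P j.
Proof.
case=> k Pk; apply: NNPP => H.
have nP j : ~ P j by elim/ltn_ind: j => j IH Pj; apply: H; exists j.
exact: nP Pk.
Qed.

Lemma Rblock_fin (f : {poly K}) k : f \is monic ->
  Rblock (Some (hom (size f).-1 f)) k = R_fin (f ^+ k).
Proof.
move=> mf; rewrite /Rblock (negPf (X2_neq_hom mf)).
by rewrite -/(dehom _) homK ?leqSpred.
Qed.

Lemma skew_decomposition (A : mpair K) : 2%N \notin [pchar K] -> skew_pair A ->
  exists2 s, forall xd, xd \in s -> valid_block xd & cong A (Atilde_seq s).
Proof.
move=> h2; have [n] := ubnP (msz A); elim: n A => // n IH [m A1 A2] /= sm [/= s1 s2].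
have step x d (A' : mpair K) : valid_block (x, d) -> skew_pair A' -> (msz A' < m)%N ->
    cong (MPair A1 A2) (dsum (Rblock x d) A') ->
    exists2 s, forall xd, xd \in s -> valid_block xd & cong (MPair A1 A2) (Atilde_seq s).
  move=> vx skA' szA' cA'; have [|s vs cs] := IH A' _ skA'.
    by apply: leq_trans szA' _; rewrite -ltnS.
  exists ((x, d) :: s) => [xd|]; first by rewrite inE => /predU1P [->|/vs].
  by apply: cong_trans cA' _; apply: cong_dsum cs; apply: cong_refl.
(* Kernel chains are exhausted first: [inf_case] relies on their absence. *)
have [[k [Y kY Y0]]|nk] := classic (exists k, exists2 Y : 'M[K]_(k, m), kchain A1 A2 Y & Y != 0).
  have [|[|e] [U kU U0] min] := @nat_least (fun k => exists2 Y : 'M[K]_(k, m), kchain A1 A2 Y & Y != 0).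
  - by exists k, Y.
  - by rewrite [U]flatmx0 eqxx in U0.
  have [|A' [skA' szA' cA']] := minus_case h2 s1 s2 _ kU U0.
    move=> V kV; apply/eqP; apply: contraT => V0.
    by case: (min e (ltnSn e)); exists V.
  apply: (step None e.+1 A') => //; first by rewrite -szA'; clear; lia.
have kmin k (Y : 'M[K]_(k, m)) : kchain A1 A2 Y -> Y = 0.
  by move=> kY; apply/eqP; apply: contraT => Y0; case: nk; exists k, Y.
have [u1|nu1] := boolP (A1 \in unitmx); last first.
  have [u u0 uA1] : exists2 u : 'rV[K]_m, u != 0 & u *m A1 = 0.
    rewrite -row_free_unit -kermx_eq0 in nu1; case/rowV0Pn: nu1 => u /sub_kermxP e u0.
    by exists u.
  have [d [A' [skA' szA' cA']]] := inf_case h2 s1 s2 kmin u0 uA1.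
  apply: (step (Some (X2 K)) d.+1 A') => //.
  - by split=> // g [<-]; apply: inP_X2.
  - by rewrite -szA'; clear; lia.
  by rewrite /Rblock eqxx.
have [m0|m0] := posnP m.
  have mF (i : 'I_m) : False by case: i => i; rewrite m0.
  by exists [::] => //; exists 0, 0; split; apply/matrixP=> i j; (case: (mF i) || case: i).
have [f [k [A' [mf irf k0 skA' [szA' cA']]]]] := fin_case h2 m0 s1 s2 u1.
apply: (step (Some (hom (size f).-1 f)) k A') => //.
- by split=> // g [<-]; apply: inP_hom.
by rewrite Rblock_fin.
Qed.

Lemma realizes_valid rho (s : seq (ptilde K * nat)) : Ftilde rho -> realizes s rho ->
  forall xd, xd \in s -> valid_block xd.
Proof.
move=> [rho0 [rhoP _]] rs [x d] xs.
have /eqP r : rho x d != 0%N by rewrite -rs -lt0n -has_count has_pred1.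
split=> [|g /= ex].
  by rewrite /= lt0n; apply/eqP=> d0; rewrite d0 rho0 in r.
by apply: (rhoP g d); rewrite -ex.
Qed.

Lemma Ftilde_count (s : seq (ptilde K * nat)) : (forall xd, xd \in s -> valid_block xd) ->
  Ftilde (fun x d => count_mem (x, d) s).
Proof.
move=> vs; have mem x d : count_mem (x, d) s <> 0%N -> (x, d) \in s.
  by move=> c; apply/negPn/negP=> /count_memPn.
split=> [x|]; last split=> [g d /mem /vs [_ v]|]; first last.
- by exists s => x d /mem.
- exact: v.
by apply/count_memPn/negP=> /vs [].
Qed.

Lemma same_orbitE rho rho' (s s' : seq (ptilde K * nat)) : Ftilde rho -> Ftilde rho' ->
  realizes s rho -> realizes s' rho' ->
  same_orbit rho rho' <-> exists2 Q, Q \in unitmx & perm_eq s (map (act_idx Q) s').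
Proof.
move=> F F' rs rs'; split=> [[Q [uQ H]]|[Q uQ H]]; exists Q => //.
  by apply/(act_idx_count uQ F F' rs rs').
by split=> //; apply/(act_idx_count uQ F F' rs rs').
Qed.
End Existence.

Theorem theorem3p5 (K : fieldType) (hK : 2%N \notin [pchar K]) :
  (forall A : mpair K, skew_pair A ->
     exists rho, Ftilde rho /\
       exists s, realizes s rho /\ wcong A (Atilde_seq s)) /\
  (forall rho rho' : ptilde K -> nat -> nat, Ftilde rho -> Ftilde rho' ->
     forall s s', realizes s rho -> realizes s' rho' ->
       (wcong (Atilde_seq s) (Atilde_seq s') <-> same_orbit rho rho')).
Proof.
split=> [A skA|rho rho' F F' s s' rs rs'].
  have [s vs cs] := skew_decomposition hK skA.
  exists (fun x d => count_mem (x, d) s); split; first exact: Ftilde_count.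
  exists s; split=> //; apply/wcongE; exists 1%:M; first exact: unitmx1.
  by rewrite act_right1.
have vs := realizes_valid F rs; have vs' := realizes_valid F' rs'.
rewrite wcongE (same_orbitE F F' rs rs'); split=> [[T uT c]|[Q uQ e]].
  have uQ : hat T \in unitmx by rewrite hat_unit.
  exists (hat T) => //; apply: cong_perm => //.
    move=> _ /mapP [[x d] xs ->]; have [d0 v] := vs' _ xs.
    split=> // g {d0 xs} /=; case: x v => [h|] //= v [<-].
    by case: (act_P_spec uQ (v h erefl)).
  (* Both sides are now acted on by the same [T]; undoing it leaves a strict congruence, to which
     uniqueness applies. *)
  have c' := cong_trans c (cong_sym (Atilde_act uT vs')).
  by have := cong_act (invmx T) c'; rewrite !act_rightM mulmxV // !act_right1.
(* [hat] is an involution, so acting on the pair by [hat Q] relabels the blocks by [Q]. *)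
exists (hat Q); first by rewrite hat_unit.
have := @Atilde_act K (hat Q) s' _ vs'; rewrite hatK hat_unit => /(_ uQ).
by apply: cong_trans; apply/cong_act/Atilde_perm.
Qed.
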